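(* Let $T_A$ be the rearrangement group of the Airplane limit space, and let $rist(C_0)$ and $rist(Hor)$ be the rigid stabilizers of the central component $C_0$ and of the horizon $Hor$. Then $$T_A=\langle rist(C_0),\,rist(Hor)\rangle ,$$ where $rist(C_0)$ is isomorphic to Thompson's group $T$ and $rist(Hor)$ is isomorphic to Thompson's group $F$.
   Context: The Airplane rearrangement group $T_A$. Graphs are finite directed multigraphs with edges coloured red or blue. The base graph $\Gamma$ has vertices $l,a,b,r$, blue edges $e_L:a\to l$ and $e_R:b\to r$, and red edges $e_U:b\to a$ and $e_D:a\to b$. Replacement rules: a red edge from $v_i$ to $v_t$ is replaced by the graph with vertices $v_i,v_t$ and two new vertices $m,w$, with red edges $\mathsf r_1:v_i\to m$, $\mathsf r_2:m\to v_t$ and a blue edge $\mathsf s:m\to w$; a blue edge from $v_i$ to $v_t$ is replaced by the graph with vertices $v_i,v_t$ and two new vertices $x,y$, with blue edges $\mathsf b_-:x\to v_i$, $\mathsf b_+:y\to v_t$ and red edges $\mathsf u:y\to x$, $\mathsf d:x\to y$. An expansion is any graph obtained from $\Gamma$ by finitely many (possibly zero) replacements of single edges. Each edge of an expansion is named by the finite word $e_0e_1\cdots e_k$ recording the edge $e_0$ of $\Gamma$ from which it descends and the successive edges of replacement graphs. Let $\Gamma_0=\Gamma$, and let $\Gamma_{n+1}$ be obtained from $\Gamma_n$ by replacing every edge. Let $\Omega$ be the set of infinite words all of whose finite nonempty prefixes name edges (topologized as a subspace of a product of finite discrete sets). Two such words $e_0e_1\cdots$ and $f_0f_1\cdots$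 are equivalent if for every $n$ the edges $e_0\cdots e_n$ and $f_0\cdots f_n$ of $\Gamma_n$ share at least one vertex; this is an equivalence relation, and the Airplane limit space $A$ is the quotient of $\Omega$ by it, with the quotient topology. Each vertex $v$ of an expansion is identified with the point of $A$ represented by the words all of whose sufficiently long prefixes name edges incident to $v$. The cell $\chi(e)$ of an edge $e$ is the set of points of $A$ represented by words beginning with $e$; it has the colour of $e$. A cellular partition is a cover of $A$ by finitely many cells with pairwise disjoint interiors. If $e,e'$ are edges of the same colour, the canonical homeomorphism $\chi(e)\to\chi(e')$ sends the class of $ew$ to the class of $e'w$. A rearrangement is a homeomorphism $f:A\to A$ for which there is a cellular partition such that $f$ restricts on each of its cells to a canonical homeomorphism onto some cell. Rearrangements form a group $T_A$ under composition. We say $f\in T_A$ extends canonically on a cell if it restricts on it to a canonical homeomorphism onto some cell. Components. The central component $C_0$ corresponds to the pair of red edges $e_U,e_D$ of $\Gamma$; every blue edge $e$ of an expansion determines another component, corresponding to the pair of red edges $e\mathsf u,e\mathsf d$. (In the plane, components are the regions enclosed by such pairs of red edges.) The boundary $\partial C$ of the component with red edges $c_1,c_2$ is the set of points represented by words $c_iw$ with all letters of $w$ in $\{\mathsf r_1,\mathsf r_2\}$; it is homeomorphic to a circle. Each $f\in T_A$ maps boundaries of components to boundaries of components, hence acts on the set of components. Rigid stabilizers. The blue cells departing from $C_0$ are the primary blue cells, i.e. those blue cells that are maximal under inclusion; $rist(C_0)$ is the group of all $f\in T_A$ that map $C_0$ to itself and extend canonically on the blue cells departing from $C_0$. The left (resp.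 right) horizontal ray is the set of points represented by words $e_Lw$ (resp. $e_Rw$) where $w$ does not contain the letter $\mathsf s$, minus its two extreme points $a,l$ (resp. $b,r$). $Hor$ is the union of the two horizontal rays and $\partial C_0$; its extremes are the points $l$ and $r$. The components lying on $Hor$ are $C_0$ and those determined by blue edges $e_Lt$ or $e_Rt$ with $t$ a finite (possibly empty) word in $\mathsf b_-,\mathsf b_+$. $rist(Hor)$ is the group of all $f\in T_A$ that map $Hor$ to itself, fix each of the extremes $l$ and $r$, and extend canonically on the two red cells (the cells of the pair of red edges) of each component lying on $Hor$. Thompson's groups. A dyadic subdivision of $[0,1]$ is a partition obtained by finitely many times halving intervals, starting from $[0,1]$; dyadic subdivisions of $S^1=[0,1]/\{0,1\}$ are their images. $F$ (resp. $T$) is the group of orientation-preserving piecewise linear homeomorphisms of $[0,1]$ (resp. $S^1$) that map linearly the intervals of one dyadic subdivision onto those of another. *)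

(* Defs.v *)
From HB Require Import structures.
From mathcomp Require Import all_boot all_order all_algebra.
From mathcomp Require Import all_classical all_reals all_analysis.

Set Implicit Arguments.
Unset Strict Implicit.
Unset Printing Implicit Defensive.

Import Order.TTheory GRing.Theory Num.Theory numFieldNormedType.Exports.

Local Open Scope classical_set_scope.
Local Open Scope ring_scope.
Local Open Scope quotient_scope.

Record homeo (X : topologicalType) := Homeo {
  homeo_fun :> X -> X;
  homeo_inv : X -> X;
  homeo_funK : cancel homeo_fun homeo_inv;
  homeo_invK : cancel homeo_inv homeo_fun;
  homeo_fun_continuous : continuous homeo_fun;
  homeo_inv_continuous : continuous homeo_inv }.

Section HomeoGroup.
Variable X : topologicalType.
Implicit Types f g h : homeo X.

Lemma homeoP f g : f =1 g -> f = g.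
Proof.
case: f g => [f f' fK f'K cf cf'] [g g' gK g'K cg cg'] /= /funext fg; subst g.
have fg' : f' = g'.
  by apply: funext => x; rewrite -[in LHS](g'K x) fK.
by subst g'; congr Homeo; exact: Prop_irrelevance.
Qed.

Definition homeo_one : homeo X :=
  @Homeo X idfun idfun (fun=> erefl) (fun=> erefl) (fun=> cvg_id) (fun=> cvg_id).

Lemma homeo_comp_continuous f g : continuous (f \o g).
Proof. by move=> x; apply: continuous_comp; exact: homeo_fun_continuous. Qed.

Lemma homeo_comp_inv_continuous f g : continuous (homeo_inv g \o homeo_inv f).
Proof. by move=> x; apply: continuous_comp; exact: homeo_inv_continuous. Qed.

Definition homeo_comp f g : homeo X :=
  Homeo (can_comp (homeo_funK f) (homeo_funK g))
    (can_comp (homeo_invK g) (homeo_invK f))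
    (@homeo_comp_continuous f g) (@homeo_comp_inv_continuous f g).

Definition homeo_sym f : homeo X :=
  Homeo (homeo_invK f) (homeo_funK f)
    (@homeo_inv_continuous _ f) (@homeo_fun_continuous _ f).

Lemma homeo_compA : associative homeo_comp.
Proof. by move=> f g h; exact: homeoP. Qed.
Lemma homeo_comp1f : left_id homeo_one homeo_comp.
Proof. by move=> f; exact: homeoP. Qed.
Lemma homeo_compf1 : right_id homeo_one homeo_comp.
Proof. by move=> f; exact: homeoP. Qed.
Lemma homeo_compVf : left_inverse homeo_one homeo_sym homeo_comp.
Proof. by move=> f; apply: homeoP => x; exact: homeo_funK. Qed.
Lemma homeo_compfV : right_inverse homeo_one homeo_sym homeo_comp.
Proof. by move=> f; apply: homeoP => x; exact: homeo_invK. Qed.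

HB.instance Definition _ := gen_eqMixin (homeo X).
HB.instance Definition _ := gen_choiceMixin (homeo X).
HB.instance Definition _ := isGroup.Build (homeo X)
  homeo_compA homeo_comp1f homeo_compf1 homeo_compVf homeo_compfV.
End HomeoGroup.

Definition subgroup (G : groupType) (H : set G) : Prop := group_closed (mem H).

Definition generated (G : groupType) (S : set G) : set G :=
  smallest (@subgroup G) S.

Definition isomorphic (G G' : groupType) (H : set G) (K : set G') : Prop :=
  [/\ subgroup H, subgroup K &
      exists2 phi : G -> G', set_bij H K phi &
        {in H &, {morph phi : x y / (x * y)%g}}].

(* [rs], [bu] and [bd] are the letters s, u and d. *)
Inductive letter := eL | eR | eU | eD | r1 | r2 | rs
  | b_minus | b_plus | bu | bd.
Inductive base_vertex := vl | va | vb | vr.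
Inductive new_vertex := nm | nw | nx | ny.
Inductive colour := Red | Blue.

Lemma letter_eq_dec : comparable letter.
Proof. by rewrite /comparable /decidable; decide equality. Defined.
HB.instance Definition _ := hasDecEq.Build letter (compareP letter_eq_dec).
HB.instance Definition _ := gen_choiceMixin letter.

Lemma base_vertex_eq_dec : comparable base_vertex.
Proof. by rewrite /comparable /decidable; decide equality. Defined.
HB.instance Definition _ :=
  hasDecEq.Build base_vertex (compareP base_vertex_eq_dec).

Lemma new_vertex_eq_dec : comparable new_vertex.
Proof. by rewrite /comparable /decidable; decide equality. Defined.
HB.instance Definition _ :=
  hasDecEq.Build new_vertex (compareP new_vertex_eq_dec).

Lemma colour_eq_dec : comparable colour.
Proof. by rewrite /comparable /decidable; decide equality. Defined.
HB.instance Definition _ := hasDecEq.Build colour (compareP colour_eq_dec).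

Definition word := seq letter.

(* [inr (p, k)] is the vertex [k] of the replacement graph glued in when the
   edge named [p] is replaced. *)
Definition vertex := (base_vertex + word * new_vertex)%type.

Record edge := Edge { name : word; col : colour; src : vertex; tgt : vertex }.

Definition edge_code (e : edge) := (name e, col e, src e, tgt e).
Definition edge_decode (c : word * colour * vertex * vertex) :=
  let: (p, k, v, v') := c in Edge p k v v'.
Lemma edge_codeK : cancel edge_code edge_decode.
Proof. by case. Qed.
HB.instance Definition _ := Equality.copy edge (can_type edge_codeK).

Definition ends (e : edge) : seq vertex := [:: src e; tgt e].

(* No isolated vertex ever occurs, so a graph is given by its edges. *)
Definition graph := seq edge.

Definition base_graph : graph :=
  [:: Edge [:: eL] Blue (inl va) (inl vl);
      Edge [:: eR] Blue (inl vb) (inl vr);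
      Edge [:: eU] Red (inl vb) (inl va);
      Edge [:: eD] Red (inl va) (inl vb)].

Definition replacement (e : edge) : graph :=
  let new k : vertex := inr (name e, k) in
  let child := rcons (name e) in
  match col e with
  | Red => [:: Edge (child r1) Red (src e) (new nm);
               Edge (child r2) Red (new nm) (tgt e);
               Edge (child rs) Blue (new nm) (new nw)]
  | Blue => [:: Edge (child b_minus) Blue (new nx) (src e);
                Edge (child b_plus) Blue (new ny) (tgt e);
                Edge (child bu) Red (new ny) (new nx);
                Edge (child bd) Red (new nx) (new ny)]
  end.

Inductive expansion : graph -> Prop :=
| expansion_base : expansion base_graph
| expansion_step G1 e G2 : expansion (G1 ++ e :: G2) ->
    expansion (G1 ++ replacement e ++ G2).

Definition is_edge (e : edge) : Prop := exists2 G, expansion G & e \in G.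

Fixpoint full_expansion (n : nat) : graph :=
  if n is m.+1 then flatten (map replacement (full_expansion m))
  else base_graph.

Definition stream : topologicalType := {ptws nat -> discrete_topology letter}.

Definition Omega : set stream :=
  [set w | forall n, exists2 e, is_edge e & name e = mkseq w n.+1].

Definition glued (w v : Omega) : Prop :=
  forall n, exists e f, [/\ e \in full_expansion n, f \in full_expansion n,
    name e = mkseq (val w) n.+1, name f = mkseq (val v) n.+1
    & exists2 x, x \in ends e & x \in ends f].

Lemma full_expansionP n e :
  e \in full_expansion n.+1 <->
  exists2 p, p \in full_expansion n & e \in replacement p.
Proof.
rewrite /=; split=> [/flattenP [s /mapP [p pG ->] es]|[p pG ep]].
  by exists p.
by apply/flattenP; exists (replacement p) => //; exact: map_f.
Qed.

Lemma replacement_name p e : e \in replacement p ->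
  exists c, name e = rcons (name p) c.
Proof.
rewrite /replacement; case: (col p); rewrite !inE.
  by case/or3P => /eqP ->; eexists; reflexivity.
by case/or4P => /eqP ->; eexists; reflexivity.
Qed.

Lemma replacement_name_inj p e f : e \in replacement p -> f \in replacement p ->
  name e = name f -> e = f.
Proof.
rewrite /replacement; case: (col p); rewrite !inE.
  by case/or3P => /eqP ->; case/or3P => /eqP -> //= /rcons_inj [].
by case/or4P => /eqP ->; case/or4P => /eqP -> //= /rcons_inj [].
Qed.

Lemma replacement_ends p e x : e \in replacement p -> x \in ends e ->
  x \in ends p \/ exists k, x = inr (name p, k).
Proof.
rewrite /replacement /ends; case: (col p); rewrite !inE.
  by case/or3P => /eqP -> /=; case/orP => /eqP ->;
    rewrite ?eqxx ?orbT; (by left) || (by right; eexists).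
by case/or4P => /eqP -> /=; case/orP => /eqP ->;
  rewrite ?eqxx ?orbT; (by left) || (by right; eexists).
Qed.

Lemma full_expansion_name n e : e \in full_expansion n -> size (name e) = n.+1.
Proof.
elim: n e => [|n IH] e.
  by rewrite !inE => /or4P [] /eqP ->.
move=> /full_expansionP [p /IH sp /replacement_name [c ->]].
by rewrite size_rcons sp.
Qed.

Lemma full_expansion_name_inj n e f :
  e \in full_expansion n -> f \in full_expansion n -> name e = name f -> e = f.
Proof.
elim: n e f => [|n IH] e f.
  by rewrite !inE => /or4P [] /eqP -> /or4P [] /eqP ->.
move=> /full_expansionP [p pG ep] /full_expansionP [q qG fq] ef.
have [c ec] := replacement_name ep; have [d fd] := replacement_name fq.
have pq : p = q by apply: IH => //; move: (ef); rewrite ec fd => /rcons_inj [].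
by subst q; exact: (replacement_name_inj ep fq ef).
Qed.

Lemma full_expansion_ends n e x p k :
  e \in full_expansion n -> x \in ends e -> x = inr (p, k) -> (size p <= n)%N.
Proof.
elim: n e => [|n IH] e.
  by rewrite !inE => /or4P [] /eqP -> /orP [] /eqP ->.
move=> /full_expansionP [q qG eq] xe xpk.
have [xq|[k' xk']] := replacement_ends eq xe; first exact/leqW/(IH q).
by move: xk'; rewrite xpk => -[-> _]; rewrite (full_expansion_name qG).
Qed.

Lemma replacement_old_end n p e x y : p \in full_expansion n ->
  e \in replacement p -> x \in ends e -> y \in ends e ->
  x \in ends p -> y \in ends p -> x = y.
Proof.
move=> pG ep xe ye xp yp.
have new k : inr (name p, k) \notin ends p.
  apply/negP => /(full_expansion_ends pG) /(_ erefl).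
  by rewrite (full_expansion_name pG) ltnn.
move: ep xe ye xp yp; rewrite /replacement; case: (col p); rewrite !inE.
  by case/or3P => /eqP -> /= /orP [] /eqP -> /orP [] /eqP -> //;
    move: (new nm) (new nw); rewrite !inE => /negPf n1 /negPf n2; rewrite ?n1 ?n2.
by case/or4P => /eqP -> /= /orP [] /eqP -> /orP [] /eqP -> //;
  move: (new nx) (new ny); rewrite !inE => /negPf n1 /negPf n2; rewrite ?n1 ?n2.
Qed.

Lemma replacement_common_end n p q e f x :
  p \in full_expansion n -> q \in full_expansion n -> p != q ->
  e \in replacement p -> f \in replacement q -> x \in ends e -> x \in ends f ->
  x \in ends p /\ x \in ends q.
Proof.
move=> pG qG pq ep fq xe xf.
have [xp|[k xk]] := replacement_ends ep xe;
  have [xq|[k' xk']] := replacement_ends fq xf => //.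
- by have := full_expansion_ends pG xp xk'; rewrite (full_expansion_name qG) ltnn.
- by have := full_expansion_ends qG xq xk; rewrite (full_expansion_name pG) ltnn.
- case/eqP: pq; apply: (full_expansion_name_inj pG qG).
  by move: xk; rewrite xk' => -[].
Qed.

Lemma expansion_full G e : expansion G -> e \in G ->
  e \in full_expansion (size (name e)).-1.
Proof.
move=> exG; elim: exG e => [|G1 p G2 _ IH] e.
  by rewrite !inE => /or4P [] /eqP ->.
rewrite !mem_cat orbCA => /orP [ep|eG]; last first.
  by apply: IH; rewrite mem_cat inE orbCA eG orbT.
have pG := IH p; rewrite mem_cat inE eqxx orbT in pG.
have {}pG := pG isT; have := full_expansion_name pG.
have [c ->] := replacement_name ep; rewrite size_rcons /=.
by case: (size _) pG => // m pG _; apply/full_expansionP; exists p.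
Qed.

Lemma Omega_full (w : Omega) n :
  exists2 e, e \in full_expansion n & name e = mkseq (val w) n.+1.
Proof.
have [e [G exG eG] ew] := set_valP w n; exists e => //.
by have := expansion_full exG eG; rewrite ew size_mkseq.
Qed.

Lemma full_expansion_parent (w : Omega) n e :
  e \in full_expansion n.+1 -> name e = mkseq (val w) n.+2 ->
  exists p, [/\ p \in full_expansion n, e \in replacement p
              & name p = mkseq (val w) n.+1].
Proof.
move=> /full_expansionP [p pG ep] ew; exists p; split=> //.
by have [c ec] := replacement_name ep; move: ew; rewrite ec mkseqS => /rcons_inj [].
Qed.

Lemma glued_refl w : glued w w.
Proof.
move=> n; have [e eG ew] := Omega_full w n; exists e, e; split=> //.
by exists (src e); rewrite mem_head.
Qed.

Lemma glued_sym w v : glued w v -> glued v w.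
Proof.
by move=> wv n; have [e [f [eG fG ew fv [x xe xf]]]] := wv n;
  exists f, e; split=> //; exists x.
Qed.

Lemma glued_trans v w u : glued w v -> glued v u -> glued w u.
Proof.
move=> wv vu n.
have [p pG pw] := Omega_full w n; have [q qG qv] := Omega_full v n.
have [z zG zu] := Omega_full u n.
have [pq|pq] := eqVneq p q.
  have [e [f [eG fG ev fu ef]]] := vu n; exists e, f; split=> //.
  by rewrite ev -qv -pq.
have [qz|qz] := eqVneq q z.
  have [e [f [eG fG ew fv ef]]] := wv n; exists e, f; split=> //.
  by rewrite fv -qv qz.
have [e [f [eG fG ew fv [x xe xf]]]] := wv n.+1.
have [f' [g [fG' gG fv' gu [y yf yg]]]] := vu n.+1.
have ff' : f' = f by apply: (full_expansion_name_inj fG' fG); rewrite fv fv'.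
subst f'.
have parent (t : Omega) r h : r \in full_expansion n ->
    name r = mkseq (val t) n.+1 -> h \in full_expansion n.+1 ->
    name h = mkseq (val t) n.+2 -> h \in replacement r.
  move=> rG rt hG ht; have [r' [rG' hr rt']] := full_expansion_parent hG ht.
  suff <- : r' = r by [].
  by apply: (full_expansion_name_inj rG' rG); rewrite rt.
have ep := parent _ _ _ pG pw eG ew; have fq := parent _ _ _ qG qv fG fv.
have go := parent _ _ _ zG zu gG gu.
have [xp xq] := replacement_common_end pG qG pq ep fq xe xf.
have [yq yz] := replacement_common_end qG zG qz fq go yf yg.
exists p, z; split=> //; exists x => //.
by rewrite (replacement_old_end qG fq xf yf xq yq).
Qed.

Lemma glued_equiv_class : equiv_class_of (fun w v => `[< glued w v >]).
Proof.
split=> [w|w v|v w u]; first exact/asboolP/glued_refl.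
  by apply/asboolP/asboolP; exact: glued_sym.
by move=> /asboolP wv /asboolP vu; exact/asboolP/(glued_trans wv vu).
Qed.

Definition glued_equiv : equiv_rel Omega := EquivRelPack glued_equiv_class.

Definition Airplane : topologicalType := quotient_topology {eq_quot glued_equiv}.

Definition pt (w : Omega) : Airplane := \pi_Airplane w.

Definition prepend (p : word) (u : stream) : stream :=
  fun n => if (n < size p)%N then nth eL p n else u (n - size p)%N.

Definition cell (e : edge) : set Airplane :=
  [set x | exists w : Omega, x = pt w /\ exists u, val w = prepend (name e) u].

Definition vertex_point (v : vertex) : set Airplane :=
  [set x | exists w : Omega, x = pt w /\
     \forall n \near \oo, exists2 e, is_edge e &
       name e = mkseq (val w) n /\ v \in ends e].

Definition cellular_partition (P : seq edge) : Prop :=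
  [/\ {in P, forall e, is_edge e},
      \bigcup_(e in [set` P]) cell e = [set: Airplane]
    & {in P &, forall e e', e != e' ->
        interior (cell e) `&` interior (cell e') = set0}].

(* The class of [name e] followed by [u] is sent to that of [name e'] followed
   by the same [u]. *)
Definition restricts_canonically (f : Airplane -> Airplane) (e e' : edge) : Prop :=
  col e = col e' /\
  forall (w : Omega) u, val w = prepend (name e) u ->
    exists2 w' : Omega, val w' = prepend (name e') u & f (pt w) = pt w'.

Definition extends_canonically (f : Airplane -> Airplane) (e : edge) : Prop :=
  exists2 e', is_edge e' & restricts_canonically f e e'.

Definition TA : set (homeo Airplane) :=
  [set f | exists2 P, cellular_partition P &
             {in P, forall e, extends_canonically f e}].

Inductive component := Central | OfBlue of edge.

Definition is_component (C : component) : Prop :=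
  if C is OfBlue e then is_edge e /\ col e = Blue else True.

(* A component is determined by the words naming its two red edges. *)
Definition red_pair (C : component) : seq word :=
  match C with
  | Central => [:: [:: eU]; [:: eD]]
  | OfBlue e => [:: rcons (name e) bu; rcons (name e) bd]
  end.

Definition boundary (C : component) : set Airplane :=
  [set x | exists (w : Omega) c u, [/\ x = pt w, c \in red_pair C,
     val w = prepend c u & forall n, u n \in [:: r1; r2]]].

Definition maps_component (f : Airplane -> Airplane) (C D : component) : Prop :=
  f @` boundary C = boundary D.

Definition primary_blue (e : edge) : Prop :=
  [/\ is_edge e, col e = Blue &
      forall e', is_edge e' -> col e' = Blue ->
        cell e `<=` cell e' -> cell e' = cell e].

Definition rist_C0 : set (homeo Airplane) :=
  [set f | [/\ TA f, maps_component f Central Central &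
               forall e, primary_blue e -> extends_canonically f e]].

Definition horizontal_ray (c : letter) (v v' : vertex) : set Airplane :=
  [set x | exists (w : Omega) u, [/\ x = pt w, val w = prepend [:: c] u &
     forall n, u n != rs]] `\` (vertex_point v `|` vertex_point v').

Definition left_ray := horizontal_ray eL (inl va) (inl vl).
Definition right_ray := horizontal_ray eR (inl vb) (inl vr).

Definition Hor : set Airplane := left_ray `|` right_ray `|` boundary Central.

Definition lies_on_Hor (C : component) : Prop :=
  is_component C /\
  match C with
  | Central => True
  | OfBlue e => exists c t, [/\ c \in [:: eL; eR], name e = c :: t &
                                all (mem [:: b_minus; b_plus]) t]
  end.

Definition rist_Hor : set (homeo Airplane) :=
  [set f | [/\ TA f, f @` Hor = Hor,
               {in vertex_point (inl vl) `|` vertex_point (inl vr),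
                 forall x, f x = x} &
               forall C e, lies_on_Hor C -> is_edge e -> name e \in red_pair C ->
                 extends_canonically f e]].

Section Thompson.
Variable R : realType.

Inductive dyadic_subdivision : seq (R * R) -> Prop :=
| dyadic_unit : dyadic_subdivision [:: (0, 1)]
| dyadic_halve s1 a b s2 : dyadic_subdivision (s1 ++ (a, b) :: s2) ->
    dyadic_subdivision (s1 ++ [:: (a, (a + b) / 2); ((a + b) / 2, b)] ++ s2).

Definition unit_itv : topologicalType := `[0, 1]%classic : set R.

Definition same_circle_point (s t : unit_itv) : bool :=
  (val s == val t) ||
  (val s \in [:: 0; 1 : R]) && (val t \in [:: 0; 1 : R]).

Lemma same_circle_point_equiv : equiv_class_of same_circle_point.
Proof.
split=> [s|s t|t s u]; rewrite /same_circle_point.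
- by rewrite eqxx.
- by rewrite eq_sym andbC.
- move=> /orP [/eqP <- //|/andP [s01 t01]] /orP [/eqP <-|/andP [_ u01]].
    by rewrite s01 t01 orbT.
  by rewrite s01 u01 orbT.
Qed.

Definition circle : topologicalType :=
  quotient_topology {eq_quot EquivRelPack same_circle_point_equiv}.

Definition circle_pt (s : unit_itv) : circle := \pi_circle s.

(* [p] is the projection of [0, 1] to [X]: the identity for F, the quotient
   map to the circle for T. *)
Definition maps_linearly_onto (X : Type) (p : unit_itv -> X) (f : X -> X)
    (J K : R * R) : Prop :=
  exists alpha beta : R,
    (fun t => alpha * t + beta) @` `[J.1, J.2] = `[K.1, K.2]%classic /\
    forall s t : unit_itv, val s \in `[J.1, J.2] ->
      val t = alpha * val s + beta -> f (p s) = p t.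

(* Linearity on the intervals of [D] subsumes piecewise linearity. *)
Definition dyadic_map (X : Type) (p : unit_itv -> X) (f : X -> X) : Prop :=
  exists D E, [/\ dyadic_subdivision D, dyadic_subdivision E,
    {in D, forall J, exists2 K, K \in E & maps_linearly_onto p f J K}
    & {in E, forall K, exists2 J, J \in D & maps_linearly_onto p f J K}].

Definition increasing (f : unit_itv -> unit_itv) : Prop :=
  forall s t, val s < val t -> val (f s) < val (f t).

(* The representatives are taken in [0, 1[, where they are unique. *)
Definition counterclockwise (x y z : circle) : Prop :=
  exists s t u : unit_itv,
    [/\ x = circle_pt s, y = circle_pt t, z = circle_pt u,
        val s < 1 /\ val t < 1 /\ val u < 1
      & [\/ val s < val t < val u, val t < val u < val s
          | val u < val s < val t]].

Definition cyclic_order_preserving (f : circle -> circle) : Prop :=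
  forall x y z, counterclockwise x y z -> counterclockwise (f x) (f y) (f z).

Definition thompson_F : set (homeo unit_itv) :=
  [set f | increasing f /\ dyadic_map id f].

Definition thompson_T : set (homeo circle) :=
  [set f | cyclic_order_preserving f /\ dyadic_map circle_pt f].

End Thompson.

Arguments thompson_F : clear implicits.
Arguments thompson_T : clear implicits.

(* Main.v *)
From HB Require Import structures.
From mathcomp Require Import all_boot all_order all_algebra.
From mathcomp Require Import all_classical all_reals all_analysis.
From mathcomp Require Import ring lra zify.
Require Import Defs.

Set Implicit Arguments.
Unset Strict Implicit.
Unset Printing Implicit Defensive.

Local Open Scope classical_set_scope.

(** An infinite word addresses a point of the Airplane. Renaming the base edges
    makes the addresses the streams of a two-state automaton, and two addresses
    name the same point exactly when they are related by the explicit relation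
    [glue] ([P_glue]). Rearrangements are then the homeomorphisms that act on all
    long enough cells by replacing a prefix of the addresses ([TA_tame]). Binary
    expansions describe the interval and the circle in the same style, and there
    the homeomorphisms replacing prefixes are the elements of Thompson's groups
    ([thompson_F_tame], [thompson_T_tame]).

    The boundary of the central component is parametrized by binary words, glued
    as on the circle. An element of [rist_C0] acts on it as an element of [T], and
    this action determines it, because the maximal blue cells follow the points to
    which they are attached; conversely every element of [T] extends
    ([rist_C0_iso]). The horizon is parametrized in the same way, except that a
    dyadic number corresponds to a whole component lying on the horizon. An
    element of [rist_Hor] fixes [l] and [r], so it preserves the direction of the
    horizon; it acts as an element of [F] and the components follow their dyadic
    numbers ([rist_Hor_iso]).

    For generation, call a blue cell singular for a rearrangement [f] when [f] does
    not map it canonically, possibly after a half turn, onto a cell. There are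
    finitely many singular cells, and the proof is an induction on their number
    ([in_subgroup]). An element of [rist_C0] has none. Two elements [x] and [z] of
    [rist_Hor] have one and two of them respectively, and all of these are singular
    for the inverse of [f] when they contain the image of the central component;
    composing with them then creates no singular cell and moves that image closer
    to the center, until it is the central component ([move_center]). An element
    of [rist_C0] makes [f] fix the central circle pointwise. Each branch at the
    circle is then preserved ([branch_stable]), so [f] is the product of a
    rearrangement supported on a single branch, moved to the right half by
    [rist_C0], and of one with fewer singular cells ([branch_factor]). Finally a
    rearrangement supported on the right half acts canonically near its fixed
    attaching point; composing with [z] makes it the identity on the cell next to
    that point, and its conjugate by [x] has one singular cell less, being the
    identity on the left half ([supported_in]). *)

(** * Streams over an automaton *)

Section Streams.
Variable L : eqType.
Implicit Types (a b : L) (p q r : seq L) (u v w : nat -> L).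

Definition scons a u : nat -> L := fun n => if n is m.+1 then u m else a.

Fixpoint sapp p u : nat -> L := if p is a :: p' then scons a (sapp p' u) else u.

Definition sdrop n u : nat -> L := fun k => u (n + k).

Definition cst a : nat -> L := fun=> a.

Lemma scons_inj a b u v : scons a u = scons b v -> a = b /\ u = v.
Proof.
move=> e; split; first by have := congr1 (fun f => f 0) e.
by apply: funext => n; have := congr1 (fun f => f n.+1) e.
Qed.

Lemma scons_eta u : u = scons (u 0) (sdrop 1 u).
Proof. by apply: funext => -[]. Qed.

Lemma cstE a : cst a = scons a (cst a).
Proof. by apply: funext => -[]. Qed.

Lemma sapp_cat p q u : sapp (p ++ q) u = sapp p (sapp q u).
Proof. by elim: p => //= a p ->. Qed.

Lemma sapp_rcons p a u : sapp (rcons p a) u = sapp p (scons a u).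
Proof. by rewrite -cats1 sapp_cat. Qed.

Lemma sapp_inj p : injective (sapp p).
Proof. by elim: p => //= a p IH u v /scons_inj[_ /IH]. Qed.

Lemma sapp_mkseq n u : sapp (mkseq u n) (sdrop n u) = u.
Proof.
elim: n u => [|n IH] u; first exact: funext.
rewrite [RHS]scons_eta -[in RHS](IH (sdrop 1 u)) /mkseq /=.
congr (scons _ (sapp _ _)).
by rewrite -[1]/(0.+1) (iotaDl 1) -map_comp.
Qed.

Lemma mkseq_scons a u n : mkseq (scons a u) n.+1 = a :: mkseq u n.
Proof. by rewrite /mkseq /= -[1]/(1 + 0) iotaDl -map_comp. Qed.

Lemma mkseq_sapp p u n : mkseq (sapp p u) (size p + n) = p ++ mkseq u n.
Proof. by elim: p => //= a p IH; rewrite addSn mkseq_scons IH. Qed.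

Lemma mkseq_sapp_size p u : mkseq (sapp p u) (size p) = p.
Proof. by rewrite -[size p]addn0 mkseq_sapp cats0. Qed.

Lemma mkseq_sapp_take p u n : n <= size p -> mkseq (sapp p u) n = take n p.
Proof.
by elim: p n => [|a p IH] [|n] // /IH h; rewrite /sapp -/sapp mkseq_scons h.
Qed.

Lemma sapp_eq p q u v : sapp p u = sapp q v -> size p = size q ->
  p = q /\ u = v.
Proof.
elim: p q => [|a p IH] [|b q] //= /scons_inj[-> /IH h] [/h[-> ->]] //.
Qed.

Lemma sapp_prefix p q u v : sapp p u = sapp q v -> size p <= size q ->
  exists2 r, q = p ++ r & u = sapp r v.
Proof.
elim: p q => [|a p IH] [|b q] //=; [by exists [::]|by exists (b :: q)|].
by rewrite ltnS => /scons_inj[-> /IH h] /h[r -> ->]; exists r.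
Qed.

Lemma sapp_nseq_cst n a : sapp (nseq n a) (cst a) = cst a.
Proof. by elim: n => //= n ->; rewrite -cstE. Qed.

Local Notation "p +++ u" := (sapp p u) (at level 60, right associativity).

Lemma mkseq_eqP n u v :
  mkseq u n = mkseq v n <-> forall k, k < n -> u k = v k.
Proof.
split=> [e k kn|h]; first by rewrite -(nth_mkseq (u 0) u kn) e nth_mkseq.
apply: (@eq_from_nth _ (u 0)); rewrite !size_mkseq // => i ni.
by rewrite !nth_mkseq // h.
Qed.

Lemma sappE p u k :
  (p +++ u) k = if k < size p then nth (u 0) p k else u (k - size p).
Proof.
by elim: p k => [|a p IH] k /=; [rewrite subn0|case: k => //= k; rewrite IH].
Qed.

Lemma first_difference u v : u <> v -> exists p a b u' v',
  [/\ a != b, u = p +++ scons a u' & v = p +++ scons b v'].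
Proof.
move=> uv; have [n hn] : exists n, u n != v n.
  by apply: contrapT => /forallNP h; apply: uv; apply: funext => n; have /negP := h n; rewrite negbK => /eqP.
have := ex_minnP (ex_intro (fun n => u n != v n) n hn) => -[m hm min].
exists (mkseq u m), (u m), (v m), (sdrop m.+1 u), (sdrop m.+1 v).
have d w : sdrop m w = scons (w m) (sdrop m.+1 w).
  by apply: funext => -[|k]; rewrite /sdrop /= ?addn0 ?addnS ?addSn.
split=> //; first by rewrite -d sapp_mkseq.
suff -> : mkseq u m = mkseq v m by rewrite -d sapp_mkseq.
apply/mkseq_eqP => k km; apply/eqP; apply: contraT => /min; rewrite leqNgt km //.
Qed.

(** [ok c a] tells whether the letter [a] can be read in the state [c], and [nx c a]
    is the next state. *)
Variables (C : Type) (ok : C -> L -> bool) (nx : C -> L -> C).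

Fixpoint vword c p := if p is a :: p' then ok c a && vword (nx c a) p' else true.
Definition endc c p := foldl nx c p.
Definition vstream c u := forall n, vword c (mkseq u n).

Lemma vword_cat c p q : vword c (p ++ q) = vword c p && vword (endc c p) q.
Proof. by elim: p c => //= a p IH c; rewrite IH andbA. Qed.

Lemma vword_rcons c p a : vword c (rcons p a) = vword c p && ok (endc c p) a.
Proof. by rewrite -cats1 vword_cat /= andbT. Qed.

Lemma endc_cat c p q : endc c (p ++ q) = endc (endc c p) q.
Proof. exact: foldl_cat. Qed.

Lemma endc_rcons c p a : endc c (rcons p a) = nx (endc c p) a.
Proof. by rewrite /endc foldl_rcons. Qed.

Lemma vstream_scons c a u : vstream c (scons a u) <-> ok c a /\ vstream (nx c a) u.
Proof.
split=> [h|[oka h] [|n] //]; last by rewrite mkseq_scons /= oka h.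
split=> [|n]; first by have := h 1; rewrite mkseq_scons /= => /andP[].
by have := h n.+1; rewrite mkseq_scons /= => /andP[].
Qed.

Lemma vstream_sapp c p u :
  vstream c (sapp p u) <-> vword c p /\ vstream (endc c p) u.
Proof.
elim: p c => [|a p IH] c /=; first by split => [|[]].
rewrite vstream_scons IH; split; first by move=> [-> []].
by move=> [/andP[-> ->] h].
Qed.

Lemma vstream_drop c u n : vstream c u ->
  vword c (mkseq u n) /\ vstream (endc c (mkseq u n)) (sdrop n u).
Proof. by move=> h; apply/vstream_sapp; rewrite sapp_mkseq. Qed.

End Streams.

Notation "a ::: u" := (scons a u) (at level 60, right associativity).
Notation "p +++ u" := (sapp p u) (at level 60, right associativity).

(** * Spaces presented by streams, and prefix-replacement homeomorphisms *)

(** A space covered by the streams of an automaton and carrying the quotient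
    topology ([point_open]). Every cylinder contains a generic stream, the only one
    naming its point ([point_generic]); this makes the cylinders containing a given
    cylinder recognizable. *)
Record presentation := Presentation {
  alph : eqType;
  letters : seq alph;
  clr : Type;
  clr0 : clr;
  okl : clr -> alph -> bool;
  nxt : clr -> alph -> clr;
  space : topologicalType;
  point_of : (nat -> alph) -> space;
  lettersP : forall a, a \in letters;
  okl2 : forall c a, exists2 b, b != a & okl c b;
  point_surj : forall x, exists2 u, vstream okl nxt clr0 u & point_of u = x;
  point_generic : forall p, vword okl nxt clr0 p ->
    exists2 u, vstream okl nxt (endc nxt clr0 p) u &
      forall v, vstream okl nxt clr0 v -> point_of v = point_of (p +++ u) ->
        v = p +++ u;
  point_open : forall U : set space, open U <->
    forall u, vstream okl nxt clr0 u -> U (point_of u) ->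
      exists n, forall v, vstream okl nxt clr0 v -> mkseq v n = mkseq u n ->
        U (point_of v) }.

Section Presentation.
Variable S : presentation.
Local Notation X := (space S).
Local Notation Q := (@point_of S).
Local Notation vw := (vword (@okl S) (@nxt S) (clr0 S)).
Local Notation vs := (vstream (@okl S) (@nxt S)).
Local Notation ec := (endc (@nxt S) (clr0 S)).
Implicit Types (p q r : seq (alph S)) (u v w : nat -> alph S) (f g : X -> X).

(** [f] maps the cell [p] onto the cell [q] by replacing the prefix. *)
Definition canon f p q :=
  [/\ vw q, ec p = ec q & forall u, vs (ec p) u -> f (Q (p +++ u)) = Q (q +++ u)].

(** All cells of some length are moved by prefix replacement. *)
Definition tame f := exists n, forall p, vw p -> size p = n -> exists q, canon f p q.

Lemma canon_cat f p q r : canon f p q -> vw (p ++ r) -> canon f (p ++ r) (q ++ r).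
Proof.
move=> [vq e h]; rewrite vword_cat => /andP[vp vr]; split.
- by rewrite vword_cat vq -e.
- by rewrite !endc_cat e.
move=> u; rewrite endc_cat => vu; rewrite !sapp_cat; apply: h.
by apply/vstream_sapp.
Qed.

Lemma tame_ge f : tame f -> exists n, forall m p, n <= m -> vw p -> size p = m ->
  exists q, canon f p q.
Proof.
move=> [n h]; exists n => m p nm vp sp.
rewrite -(cat_take_drop n p).
have vt : vw (take n p) by move: vp; rewrite -{1}(cat_take_drop n p) vword_cat => /andP[].
have [|q cq] := h _ vt; first by rewrite size_takel // sp.
by exists (q ++ drop n p); apply: canon_cat; rewrite ?cat_take_drop.
Qed.

(** A cell cannot sit inside a cell whose word it does not extend, because
    generic points have a single address. *)
Lemma cell_prefix p q : vw p -> vw q ->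
  (forall u, vs (ec p) u -> exists2 v, vs (ec q) v & Q (p +++ u) = Q (q +++ v)) ->
  exists r, p = q ++ r.
Proof.
move=> vp vq h.
have step z : vw (p ++ z) -> exists u v, (p ++ z) +++ u = q +++ v.
  move=> vz; have [u vu gu] := @point_generic S (p ++ z) vz.
  have vzu : vs (ec p) (z +++ u).
    by apply/vstream_sapp; move: vz; rewrite vword_cat => /andP[_ ->]; rewrite -endc_cat.
  have [v vv e] := h _ vzu; exists u, v; rewrite (gu (q +++ v)) //.
    by apply/vstream_sapp.
  by rewrite sapp_cat e.
have [sqp|spq] := leqP (size q) (size p).
  have [|u [v e]] := step [::]; first by rewrite cats0.
  by move: e; rewrite cats0 => /esym /sapp_prefix [] // r -> _; exists r.
have [u [v e]] : exists u v, p +++ u = q +++ v.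
  by have [|u [v e]] := step [::]; [|move: e]; rewrite cats0 //; exists u, v.
have [[|a r] qp _] := sapp_prefix e (ltnW spq).
  by move: spq; rewrite qp cats0 ltnn.
have [b ba okb] := @okl2 S (ec p) a.
have [|u' [v' e']] := step [:: b]; first by rewrite cats1 vword_rcons vp.
have [] := sapp_prefix e'; first by rewrite cats1 size_rcons.
move=> r'; rewrite qp -catA => /eqP; rewrite eqseq_cat // eqxx /= eqseq_cons.
by rewrite eq_sym (negPf ba).
Qed.

Lemma canon_fun f p q q' : vw p -> canon f p q -> canon f p q' -> q = q'.
Proof.
move=> vp [vq e h] [vq' e' h'].
have [r qr] : exists r, q = q' ++ r.
  apply: cell_prefix => // u; rewrite -e => vu; exists u; first by rewrite -e'.
  by rewrite -h // h'.
have [r' qr'] : exists r, q' = q ++ r.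
  apply: cell_prefix => // u; rewrite -e' => vu; exists u; first by rewrite -e.
  by rewrite -h // h'.
move: qr'; rewrite qr -catA => /(congr1 size); rewrite !size_cat => /eqP.
by rewrite -[X in X == _]addn0 eqn_add2l eq_sym addn_eq0 => /andP[/nilP -> _]; rewrite cats0.
Qed.

Lemma canon_id p : vw p -> canon id p p.
Proof. by move=> vp; split. Qed.

Lemma canon_comp f g p q r : canon f p q -> canon g q r -> canon (g \o f) p r.
Proof.
move=> [vq e h] [vr e' h']; split=> //; first by rewrite e.
by move=> u vu; rewrite /= h // h' // -e.
Qed.

Lemma canon_can f g p q : cancel f g -> vw p -> canon f p q -> canon g q p.
Proof.
move=> fK vp [vq e h]; split=> // u; rewrite -e => vu.
by rewrite -h // fK.
Qed.

Fixpoint words n : seq (seq (alph S)) :=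
  if n is m.+1 then [seq a :: p | a <- letters S, p <- words m] else [:: [::]].

Lemma wordsP n p : size p = n -> p \in words n.
Proof.
elim: n p => [|n IH] [|a p] //= [/IH pn]; apply/allpairsP; exists (a, p).
by split=> //; exact: lettersP.
Qed.

Lemma tame_bound f : tame f -> exists n m, forall p, vw p -> size p = n ->
  exists2 q, canon f p q & size q <= m.
Proof.
move=> [n h]; exists n.
have [m hm] : exists m, forall p, p \in words n -> vw p -> size p = n ->
    exists2 q, canon f p q & size q <= m.
  elim: (words n) => [|p s [m IH]]; first by exists 0.
  have [[vp sp]|np] := pselect (vw p /\ size p = n).
    have [q cq] := h _ vp sp; exists (maxn m (size q)) => p'.
    rewrite inE => /orP[/eqP -> _ _|ps vp' sp'].
      by exists q => //; rewrite leq_maxr.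
    have [q' cq' sq'] := IH _ ps vp' sp'.
    by exists q' => //; rewrite (leq_trans sq') // leq_maxl.
  exists m => p'; rewrite inE => /orP[/eqP -> vp sp|]; last exact: IH.
  by case: np.
by exists m => p vp sp; apply: hm => //; exact: wordsP.
Qed.

(** Long enough cells have generic points, which locate them inside the image
    of a cell of the source. *)
Lemma tame_can f g : cancel f g -> cancel g f -> tame f -> tame g.
Proof.
move=> fK gK /tame_bound [n [m h]]; exists m => q vq sq.
have [u vu gu] := @point_generic S q vq.
have [w vw' ew] := @point_surj S (g (Q (q +++ u))).
have [vp vv] := vstream_drop n vw'.
have [q' cq' sq'] := h _ vp (size_mkseq _ _).
have [vq' ec' hq'] := cq'.
have e : q' +++ sdrop n w = q +++ u.
  apply: gu; first by apply/vstream_sapp; rewrite -ec'.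
  by rewrite -hq' // sapp_mkseq ew gK.
have [|z qz _] := sapp_prefix e; first by rewrite sq.
exists (mkseq w n ++ z); rewrite qz; apply: canon_cat; last by rewrite -qz.
exact: canon_can fK vp cq'.
Qed.

Lemma tame_id : tame id.
Proof. by exists 0 => p vp _; exists p; exact: canon_id. Qed.

(** A cell with enough letters to spare for [g] has an image long enough for [f]. *)
Lemma tame_comp f g : tame f -> tame g -> tame (f \o g).
Proof.
move=> /tame_ge [m hf] [n hg]; exists (n + m) => p vp sp.
have := vp; rewrite -{1}(cat_take_drop n p) vword_cat => /andP[vt _].
have [|q cq] := hg _ vt; first by rewrite size_takel // sp leq_addr.
have := canon_cat (r := drop n p) cq; rewrite cat_take_drop => /(_ vp) cp.
have [vq _ _] := cp.
have [|r cr] := hf _ _ _ vq erefl.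
  by rewrite size_cat size_drop sp addKn leq_addl.
by exists r; exact: canon_comp cr.
Qed.

Lemma tame_continuous f : tame f -> continuous f.
Proof.
move=> [n h]; apply/continuousP => U /point_open oU; apply/point_open => u vu Ufu.
have [vp vd] := vstream_drop n vu.
have [q [vq e hq]] := h _ vp (size_mkseq _ _).
rewrite /preimage /= -(sapp_mkseq n u) hq // in Ufu.
have vqd : vs (clr0 S) (q +++ sdrop n u) by apply/vstream_sapp; rewrite -e.
have [m hm] := oU _ vqd Ufu.
exists (n + m) => v vv evu; rewrite /preimage /= -(sapp_mkseq n v).
move/mkseq_eqP: evu => evu.
have en : mkseq v n = mkseq u n.
  by apply/mkseq_eqP => k kn; apply: evu; rewrite ltn_addr.
have [_ vdv] := vstream_drop n vv.
rewrite en in vdv *; rewrite hq //.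
apply: hm; first by apply/vstream_sapp; rewrite -e.
apply/mkseq_eqP => k km; rewrite !sappE; case: ifP => kq; first exact: set_nth_default.
by rewrite /sdrop; apply: evu; rewrite ltn_add2l (leq_ltn_trans _ km) // leq_subr.
Qed.

(** A relation that is functional in both directions and acts on long cells by
    prefix replacement is the graph of a homeomorphism: continuity comes for free. *)
Lemma rel_homeo (R : X -> X -> Prop) :
  (forall x, exists y, R x y) -> (forall y, exists x, R x y) ->
  (forall x y y', R x y -> R x y' -> y = y') ->
  (forall x x' y, R x y -> R x' y -> x = x') ->
  (exists n, forall p, vw p -> size p = n -> exists q, [/\ vw q, ec p = ec q &
     forall u, vs (ec p) u -> R (Q (p +++ u)) (Q (q +++ u))]) ->
  exists2 h : homeo X, tame h & forall x, R x (h x).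
Proof.
move=> tR tR' fR fR' [n hR].
pose f x := projT1 (cid (tR x)); pose g y := projT1 (cid (tR' y)).
have Rf x : R x (f x) by rewrite /f; case: cid.
have Rg y : R (g y) y by rewrite /g; case: cid.
have fK : cancel f g by move=> x; exact: (fR' _ _ _ (Rg _) (Rf _)).
have gK : cancel g f by move=> x; exact: (fR _ _ _ (Rf _) (Rg _)).
have tf : tame f.
  exists n => p vp sp; have [q [vq e h]] := hR _ vp sp; exists q; split=> // u vu.
  exact: fR (Rf _) (h _ vu).
have tg := tame_can fK gK tf.
by exists (Homeo fK gK (tame_continuous tf) (tame_continuous tg)).
Qed.

Lemma tame_homeoV (f : homeo X) : tame f -> tame (f^-1)%g.
Proof. exact: tame_can (homeo_funK f) (homeo_invK f). Qed.

Lemma tame_subgroup : subgroup [set f : homeo X | tame f].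
Proof.
split=> [|f g]; rewrite !inE /=; first exact: tame_id.
by move=> tf /tame_homeoV; exact: tame_comp.
Qed.

End Presentation.

(** * The topology of the space of words *)

Lemma stream_cylinder_open (w : stream) n :
  open [set v : stream | mkseq v n = mkseq w n].
Proof.
elim: n => [|n IH]; first by rewrite (_ : [set _ | _] = setT) ?predeqE //; exact: openT.
rewrite (_ : [set _ | _] =
    [set v | mkseq v n = mkseq w n] `&` (proj n) @^-1` [set w n]); last first.
  by rewrite predeqE => v /=; rewrite !mkseqS; split=> [/rcons_inj[]|[h1 h2]] //; rewrite h1; congr rcons.
apply: openI => //; apply: open_comp; last exact: discrete_open.
by move=> v _; apply: proj_continuous.
Qed.

(** If no cylinder around [w] lay inside an open set, words outside the set,
    agreeing with [w] further and further, would converge to [w]. *)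
Lemma stream_open_cylinder (O : set stream) (w : stream) : open O -> O w ->
  exists n, [set v : stream | mkseq v n = mkseq w n] `<=` O.
Proof.
move=> oO Ow; apply: contrapT => /forallNP h.
have /choice [v hv] n : exists v : stream, mkseq v n = mkseq w n /\ ~ O v.
  by have /existsNP [v /not_implyP [? ?]] := h n; exists v.
have cv : (v @ \oo) --> w.
  apply/cvg_sup => i; apply/cvg_image.
    by apply/seteqP; split => // x _; exists (fun=> x).
  move=> A /= nA; exists ((fun f : stream => f i) @^-1` A); last first.
    by apply/seteqP; split => [x [f Af <-] //|x Ax]; exists (fun=> x).
  exists i.+1 => // n /= ni; have [/mkseq_eqP e _] := hv n.
  by rewrite /preimage /= e //; exact: nbhs_singleton nA.
have : \forall n \near \oo, O (v n) by apply: cv; exact: open_nbhs_nbhs.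
by case=> n _ /(_ n (leqnn n)); case: (hv n).
Qed.

Lemma Omega_open (U : set Omega) : open U <->
  forall w, U w -> exists n, forall v : Omega,
    mkseq (val v) n = mkseq (val w) n -> U v.
Proof.
split=> [[V oV <-] w Vw|h].
  by have [n hn] := stream_open_cylinder oV Vw; exists n => v /hn.
rewrite openE => w /h [n hn]; rewrite /interior nbhsE.
exists (val @^-1` [set v : stream | mkseq v n = mkseq (val w) n]) => //.
split=> //; exists [set v : stream | mkseq v n = mkseq (val w) n] => //.
exact: stream_cylinder_open.
Qed.

Lemma Airplane_open (U : set Airplane) : open U <->
  forall w, U (pt w) -> exists n, forall v : Omega,
    mkseq (val v) n = mkseq (val w) n -> U (pt v).
Proof. exact: Omega_open. Qed.

(** * Addresses of edges *)

(** The replacement rules as an automaton: the state is the colour of the edge. *)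
Definition okc (c : colour) (a : letter) : bool :=
  match c with
  | Blue => a \in [:: b_minus; b_plus; bu; bd]
  | Red => a \in [:: r1; r2; rs]
  end.

Definition lcol (c : colour) (a : letter) : colour :=
  if a \in [:: b_minus; b_plus; rs; eL; eR] then Blue else Red.

Notation vw := (vword okc lcol).
Notation vs := (vstream okc lcol).
Notation ec := (endc lcol).

(** Renaming the four base edges as the children of a virtual blue edge from
    [l] to [r] makes the base graph an instance of the blue replacement rule. *)
Definition ren (a : letter) : letter :=
  match a with
  | b_minus => eL | b_plus => eR | bu => eU | bd => eD
  | eL => b_minus | eR => b_plus | eU => bu | eD => bd
  | a => a
  end.

Lemma renK : involutive ren. Proof. by case. Qed.

Definition renw (p : word) : word := if p is a :: p' then ren a :: p' else p.
Definition rens (u : nat -> letter) : nat -> letter := ren (u 0) ::: sdrop 1 u.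

Lemma renwK : involutive renw. Proof. by case=> //= a p; rewrite renK. Qed.

Lemma rensK : involutive rens.
Proof. by move=> u; apply: funext => -[|n] //; rewrite /rens /= renK. Qed.

Lemma mkseq_rens u n : mkseq (rens u) n = renw (mkseq u n).
Proof.
case: n => [|n] //; rewrite /rens mkseq_scons [in RHS](scons_eta u).
by rewrite mkseq_scons.
Qed.

Definition base_edge (a : letter) : edge :=
  match a with
  | b_minus => Edge [:: eL] Blue (inl va) (inl vl)
  | b_plus => Edge [:: eR] Blue (inl vb) (inl vr)
  | bu => Edge [:: eU] Red (inl vb) (inl va)
  | _ => Edge [:: eD] Red (inl va) (inl vb)
  end.

(** The child of [e] named by a letter, under the rule that uses that letter. *)
Definition sub (e : edge) (a : letter) : edge :=
  let new k : vertex := inr (name e, k) in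
  let child := rcons (name e) in
  match a with
  | r1 => Edge (child r1) Red (src e) (new nm)
  | r2 => Edge (child r2) Red (new nm) (tgt e)
  | rs => Edge (child rs) Blue (new nm) (new nw)
  | b_minus => Edge (child b_minus) Blue (new nx) (src e)
  | b_plus => Edge (child b_plus) Blue (new ny) (tgt e)
  | bu => Edge (child bu) Red (new ny) (new nx)
  | _ => Edge (child bd) Red (new nx) (new ny)
  end.

Definition edge_of (p : word) : edge :=
  if p is a :: p' then foldl sub (base_edge a) p' else base_edge b_minus.

Lemma edge_of_rcons p a : p != [::] -> edge_of (rcons p a) = sub (edge_of p) a.
Proof. by case: p => //= b p _; rewrite foldl_rcons. Qed.

Lemma replacementP (e f : edge) :
  f \in replacement e <-> exists2 a, okc (col e) a & f = sub e a.
Proof.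
rewrite /replacement; case: (col e); rewrite !inE; split.
- by case/or3P => /eqP ->; [exists r1|exists r2|exists rs].
- by move=> [] [] //= _ ->; rewrite eqxx ?orbT.
- by case/or4P => /eqP ->; [exists b_minus|exists b_plus|exists bu|exists bd].
- by move=> [] [] //= _ ->; rewrite eqxx ?orbT.
Qed.

Lemma sub_col e a : okc (col e) a -> col (sub e a) = lcol (col e) a.
Proof. by case: (col e) a => -[]. Qed.

Lemma sub_name e a : okc (col e) a -> name (sub e a) = rcons (name e) a.
Proof. by case: (col e) a => -[]. Qed.

Lemma base_col a : okc Blue a -> col (base_edge a) = lcol Blue a.
Proof. by case: a. Qed.

Lemma edge_of_col p : p != [::] -> vw Blue p -> col (edge_of p) = ec Blue p.
Proof.
elim/last_ind: p => // p a IH _; rewrite vword_rcons => /andP[vp oka].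
case: p IH vp oka => [|b p] IH vp oka; first by rewrite /= base_col.
rewrite edge_of_rcons // sub_col ?IH //.
by rewrite endc_rcons.
Qed.

Lemma edge_of_name p : p != [::] -> vw Blue p -> name (edge_of p) = renw p.
Proof.
elim/last_ind: p => // p a IH _; rewrite vword_rcons => /andP[vp oka].
case: p IH vp oka => [|b p] IH vp oka; first by case: a oka.
rewrite edge_of_rcons // sub_name ?IH //.
by rewrite edge_of_col.
Qed.

Lemma full_edge n e : e \in full_expansion n <->
  exists p, [/\ vw Blue p, size p = n.+1 & e = edge_of p].
Proof.
elim: n e => [|n IH] e.
  rewrite !inE; split=> [/or4P [] /eqP ->|].
  - by exists [:: b_minus].
  - by exists [:: b_plus].
  - by exists [:: bu].
  - by exists [:: bd].
  by move=> [[|a [|b p]]] [] //= h _ ->; case: a h => //= _; rewrite eqxx ?orbT.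
rewrite full_expansionP; split=> [[f /IH [p [vp sp ->]] /replacementP [a oka ->]]|].
  have pn : p != [::] by case: p sp {vp oka}.
  exists (rcons p a); rewrite size_rcons sp edge_of_rcons //; split=> //.
  by rewrite vword_rcons vp -edge_of_col.
move=> [p []]; elim/last_ind: p => // p a _; rewrite vword_rcons size_rcons.
move=> /andP[vp oka] [sp] ->; have pn : p != [::] by case: p sp {vp oka}.
exists (edge_of p); first by apply/IH; exists p.
by apply/replacementP; exists a; rewrite ?edge_of_rcons ?edge_of_col.
Qed.

Lemma expansion_flatten G1 G2 G3 : expansion (G1 ++ G2 ++ G3) ->
  expansion (G1 ++ flatten (map replacement G2) ++ G3).
Proof.
elim: G2 G1 => //= e G2 IH G1 h; rewrite -catA catA; apply: IH.
by rewrite -catA; exact: expansion_step.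
Qed.

Lemma expansion_full_expansion n : expansion (full_expansion n).
Proof.
elim: n => [|n IH]; first exact: expansion_base.
have := @expansion_flatten [::] (full_expansion n) [::].
by rewrite !cat0s !cats0; exact.
Qed.

Lemma is_edgeP e : is_edge e <->
  exists p, [/\ vw Blue p, p != [::] & e = edge_of p].
Proof.
split=> [[G exG /(expansion_full exG) /full_edge [p [vp sp ->]]]|[p [vp pn ->]]].
  by exists p; split=> //; case: p sp {vp}.
exists (full_expansion (size p).-1); first exact: expansion_full_expansion.
by apply/full_edge; exists p; split=> //; case: p pn {vp}.
Qed.

(** * The gluing of addresses *)

(** The address, below an edge of colour [c], of its source ([s = true]) or
    target ([s = false]). *)
Definition end_tail (c : colour) (s : bool) : nat -> letter :=
  match c, s with
  | Red, true => cst r1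
  | Red, false => cst r2
  | Blue, true => b_minus ::: cst b_plus
  | Blue, false => cst b_plus
  end.

Definition ends_at (e : edge) (s : bool) := if s then src e else tgt e.

(** The new vertices at which several new edges meet; [w] is a leaf. *)
Inductive junction := Jm | Jx | Jy.

Definition junction_vertex j :=
  match j with Jm => nm | Jx => nx | Jy => ny end.

(** Whether a new edge leaves ([Some true]), enters ([Some false]) or misses a
    junction. *)
Definition role j (a : letter) : option bool :=
  match j, a with
  | Jm, r1 => Some false | Jm, r2 => Some true | Jm, rs => Some true
  | Jx, b_minus => Some true | Jx, bu => Some false | Jx, bd => Some true
  | Jy, b_plus => Some true | Jy, bu => Some true | Jy, bd => Some false
  | _, _ => None
  end.

Definition at_junction j (u : nat -> letter) :=
  exists a s, role j a = Some s /\ u = a ::: end_tail (lcol Blue a) s.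

(** The gluing of addresses in closed form: below a common edge they follow, to
    their ends, two edges with a common new vertex. *)
Definition glue (u v : nat -> letter) := u = v \/
  exists p j t t', [/\ at_junction j t, at_junction j t', u = p +++ t & v = p +++ t'].

(** Edges whose new vertices, and those of their descendants, are fresh. *)
Definition fresh (e : edge) := src e != tgt e /\
  forall p k, inr (p, k) \in ends e -> size p < size (name e).

Lemma fresh_new e k : fresh e -> (inr (name e, k) : vertex) \notin ends e.
Proof. by move=> [_ h]; apply/negP => /h; rewrite ltnn. Qed.

Lemma fresh_sub e a : fresh e -> okc (col e) a -> fresh (sub e a).
Proof.
move=> fe oka; have fn k := fresh_new k fe; have [ne he] := fe.
split; last first.
  move=> p k kp; rewrite sub_name // size_rcons ltnS.
  have /replacement_ends : sub e a \in replacement e by apply/replacementP; exists a.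
  by move=> /(_ _ kp)[/he /ltnW //|[k' [-> _]]].
move: fn; rewrite /ends; case: a oka; case: (col e) => //= _ fn;
  try by apply/negP => /eqP.
all: by move: (fn nm) (fn nx) (fn ny); rewrite !inE !negb_or
  => /andP[m1 m2] /andP[x1 x2] /andP[y1 y2] //; rewrite eq_sym.
Qed.

Lemma fresh_base a : okc Blue a -> fresh (base_edge a).
Proof. by case: a => // _; split=> // p k; rewrite !inE. Qed.

Lemma sub_junction e a j s : okc (col e) a -> role j a = Some s ->
  ends_at (sub e a) s = inr (name e, junction_vertex j).
Proof. by case: (col e); case: j; case: a => //= _ [<-]. Qed.

Lemma sub_tail e c s : col e = c ->
  end_tail c s = end_tail c s 0 ::: sdrop 1 (end_tail c s) /\
  [/\ okc c (end_tail c s 0),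
   sdrop 1 (end_tail c s) = end_tail (lcol c (end_tail c s 0)) (s && (c == Red))
   & ends_at (sub e (end_tail c s 0)) (s && (c == Red)) = ends_at e s].
Proof.
move=> ce; split; first exact: scons_eta.
by case: c s ce => -[] ce.
Qed.

Lemma end_tail_stays e s k : 
  ends_at e s \in ends (foldl sub e (mkseq (end_tail (col e) s) k)).
Proof.
elim: k e s => [|k IH] e s; first by rewrite /ends; case: s; rewrite /= !inE eqxx ?orbT.
have [E [oka et ee]] := sub_tail s (erefl (col e)).
rewrite E mkseq_scons /= et -ee -sub_col //; exact: IH.
Qed.

Lemma vs_end_tail c s : vs c (end_tail c s).
Proof. 
have h a b : (forall c, okc c b -> lcol c b = a) -> okc a b -> vs a (cst b).
  move=> hl ok n; elim: n => // n IH; rewrite cstE mkseq_scons /= ok hl //.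
have hb : vs Blue (cst b_plus) by apply: h => // -[].
case: c s => -[] //=; first 2 last.
- by apply/vstream_scons.
all: by apply: h => // -[].
Qed.

Lemma stays_first e s a : fresh e -> okc (col e) a ->
  ends_at e s \in ends (sub e a) -> a = end_tail (col e) s 0.
Proof.
move=> fe; move: (fresh_new nm fe) (fresh_new nw fe) (fresh_new nx fe) (fresh_new ny fe).
have [ne _] := fe; move: ne; rewrite /ends !inE !negb_or => ne.
move=> /andP[m1 m2] /andP[w1 w2] /andP[x1 x2] /andP[y1 y2].
case: (col e); case: a => // _; case: s => //=; rewrite ?inE.
all: rewrite ?(eq_sym (src e) (inr _)) ?(eq_sym (tgt e) (inr _)).
all: rewrite ?(negPf m1) ?(negPf m2) ?(negPf w1) ?(negPf w2) ?(negPf x1)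
  ?(negPf x2) ?(negPf y1) ?(negPf y2) ?(negPf ne) //=.
all: by rewrite eq_sym (negPf ne).
Qed.

(** Conversely a descending chain of edges incident to an end of [e] is forced. *)
Lemma stays_end_tail e s u : fresh e -> vs (col e) u ->
  (forall k, ends_at e s \in ends (foldl sub e (mkseq u k))) ->
  u = end_tail (col e) s.
Proof.
move=> fe vu h; apply: funext => k.
elim: k e s u fe vu h => [|k IH] e s u fe.
  by rewrite (scons_eta u) => /vstream_scons [ok0 _] /(_ 1) /(stays_first fe ok0).
rewrite (scons_eta u); set a := u 0; set v := sdrop 1 u.
move=> /vstream_scons [ok0 vv] h.
have e0 : a = end_tail (col e) s 0.
  by have := h 1; rewrite mkseq_scons => /(stays_first fe ok0).
have [E [_ et ee]] := sub_tail s (erefl (col e)).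
rewrite E /= et -e0 -sub_col //; apply: IH; first exact: fresh_sub.
  by rewrite sub_col.
by move=> m; have := h m.+1; rewrite mkseq_scons /= e0 ee.
Qed.

Lemma new_end e a k : fresh e -> okc (col e) a ->
  (inr (name e, k) : vertex) \in ends (sub e a) ->
  if k is nw then a = rs else exists j s,
    [/\ k = junction_vertex j, role j a = Some s & inr (name e, k) = ends_at (sub e a) s].
Proof.
move=> /(fresh_new k) + oa; rewrite /ends !inE negb_or => /andP[/negPf k1 /negPf k2].
case: (col e) a oa => -[] //= _; rewrite ?k1 ?k2 ?orbF ?orFb.
- by move=> /eqP [->]; exists Jm, false.
- by move=> /eqP [->]; exists Jm, true.
- by case/orP => /eqP [->] //; exists Jm, true.
- by move=> /eqP [->]; exists Jx, true.
- by move=> /eqP [->]; exists Jy, true.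
- by case/orP => /eqP [->]; [exists Jy, true|exists Jx, false].
- by case/orP => /eqP [->]; [exists Jx, true|exists Jy, false].
Qed.

(** An old vertex lies on a single child, so siblings can only meet at a junction. *)
Lemma siblings_meet e a b x : fresh e -> okc (col e) a -> okc (col e) b -> a != b ->
  x \in ends (sub e a) -> x \in ends (sub e b) ->
  exists j s t, [/\ role j a = Some s, role j b = Some t,
    x = ends_at (sub e a) s & x = ends_at (sub e b) t].
Proof.
move=> fe oa ob ab xa xb.
have ra : sub e a \in replacement e by apply/replacementP; exists a.
have [xe|[k xk]] := replacement_ends ra xa.
  have [s xs] : exists s, x = ends_at e s.
    by move: xe; rewrite !inE => /orP[] /eqP ->; [exists true|exists false].
  move: ab; rewrite xs in xa xb.
  by rewrite (stays_first fe oa xa) (stays_first fe ob xb) eqxx.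
rewrite {}xk in xa xb *.
move: (new_end fe oa xa) (new_end fe ob xb).
case: k xa xb => xa xb; last 2 first.
- move=> [j [s [ej js es]]] [j' [t [ej' jt et]]].
  by move: ej ej'; case: j js; case: j' jt => // jt js _ _; exists Jx, s, t.
- move=> [j [s [ej js es]]] [j' [t [ej' jt et]]].
  by move: ej ej'; case: j js; case: j' jt => // jt js _ _; exists Jy, s, t.
- move=> [j [s [ej js es]]] [j' [t [ej' jt et]]].
  by move: ej ej'; case: j js; case: j' jt => // jt js _ _; exists Jm, s, t.
- by move=> ea eb; rewrite ea eb eqxx in ab.
Qed.

Lemma base_meet a b x : okc Blue a -> okc Blue b -> a != b ->
  x \in ends (base_edge a) -> x \in ends (base_edge b) ->
  exists j s t, [/\ role j a = Some s, role j b = Some t,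
    x = ends_at (base_edge a) s & x = ends_at (base_edge b) t].
Proof.
case: a => // _; case: b => // _ _; rewrite !inE => /orP[] /eqP -> /orP[] /eqP //= _.
all: first [by exists Jx; do 2 eexists | by exists Jy; do 2 eexists].
Qed.

Lemma base_junction a b j s t : okc Blue a -> okc Blue b ->
  role j a = Some s -> role j b = Some t ->
  ends_at (base_edge a) s = ends_at (base_edge b) t.
Proof. by case: a => // _; case: b => // _; case: j => //= -[<-] [<-]. Qed.

Lemma edge_of_fresh p : p != [::] -> vw Blue p -> fresh (edge_of p).
Proof.
elim/last_ind: p => // p a IH _; rewrite vword_rcons => /andP[vp oka].
case: p IH vp oka => [|b p] IH vp oka; first exact: fresh_base.
by rewrite edge_of_rcons //; apply: fresh_sub; [exact: IH|rewrite edge_of_col].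
Qed.

Lemma edge_of_cat p q : p != [::] -> edge_of (p ++ q) = foldl sub (edge_of p) q.
Proof. by case: p => // a p _; rewrite /edge_of /= foldl_cat. Qed.

Lemma edge_of_meet p a b x : vw Blue p -> okc (ec Blue p) a -> okc (ec Blue p) b ->
  a != b -> x \in ends (edge_of (rcons p a)) -> x \in ends (edge_of (rcons p b)) ->
  exists j s t, [/\ role j a = Some s, role j b = Some t,
    x = ends_at (edge_of (rcons p a)) s & x = ends_at (edge_of (rcons p b)) t].
Proof.
have [->|pn] := eqVneq p [::]; first by move=> _; exact: base_meet.
move=> vp oa ob ab; rewrite !edge_of_rcons // => xa xb.
by apply: (siblings_meet _ _ _ ab xa xb); rewrite ?edge_of_col //; exact: edge_of_fresh.
Qed.

Lemma edge_of_junction p a b j s t : vw Blue p -> okc (ec Blue p) a ->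
  okc (ec Blue p) b -> role j a = Some s -> role j b = Some t ->
  ends_at (edge_of (rcons p a)) s = ends_at (edge_of (rcons p b)) t.
Proof.
have [->|pn] := eqVneq p [::]; first by move=> _; exact: base_junction.
move=> vp oa ob ja jb; rewrite !edge_of_rcons //.
by rewrite (sub_junction _ ja) ?edge_of_col // (sub_junction _ jb) ?edge_of_col.
Qed.

Definition adjacent (u v : nat -> letter) := forall n, exists2 x,
  x \in ends (edge_of (mkseq u n.+1)) & x \in ends (edge_of (mkseq v n.+1)).

Lemma end_adjacent p c s n : p != [::] -> vw Blue p -> ec Blue p = c ->
  size p <= n.+1 ->
  ends_at (edge_of p) s \in ends (edge_of (mkseq (p +++ end_tail c s) n.+1)).
Proof.
move=> pn vp <- /subnKC <-; rewrite mkseq_sapp edge_of_cat //.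
by rewrite -edge_of_col //; exact: end_tail_stays.
Qed.

Lemma glue_adjacent u v : vs Blue u -> vs Blue v -> glue u v -> adjacent u v.
Proof.
move=> vu vv [->|[p [j [t [t' [[a [s [ja ->]]] [b [s' [jb ->]]] eu ev]]]]]] n.
  by exists (src (edge_of (mkseq v n.+1))); rewrite mem_head.
rewrite eu ev -!sapp_rcons in vu vv *.
have /vstream_sapp[va _] := vu; have /vstream_sapp[vb _] := vv.
move: (va) (vb); rewrite !vword_rcons => /andP[vp oa] /andP[_ ob].
have [np|pn] := ltnP n (size p).
  exists (src (edge_of (take n.+1 p))).
    by rewrite sapp_rcons mkseq_sapp_take // mem_head.
  by rewrite sapp_rcons mkseq_sapp_take // mem_head.
have lc c : okc (ec Blue p) c -> ec Blue (rcons p c) = lcol Blue c by rewrite endc_rcons.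
exists (ends_at (edge_of (rcons p a)) s).
  by apply: end_adjacent; rewrite ?lc ?size_rcons //; case: (p).
rewrite (edge_of_junction vp oa ob ja jb).
by apply: end_adjacent; rewrite ?lc ?size_rcons //; case: (p).
Qed.

Lemma edge_of_full u n : vs Blue u -> edge_of (mkseq u n.+1) \in full_expansion n.
Proof. by move=> vu; apply/full_edge; exists (mkseq u n.+1); rewrite size_mkseq. Qed.

Lemma edge_of_child u n : vs Blue u ->
  edge_of (mkseq u n.+2) \in replacement (edge_of (mkseq u n.+1)).
Proof.
move=> vu; rewrite (mkseqS u n.+1); apply/replacementP; exists (u n.+1).
  by have := vu n.+2; rewrite mkseqS vword_rcons edge_of_col // => /andP[].
by rewrite edge_of_rcons.
Qed.

(** Two words separating below [p] that stay adjacent share, from the next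
    level on, one and the same vertex. *)
Lemma adjacent_glue u v : vs Blue u -> vs Blue v -> adjacent u v -> glue u v.
Proof.
move=> vu vv adj; have [uv|/first_difference] := pselect (u = v); first by left.
move=> [p [a [b [u' [v' [ab eu ev]]]]]]; set n := size p.
pose E w m := edge_of (mkseq w m.+1).
have ne m : n <= m -> E u m != E v m.
  move=> nm; apply/eqP => /(congr1 name).
  rewrite !edge_of_name // => /(can_inj renwK) /mkseq_eqP /(_ n).
  by rewrite ltnS => /(_ nm); rewrite eu ev !sappE ltnn subnn /= => /eqP; rewrite (negPf ab).
have [x xu xv] := adj n.+1.
have up m y : n <= m -> y \in ends (E u m.+1) -> y \in ends (E v m.+1) ->
    y \in ends (E u m) /\ y \in ends (E v m).
  move=> nm; apply: (replacement_common_end (edge_of_full m vu) (edge_of_full m vv) (ne m nm));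
    exact: edge_of_child.
have stay m : x \in ends (E u (n + m)) /\ x \in ends (E v (n + m)).
  have [y yu yv] := adj (n + m).+1.
  have down k : k <= m.+1 -> y \in ends (E u (n + m.+1 - k)) /\ y \in ends (E v (n + m.+1 - k)).
    elim: k => [|k IH]; first by rewrite subn0 addnS.
    move=> km; have [] := IH (ltnW km).
    have -> : n + m.+1 - k = (n + m.+1 - k.+1).+1 by rewrite -subSn ?subSS // (leq_trans km) // leq_addl.
    by apply: up; rewrite -addnBA // leq_addr.
  have := down 1 isT; rewrite addnS subSS subn0; suff -> : x = y by [].
  have [yu0 _] := down m.+1 (leqnn _); rewrite addnK in yu0.
  have [yu1 _] := down m (leqnSn _); rewrite addnS subSn ?leq_addl // addnK in yu1.
  have [xu0 _] := up n x (leqnn _) xu xv.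
  exact: (replacement_old_end (edge_of_full n vu) (edge_of_child n vu) xu yu1 xu0 yu0).
have [] := stay 0; rewrite addn0.
have first w c w' : w = p +++ c ::: w' -> E w n = edge_of (rcons p c).
  move=> ->; rewrite /E -sapp_rcons -[n.+1](size_rcons p c); congr edge_of.
  exact: mkseq_sapp_size.
rewrite (first _ _ _ eu) (first _ _ _ ev) => xa xb.
move: (vu) (vv); rewrite eu ev -!sapp_rcons => /vstream_sapp[va vu'] /vstream_sapp[vb vv'].
move: (va) (vb); rewrite !vword_rcons => /andP[vp oa] /andP[_ ob].
have [j [s [t [ja jb xs xt]]]] := edge_of_meet vp oa ob ab xa xb.
have nn c : rcons p c != [::] by case: (p).
have tail w c w' r : w = p +++ c ::: w' -> vw Blue (rcons p c) -> vs (ec Blue (rcons p c)) w' ->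
    x = ends_at (edge_of (rcons p c)) r -> (forall m, x \in ends (E w (n + m))) ->
    w' = end_tail (lcol Blue c) r.
  move=> ew vc vw' xr h; have ecc : col (edge_of (rcons p c)) = lcol Blue c.
    by rewrite edge_of_col // endc_rcons.
  rewrite -ecc; apply: stays_end_tail; first exact: edge_of_fresh.
    by rewrite edge_of_col.
  move=> k; rewrite -xr -edge_of_cat // -mkseq_sapp sapp_rcons -ew size_rcons.
  exact: h.
right; exists p, j, (a ::: u'), (b ::: v'); split; rewrite ?sapp_rcons //.
  by exists a, s; split=> //; rewrite (tail _ _ _ _ eu va vu' xs) // => m; case: (stay m).
by exists b, t; split=> //; rewrite (tail _ _ _ _ ev vb vv' xt) // => m; case: (stay m).
Qed.

(** * The Airplane as a presented space *)

Lemma Omega_valid u : Omega (rens u) <-> vs Blue u.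
Proof.
split=> [h [|n] //|vu n].
  have [e /is_edgeP [p [vp pn ->]]] := h n.
  by rewrite edge_of_name // mkseq_rens => /(can_inj renwK) <-.
have vn := vu n.+1; exists (edge_of (mkseq u n.+1)).
  by apply/is_edgeP; exists (mkseq u n.+1).
by rewrite edge_of_name // mkseq_rens.
Qed.

Definition omega u (H : Omega (rens u)) : Omega := SigSub (mem_set H).

Lemma vs_plus : vs Blue (cst b_plus). Proof. exact: (vs_end_tail Blue false). Qed.

(** The point with a given address; a default point on invalid addresses. *)
Definition P (u : nat -> letter) : Airplane :=
  if pselect (Omega (rens u)) is left H then pt (omega H)
  else pt (omega ((Omega_valid _).2 vs_plus)).

Lemma val_valid (w : Omega) : vs Blue (rens (val w)).
Proof. by apply/Omega_valid; rewrite rensK; exact: set_valP. Qed.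

Lemma ptE (w : Omega) : pt w = P (rens (val w)).
Proof.
rewrite /P; case: pselect => [H|]; last by have := set_valP w; rewrite rensK.
by congr pt; apply: val_inj; rewrite /= rensK.
Qed.

Lemma P_pt u : vs Blue u -> exists2 w : Omega, val w = rens u & P u = pt w.
Proof.
by move=> /Omega_valid H; exists (omega H) => //; rewrite ptE /= rensK.
Qed.

Lemma P_surj x : exists2 u, vs Blue u & P u = x.
Proof.
exists (rens (val (repr x))); first exact: val_valid.
by rewrite -ptE /pt reprK.
Qed.

Lemma pt_eq (w v : Omega) : pt w = pt v <-> glued w v.
Proof. by split=> [/eqquotP/asboolP|h] //; apply/eqquotP/asboolP. Qed.

Lemma glued_adjacent (w v : Omega) : glued w v <-> adjacent (rens (val w)) (rens (val v)).
Proof.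
have E (t : Omega) n : edge_of (mkseq (rens (val t)) n.+1) \in full_expansion n /\
    name (edge_of (mkseq (rens (val t)) n.+1)) = mkseq (val t) n.+1.
  have vt := val_valid t; split; first exact: edge_of_full.
  by rewrite edge_of_name // mkseq_rens renwK.
split=> h n; have [wG wn] := E w n; have [vG vn] := E v n.
  have [e [f [eG fG ew fv [x xe xf]]]] := h n; exists x.
    by rewrite (full_expansion_name_inj wG eG) // wn.
  by rewrite (full_expansion_name_inj vG fG) // vn.
by have [x xw xv] := h n; exists (edge_of (mkseq (rens (val w)) n.+1)),
  (edge_of (mkseq (rens (val v)) n.+1)); split=> //; exists x.
Qed.

Lemma P_glue u v : vs Blue u -> vs Blue v -> P u = P v <-> glue u v.
Proof.
move=> vu vv; have [w ew ->] := P_pt vu; have [w' ew' ->] := P_pt vv.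
rewrite pt_eq glued_adjacent ew ew' !rensK.
by split; [exact: adjacent_glue|exact: glue_adjacent].
Qed.

(** Glued words are eventually constant, equal to one of these letters. *)
Definition generic (u : nat -> letter) := forall a, a \in [:: r1; r2; b_plus] ->
  forall n, exists2 k, n <= k & u k != a.

Lemma generic_sapp p u : generic u -> generic (p +++ u).
Proof.
move=> gu a /gu h n; have [k nk uk] := h n; exists (size p + k).
  by rewrite (leq_trans nk) // leq_addl.
by rewrite sappE ltnNge leq_addr /= addKn.
Qed.

Lemma sapp_generic p u : generic (p +++ u) -> generic u.
Proof.
move=> gu a /gu h n; have [k nk uk] := h (size p + n); exists (k - size p).
  by rewrite leq_subRL // (leq_trans _ nk) // leq_addr.
by move: uk; rewrite sappE ltnNge (leq_trans _ nk) // leq_addr.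
Qed.

Lemma end_tail_not_generic a c s : ~ generic (a ::: end_tail c s).
Proof.
have H b d : d \in [:: r1; r2; b_plus] -> ~ generic (b ::: cst d).
  by move=> dd /(_ d dd 1) [[|k] //= _]; rewrite eqxx.
case: c; case: s => /=; try exact: H.
by rewrite -[_ ::: _ ::: _]/([:: a] +++ _) => /sapp_generic; apply: H.
Qed.

Lemma glue_generic u v : generic u -> glue u v -> v = u.
Proof.
move=> gu [->//|[p [j [t [t' [[a [s [_ et]]] _ eu _]]]]]].
by move: gu; rewrite eu et => /sapp_generic /end_tail_not_generic.
Qed.

Lemma P_generic u v : vs Blue u -> vs Blue v -> generic u -> P v = P u -> v = u.
Proof.
by move=> vu vv gu /esym /P_glue-/(_ vu vv); exact: glue_generic.
Qed.

Definition gst (c : colour) : nat -> letter :=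
  if c is Blue then cst b_minus else rs ::: cst b_minus.

Lemma vs_gst c : vs c (gst c).
Proof.
have h : vs Blue (cst b_minus).
  by move=> n; elim: n => // n IH; rewrite cstE mkseq_scons.
by case: c => //; apply/vstream_scons.
Qed.

Lemma generic_cst : generic (cst b_minus).
Proof.
move=> a + n; rewrite !inE => aa; exists n => //.
by case/or3P: aa => /eqP ->.
Qed.

Lemma generic_gst c : generic (gst c).
Proof.
by case: c; [apply: (@generic_sapp [:: rs])|]; exact: generic_cst.
Qed.

Lemma vs_sapp_gst p c : vw Blue p -> ec Blue p = c -> vs Blue (p +++ gst c).
Proof. by move=> vp <-; apply/vstream_sapp; split=> //; exact: vs_gst. Qed.

Lemma air_generic p : vw Blue p -> exists2 u, vs (ec Blue p) u &
  forall v, vs Blue v -> P v = P (p +++ u) -> v = p +++ u.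
Proof.
move=> vp; exists (gst (ec Blue p)); first exact: vs_gst.
move=> v vv; apply: P_generic => //; first exact: vs_sapp_gst.
exact/generic_sapp/generic_gst.
Qed.

Lemma okc2 c a : exists2 b, b != a & okc c b.
Proof. by case: c a => -[]; by [exists r1|exists r2|exists b_minus|exists b_plus]. Qed.

Lemma P_open (U : set Airplane) : open U <->
  forall u, vs Blue u -> U (P u) -> exists n, forall v, vs Blue v ->
    mkseq v n = mkseq u n -> U (P v).
Proof.
rewrite Airplane_open; split=> h.
  move=> u /P_pt [w ew ->] /h [n hn]; exists n => v /P_pt [w' ew' ->] e.
  by apply: hn; rewrite ew ew' !mkseq_rens e.
move=> w; rewrite ptE => /(h _ (val_valid w)) [n hn]; exists n => v e.
by rewrite ptE; apply: hn; rewrite ?mkseq_rens ?e //; exact: val_valid.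
Qed.

Definition all_letters :=
  [:: eL; eR; eU; eD; r1; r2; rs; b_minus; b_plus; bu; bd].

Lemma all_lettersP a : a \in all_letters. Proof. by case: a. Qed.

Definition air : presentation :=
  Presentation all_lettersP okc2 P_surj air_generic P_open.

(** * Rearrangements as prefix replacements *)

Lemma prependE p u : prepend p u = p +++ u.
Proof.
apply: funext => n; rewrite /prepend sappE; case: ifP => // np.
exact: set_nth_default.
Qed.

Lemma rens_prepend p u : p != [::] -> rens (p +++ u) = renw p +++ u.
Proof. by case: p. Qed.

Lemma cellP p x : vw Blue p -> p != [::] ->
  cell (edge_of p) x <-> exists2 u, vs (ec Blue p) u & x = P (p +++ u).
Proof.
move=> vp pn; split.
  move=> [w [-> [u]]]; rewrite edge_of_name // prependE -rens_prepend // => ew; exists u.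
    by have := val_valid w; rewrite ew rensK => /vstream_sapp[].
  by rewrite ptE ew rensK.
move=> [u vu ->]; have vpu : vs Blue (p +++ u) by apply/vstream_sapp.
have [w ew ->] := P_pt vpu; exists w; split=> //; exists u.
by rewrite edge_of_name // prependE ew rens_prepend.
Qed.

Lemma extends_canon p (f : Airplane -> Airplane) : vw Blue p -> p != [::] ->
  extends_canonically f (edge_of p) <-> exists2 q, q != [::] & canon (S := air) f p q.
Proof.
move=> vp pn; split=> [[e' /is_edgeP [q [vq qn ->]]]|[q qn [vq ecq h]]].
  rewrite /restricts_canonically !edge_of_col // !edge_of_name // => -[ecq h].
  exists q => //; split=> // u vu; have vpu : vs Blue (p +++ u) by apply/vstream_sapp.
  rewrite -[LHS]/(f (P (p +++ u))) -[RHS]/(P (q +++ u)).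
  have [w ew ->] := P_pt vpu; have [|w' ew' ->] := h w u.
    by rewrite prependE ew rens_prepend.
  by rewrite ptE ew' prependE -rens_prepend // rensK.
exists (edge_of q); first by apply/is_edgeP; exists q.
rewrite /restricts_canonically !edge_of_col // !edge_of_name //; split=> // w u.
rewrite prependE -rens_prepend // => ew.
have vu : vs (ec Blue p) u by have := val_valid w; rewrite ew rensK => /vstream_sapp[].
have vqu : vs Blue (q +++ u) by apply/vstream_sapp; rewrite -ecq.
have [w' ew' e] := P_pt vqu; exists w'; first by rewrite prependE ew' rens_prepend.
by rewrite ptE ew rensK h.
Qed.

Lemma full_expansion_partition n : cellular_partition (full_expansion n).
Proof.
split=> [e /full_edge [p [vp sp ->]]||e e'].
- by apply/is_edgeP; exists p; split=> //; case: p sp {vp}.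
- apply/seteqP; split=> // x _; have [u vu <-] := P_surj x.
  have [vp vd] := vstream_drop n.+1 vu.
  exists (edge_of (mkseq u n.+1)); first exact: edge_of_full.
  by apply/cellP => //; exists (sdrop n.+1 u); rewrite ?sapp_mkseq.
move=> /full_edge [p [vp sp ->]] /full_edge [q [vq sq ->]] ne.
have [pn qn] : p != [::] /\ q != [::] by case: p q sp sq {vp vq ne} => [|? ?] [].
apply/seteqP; split=> // x [xp xq].
have : open (interior (cell (edge_of p)) `&` interior (cell (edge_of q))).
  by apply: openI; exact: open_interior.
have [u vu ux] := P_surj x.
move=> /P_open /(_ _ vu); rewrite ux => /(_ (conj xp xq)) [m hm].
have [vm _] := vstream_drop m vu; set c := ec Blue (mkseq u m).
have vv : vs Blue (mkseq u m +++ gst c) by exact: vs_sapp_gst.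
have [] := hm _ vv; first by rewrite mkseq_sapp_take ?size_mkseq // take_oversize ?size_mkseq.
move=> /interior_subset /(cellP _ vp pn) [s vs' es] /interior_subset /(cellP _ vq qn) [t vt et].
have gen : generic (mkseq u m +++ gst c) by exact/generic_sapp/generic_gst.
have e1 := P_generic vv ((vstream_sapp _ _ _ _ _).2 (conj vp vs')) gen (esym es).
have e2 := P_generic vv ((vstream_sapp _ _ _ _ _).2 (conj vq vt)) gen (esym et).
rewrite -e2 in e1; have [pq _] := sapp_eq e1 (etrans sp (esym sq)).
by rewrite pq eqxx in ne.
Qed.

(** The empty word names no edge, so one more letter is needed for the cell and its
    image to be cells of edges. *)
Lemma tame_nonempty (f : Airplane -> Airplane) : tame (S := air) f ->
  exists n, forall p, vw Blue p -> n <= size p ->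
    p != [::] /\ exists2 q, q != [::] & canon (S := air) f p q.
Proof.
move=> /(@tame_ge air) [n h]; exists n.+1 => p; elim/last_ind: p => // p a _ vpa.
rewrite size_rcons ltnS => np; split; first by case: (p).
move: (vpa); rewrite vword_rcons => /andP[vp _].
have [q cq] := h _ _ np vp erefl; exists (rcons q a); first by case: (q).
by rewrite -!cats1; apply: canon_cat; rewrite ?cats1.
Qed.

(** The cells of a partition have bounded depth, so deeper cells lie inside them and
    are moved canonically too; conversely the cells of one depth form a partition. *)
Lemma TA_tame (f : homeo Airplane) : TA f <-> tame (S := air) f.
Proof.
split=> [[E [Ee Ec _] hE]|/tame_nonempty [n h]]; last first.
  exists (full_expansion n); first exact: full_expansion_partition.
  move=> e /full_edge [p [vp sp ->]].
  by have [|pn cq] := h _ vp; [rewrite sp|apply/extends_canon].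
have [n hn] : exists n, forall e, e \in E -> size (name e) <= n.
  elim: {Ee Ec hE} E => [|e E [n hn]]; first by exists 0.
  exists (maxn (size (name e)) n) => e'; rewrite inE => /orP[/eqP ->|/hn h].
    by rewrite leq_maxl.
  by rewrite (leq_trans h) // leq_maxr.
exists n => p vp sp; have vu := vs_sapp_gst vp erefl; set u := p +++ _ in vu.
have : (\bigcup_(e in [set` E]) cell e) (P u) by rewrite Ec.
move=> [e eE]; have [q [vq qn eq]] := (is_edgeP e).1 (Ee _ eE).
rewrite eq => /(cellP _ vq qn) [v vv ev].
have vqv : vs Blue (q +++ v) by apply/vstream_sapp.
have := P_generic vu vqv (generic_sapp _ (generic_gst _)) (esym ev).
move=> /sapp_prefix [|r pr _].
  by have := hn _ eE; rewrite eq edge_of_name // sp; case: (q).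
have := hE _ eE; rewrite eq => /extends_canon-/(_ vq qn) [q' _ cq'].
by exists (q' ++ r); rewrite pr; apply: canon_cat cq' _; rewrite -pr.
Qed.

Lemma TA_subgroup : subgroup TA.
Proof.
by rewrite (_ : TA = [set f | tame (S := air) f]);
  [exact: tame_subgroup|apply/seteqP; split=> f /TA_tame].
Qed.

(** * Binary expansions *)

Section Binary.
Import Order.TTheory GRing.Theory Num.Theory numFieldNormedType.Exports.
Local Open Scope ring_scope.
Variable R : realType.
Implicit Types (w v : nat -> bool) (p q : seq bool) (t s : R).

Fixpoint approx n w : R :=
  if n is m.+1 then ((w 0)%:R + approx m (sdrop 1 w)) / 2 else 0.

Lemma approx_bounds n w : 0 <= approx n w <= 1.
Proof.
elim: n w => [|n IH] w /=; first by rewrite lexx ler01.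
by have := IH (sdrop 1 w); case: (w 0) => /=; lra.
Qed.

Lemma approx_nondecreasing w : nondecreasing_seq (approx^~ w).
Proof.
apply/nondecreasing_seqP => n; elim: n w => [|n IH] w.
  by case/andP: (approx_bounds 1 w).
by have := IH (sdrop 1 w); rewrite /=; lra.
Qed.

Definition value w : R := limn (approx^~ w).

Lemma approx_cvg w : approx^~ w @ \oo --> value w.
Proof.
apply: nondecreasing_is_cvgn; first exact: approx_nondecreasing.
by exists 1 => _ [n _ <-]; case/andP: (approx_bounds n w).
Qed.

Lemma value_scons b w : value (b ::: w) = (b%:R + value w) / 2.
Proof.
have h : (fun n => approx n.+1 (b ::: w)) @ \oo --> (b%:R + value w) / 2.
  by apply: cvgMl; apply: cvgD; [exact: cvg_cst|exact: approx_cvg].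
have := @approx_cvg (b ::: w); rewrite -(cvg_shiftS (approx^~ (b ::: w))) => h'.
exact: (cvg_unique _ h' h).
Qed.

Lemma value_bounds w : 0 <= value w <= 1.
Proof.
apply/andP; split.
  apply: limr_ge; first exact: approx_cvg.
  by apply: nearW => n; case/andP: (approx_bounds n w).
apply: limr_le; first exact: approx_cvg.
by apply: nearW => n; case/andP: (approx_bounds n w).
Qed.

Lemma value_ge0 w : 0 <= value w. Proof. by case/andP: (value_bounds w). Qed.
Lemma value_le1 w : value w <= 1. Proof. by case/andP: (value_bounds w). Qed.

Lemma value_eq0 w : value w = 0 <-> w = cst false.
Proof.
split=> [h|->]; last first.
  by have := value_scons false (cst false); rewrite -cstE /=; lra.
apply: funext => k; elim: k w h => [|k IH] w; rewrite (scons_eta w) value_scons.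
  by have := value_ge0 (sdrop 1 w); case: (w 0) => //= ? ?; exfalso; lra.
move=> h; apply: (IH (sdrop 1 w)).
by move: h; have := value_ge0 (sdrop 1 w); case: (w 0) => //= ? ?; lra.
Qed.

Lemma value_eq1 w : value w = 1 <-> w = cst true.
Proof.
split=> [h|->]; last first.
  by have := value_scons true (cst true); rewrite -cstE /=; lra.
apply: funext => k; elim: k w h => [|k IH] w; rewrite (scons_eta w) value_scons.
  by have := value_le1 (sdrop 1 w); case: (w 0) => //= ? ?; exfalso; lra.
move=> h; apply: (IH (sdrop 1 w)).
by move: h; have := value_le1 (sdrop 1 w); case: (w 0) => //= ? ?; lra.
Qed.

Lemma value_cst b : value (cst b) = b%:R.
Proof. by case: b; [apply/value_eq1|apply/value_eq0]. Qed.

(** Left end and length of the standard dyadic interval named by a word. *)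
Fixpoint lo p : R := if p is b :: p' then (b%:R + lo p') / 2 else 0.
Definition len p : R := 2^-1 ^+ size p.

Lemma len_gt0 p : 0 < len p. Proof. by rewrite exprn_gt0. Qed.

Lemma value_sapp p w : value (p +++ w) = lo p + len p * value w.
Proof.
elim: p => [|b p IH] /=; first by rewrite /len expr0; lra.
by rewrite value_scons IH /len /= exprS; lra.
Qed.

Lemma lo_rcons p b : lo (rcons p b) = lo p + len p * b%:R / 2.
Proof.
elim: p => [|c p IH] /=; first by rewrite /len expr0; lra.
by rewrite IH /len /= exprS; lra.
Qed.

Lemma len_rcons p b : len (rcons p b) = len p / 2.
Proof. by rewrite /len size_rcons exprS mulrC. Qed.

Lemma lo_ge0 p : 0 <= lo p.
Proof. by have := value_ge0 (p +++ cst false); rewrite value_sapp value_cst mulr0 addr0. Qed.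

Lemma hi_le1 p : lo p + len p <= 1.
Proof. by have := value_le1 (p +++ cst true); rewrite value_sapp value_cst mulr1. Qed.

(** The relation identifying the two expansions of a dyadic number. *)
Definition twins w v := exists p,
  (w = p +++ false ::: cst true /\ v = p +++ true ::: cst false) \/
  (v = p +++ false ::: cst true /\ w = p +++ true ::: cst false).

Lemma value_eq w v : value w = value v <-> w = v \/ twins w v.
Proof.
split=> [h|]; last first.
  by case=> [->//|[p [[-> ->]|[-> ->]]]]; rewrite !value_sapp !value_scons !value_cst /=; lra.
have [->|/first_difference] := pselect (w = v); first by left.
move=> [p [a [b [w' [v' [ab ew ev]]]]]]; right; exists p; move: h.
rewrite ew ev !value_sapp => /addrI /(mulfI (lt0r_neq0 (len_gt0 p))).
rewrite !value_scons; have := value_bounds w'; have := value_bounds v'.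
case: a ab {ew} => /= ab; case: b ab {ev} => //= _ hv hw h; [right|left].
  have -> : w' = cst false by apply/value_eq0; lra.
  by have -> : v' = cst true by apply/value_eq1; lra.
have -> : w' = cst true by apply/value_eq1; lra.
by have -> : v' = cst false by apply/value_eq0; lra.
Qed.

(** Expansions of [t]: [c] chooses the digit, and the remainder is kept. *)
Definition rest (c : R -> bool) t : R := 2 * t - (c t)%:R.
Definition digits c t : nat -> bool := fun k => c (iter k (rest c) t).

Lemma digits_scons c t : digits c t = c t ::: digits c (rest c t).
Proof. by apply: funext => -[|k] //; rewrite /digits iterSr. Qed.

Lemma digits_prefix c t n :
  t = lo (mkseq (digits c t) n) + len (mkseq (digits c t) n) * iter n (rest c) t.
Proof.
elim: n t => [|n IH] t; first by rewrite /len /= expr0; lra.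
rewrite (digits_scons c t) mkseq_scons iterSr /= /len /= exprS.
have := IH (rest c t); rewrite {1 2}/rest /len; lra.
Qed.

Lemma half_lt (e : R) : 0 < e -> exists n, 2^-1 ^+ n < e.
Proof.
move=> e0; have : (fun n => 2^-1 ^+ n : R) @ \oo --> (0 : R).
  by apply: cvg_expr; rewrite ger0_norm ?invf_lt1 //; lra.
move/cvgrPdist_lt => /(_ e e0) [n _ /(_ n (leqnn n))] h; exists n.
by move: h; rewrite /= sub0r normrN ger0_norm // exprn_ge0.
Qed.

Lemma value_digits c t : (forall n, 0 <= iter n (rest c) t <= 1) -> value (digits c t) = t.
Proof.
move=> h; apply/eqP; rewrite -subr_eq0 -normr_le0 leNgt; apply/negP => /half_lt [n].
set d := digits c t; set x := value (sdrop n d) - iter n (rest c) t.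
have -> : value d - t = 2^-1 ^+ n * x.
  have h1 := value_sapp (mkseq d n) (sdrop n d); rewrite sapp_mkseq in h1.
  by rewrite h1 {1}(digits_prefix c t n) /len size_mkseq /x mulrBr; lra.
rewrite normrM ger0_norm ?exprn_ge0 // ltr_pMr ?exprn_gt0 // ltNge ler_norml.
by rewrite /x; have := h n; have := value_bounds (sdrop n d); lra.
Qed.

Definition right_digit t := 2^-1 <= t.
Definition left_digit t := 2^-1 < t.

Lemma right_rest t n : 0 <= t < 1 -> 0 <= iter n (rest right_digit) t < 1.
Proof.
move=> h; elim: n => //= n; rewrite /rest /right_digit; move: (iter _ _ _) => s.
by case: (leP 2^-1 s) => /= ? /andP[? ?]; rewrite ?subr0; apply/andP; split; lra.
Qed.

Lemma left_rest t n : 0 < t <= 1 -> 0 < iter n (rest left_digit) t <= 1.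
Proof.
move=> h; elim: n => //= n; rewrite /rest /left_digit; move: (iter _ _ _) => s.
by case: (ltP 2^-1 s) => /= ? /andP[? ?]; rewrite ?subr0; apply/andP; split; lra.
Qed.

Lemma value_surj t : 0 <= t <= 1 -> exists w, value w = t.
Proof.
move=> h; have [t1|t1] := ltP t 1.
  by exists (digits right_digit t); apply: value_digits => n;
    have := @right_rest t n; lra.
by exists (cst true); rewrite value_cst /=; lra.
Qed.

Lemma value_agree w v n : mkseq w n = mkseq v n -> `|value w - value v| <= 2^-1 ^+ n.
Proof.
move=> e; rewrite -(sapp_mkseq n w) -(sapp_mkseq n v) e !value_sapp.
rewrite opprD addrACA subrr add0r -mulrBr normrM ger0_norm; last exact/ltW/len_gt0.
rewrite /len size_mkseq ger_pMr ?exprn_gt0 // ler_norml.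
by have := value_bounds (sdrop n w); have := value_bounds (sdrop n v); lra.
Qed.

(** Points just to the right of [t] share with [t] any given number of digits of
    the expansion of [t] that does not end with ones. *)
Lemma right_cylinder t n : 0 <= t < 1 -> exists2 e : R, 0 < e &
  forall s, t <= s < t + e -> exists2 v, value v = s &
    mkseq v n = mkseq (digits right_digit t) n.
Proof.
move=> h; set p := mkseq (digits right_digit t) n; set x := iter n (rest right_digit) t.
have xb : 0 <= x < 1 := right_rest n h.
have et : t = lo p + len p * x := digits_prefix _ _ _.
have lp := len_gt0 p; exists (len p * (1 - x)); first by rewrite mulr_gt0 //; lra.
move=> s hs; have [|v hv] := @value_surj ((s - lo p) / len p).
  apply/andP; split; first by apply: divr_ge0; [have := mulr_ge0 (ltW lp) (andP xb).1; lra|exact: ltW].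
  by rewrite ler_pdivrMr //; lra.
exists (p +++ v); first by rewrite value_sapp hv mulrC divfK ?gt_eqF //; lra.
by rewrite mkseq_sapp_take ?size_mkseq // take_oversize // size_mkseq.
Qed.

Lemma left_cylinder t n : 0 < t <= 1 -> exists2 e : R, 0 < e &
  forall s, t - e < s <= t -> exists2 v, value v = s &
    mkseq v n = mkseq (digits left_digit t) n.
Proof.
move=> h; set p := mkseq (digits left_digit t) n; set x := iter n (rest left_digit) t.
have xb : 0 < x <= 1 := left_rest n h.
have et : t = lo p + len p * x := digits_prefix _ _ _.
have lp := len_gt0 p; exists (len p * x); first by rewrite mulr_gt0 //; lra.
move=> s hs; have [|v hv] := @value_surj ((s - lo p) / len p).
  apply/andP; split; first by apply: divr_ge0; [have := mulr_gt0 lp (andP xb).1; lra|exact: ltW].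
  rewrite ler_pdivrMr // mul1r.
  have : len p * x <= len p * 1 by rewrite ler_pM2l //; case/andP: xb.
  lra.
exists (p +++ v); first by rewrite value_sapp hv mulrC divfK ?gt_eqF //; lra.
by rewrite mkseq_sapp_take ?size_mkseq // take_oversize // size_mkseq.
Qed.

(** * The interval and the circle as presented spaces *)

Lemma value_in w : value w \in (`[0, 1]%classic : set R).
Proof. by rewrite inE /= in_itv /= value_bounds. Qed.

Definition Qi w : unit_itv R := SigSub (value_in w).

Lemma Qi_eq w v : Qi w = Qi v <-> w = v \/ twins w v.
Proof. by rewrite -value_eq; split=> [/(congr1 val)|h] //; exact: val_inj. Qed.

Lemma unit_itvP (x : unit_itv R) : 0 <= (val x : R) <= 1.
Proof. by have := set_valP x; rewrite /= in_itv. Qed.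

Definition okb (c : unit) (b : bool) := true.
Definition nxb (c : unit) (b : bool) := c.

Lemma vwb p c : vword okb nxb c p. Proof. by elim: p. Qed.
Lemma vsb w c : vstream okb nxb c w. Proof. by move=> n; exact: vwb. Qed.

Lemma Qi_surj x : exists2 w, vstream okb nxb tt w & Qi w = x.
Proof.
have [w hw] := value_surj (unit_itvP x); exists w; first exact: vsb.
exact: val_inj.
Qed.

Definition gbit : nat -> bool := odd.

Lemma gbit_hits p b n : exists2 k, (n <= k)%N & (p +++ gbit) k = b.
Proof.
exists (size p + (n.*2 + b))%N; first by rewrite -addnn; lia.
by rewrite sappE ltnNge leq_addr /= addKn /gbit oddD odd_double; case: b.
Qed.

Lemma gbit_tail p q b c : p +++ gbit <> q +++ c ::: cst b.
Proof.
move=> e; have [k qk] := gbit_hits p (~~ b) (size q).+1.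
rewrite e sappE ltnNge (ltnW qk) /=.
by case E : (k - size q)%N => [|m] /=; [move: qk; rewrite -subn_gt0 E|case: b {e}].
Qed.

Lemma gbit_twins p v : ~ twins (p +++ gbit) v.
Proof. by move=> [q [[/gbit_tail]|[_ /gbit_tail]]]. Qed.

Lemma Qi_generic p : vword okb nxb tt p -> exists2 u, vstream okb nxb (endc nxb tt p) u &
  forall v, vstream okb nxb tt v -> Qi v = Qi (p +++ u) -> v = p +++ u.
Proof.
move=> _; exists gbit; first exact: vsb.
by move=> v _ /esym /Qi_eq [//|/gbit_twins].
Qed.

Lemma okb2 c b : exists2 b', b' != b & okb c b'.
Proof. by exists (~~ b) => //; case: b. Qed.

Lemma boolsP b : b \in [:: true; false]. Proof. by case: b. Qed.

(** A neighbourhood of a point is made of a cylinder on each side of it, given by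
    its two expansions. *)
Lemma Qi_open (U : set (unit_itv R)) : open U <->
  forall u, vstream okb nxb tt u -> U (Qi u) -> exists n, forall v,
    vstream okb nxb tt v -> mkseq v n = mkseq u n -> U (Qi v).
Proof.
split=> [[V oV <-] u _ Vu|h].
  have /nbhs_ballP [e /= e0 he] : nbhs (value u) V by exact: open_nbhs_nbhs.
  have [n hn] := half_lt e0; exists n => v _ /value_agree vu; apply: he => /=.
  by rewrite /ball /= distrC (le_lt_trans vu).
rewrite openE => x Ux; set t : R := val x; have tb : 0 <= t <= 1 := unit_itvP x.
have near w y : value w = val y -> Qi w = y by move=> e; exact: val_inj.
have eqx y : val y = t :> R -> y = x by move=> e; exact: val_inj.
have [e1 e10 h1] : exists2 e : R, 0 < e & forall y, t <= val y < t + e -> U y.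
  have [t1|t1] := ltP t 1; last first.
    exists 1 => // y hy; suff -> : y = x by [].
    by apply: eqx; move: hy (unit_itvP y); lra.
  have tb1 : 0 <= t < 1 by lra.
  have [|n hn] := h (digits right_digit t) (vsb _ _).
    by rewrite (near _ x) //; apply: value_digits => k; case/andP: (right_rest k tb1) => -> /ltW ->.
  have [e e0 he] := right_cylinder n tb1; exists e => // y /he [v vy ev].
  by rewrite -(near v y vy); apply: hn => //; exact: vsb.
have [e2 e20 h2] : exists2 e : R, 0 < e & forall y, t - e < val y <= t -> U y.
  have [t0|t0] := ltP 0 t; last first.
    exists 1 => // y hy; suff -> : y = x by [].
    by apply: eqx; move: hy (unit_itvP y); lra.
  have tb1 : 0 < t <= 1 by lra.
  have [|n hn] := h (digits left_digit t) (vsb _ _).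
    by rewrite (near _ x) //; apply: value_digits => k; case/andP: (left_rest k tb1) => /ltW -> ->.
  have [e e0 he] := left_cylinder n tb1; exists e => // y /he [v vy ev].
  by rewrite -(near v y vy); apply: hn => //; exact: vsb.
rewrite /interior nbhsE /=; exists (val @^-1` (ball t (Order.min e1 e2))).
  split; last by apply: ballxx; rewrite lt_min e10.
  by exists (ball t (Order.min e1 e2)) => //; exact: ball_open.
move=> y hy; have {hy} : `|t - (val y : R)| < Order.min e1 e2 := hy.
rewrite lt_min !ltr_norml => /andP[/andP[a1 a2] /andP[b1 b2]].
by have [ty|ty] := leP t (val y); [apply: h1|apply: h2]; apply/andP; split; lra.
Qed.

Definition itv : presentation :=
  Presentation boolsP okb2 Qi_surj Qi_generic Qi_open.

Definition Qc w : circle R := circle_pt (Qi w).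

Lemma same_circleP x y : circle_pt x = circle_pt y <-> @same_circle_point R x y.
Proof. by split=> [/eqquotP|h] //; apply/eqquotP. Qed.

Lemma Qc_eq w v : Qc w = Qc v <-> w = v \/ twins w v \/
  (w = cst false /\ v = cst true) \/ (w = cst true /\ v = cst false).
Proof.
rewrite same_circleP /same_circle_point /= !inE; split.
  case/orP => [/eqP /value_eq [->|]|]; [by left|by right; left|].
  case/andP=> /orP[] /eqP /= + /orP[] /eqP /=.
  - by move=> /value_eq0 -> /value_eq0 ->; left.
  - by move=> /value_eq0 -> /value_eq1 ->; right; right; left.
  - by move=> /value_eq1 -> /value_eq0 ->; right; right; right.
  - by move=> /value_eq1 -> /value_eq1 ->; left.
case=> [->|[h|[[-> ->]|[-> ->]]]]; rewrite ?eqxx //.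
- by rewrite (value_eq w v).2 ?eqxx //; right.
- by rewrite !value_cst /= !eqxx !orbT.
- by rewrite !value_cst /= !eqxx !orbT.
Qed.

Lemma Qc_surj x : exists2 w, vstream okb nxb tt w & Qc w = x.
Proof.
have [w vw' hw] := Qi_surj (repr x); exists w => //.
by rewrite /Qc hw /circle_pt reprK.
Qed.

Lemma Qc_gbit p v : Qc v = Qc (p +++ gbit) -> v = p +++ gbit.
Proof.
move/esym/Qc_eq => [//|[/gbit_twins//|[[h _]|[h _]]]].
all: by move: h; rewrite cstE => /(@gbit_tail p [::]).
Qed.

Lemma Qc_generic p : vword okb nxb tt p -> exists2 u, vstream okb nxb (endc nxb tt p) u &
  forall v, vstream okb nxb tt v -> Qc v = Qc (p +++ u) -> v = p +++ u.
Proof.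
by move=> _; exists gbit; [exact: vsb|move=> v _; exact: Qc_gbit].
Qed.

Lemma Qc_open (U : set (circle R)) : open U <->
  forall u, vstream okb nxb tt u -> U (Qc u) -> exists n, forall v,
    vstream okb nxb tt v -> mkseq v n = mkseq u n -> U (Qc v).
Proof. exact: (Qi_open (@circle_pt R @^-1` U)). Qed.

Definition circ : presentation :=
  Presentation boolsP okb2 Qc_surj Qc_generic Qc_open.

End Binary.

(** * Thompson's groups as prefix-replacement groups *)

Section Thompson.
Import Order.TTheory GRing.Theory Num.Theory numFieldNormedType.Exports.
Local Open Scope ring_scope.
Variable R : realType.
Implicit Types (w v u : nat -> bool) (p q r : seq bool).
Local Notation Qi := (@Qi R).
Local Notation Qc := (@Qc R).
Local Notation value := (@value R).
Local Notation lo := (@lo R).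
Local Notation len := (@len R).

Definition wint p : R * R := (lo p, lo p + len p).

Lemma coordinate p (t : R) : lo p <= t <= lo p + len p -> 0 <= (t - lo p) / len p <= 1.
Proof.
have lp := len_gt0 R p; move=> /andP[h1 h2]; apply/andP; split.
  by apply: divr_ge0; [lra|exact: ltW].
by rewrite ler_pdivrMr //; lra.
Qed.

Lemma wint_halves p : wint (rcons p false) = (lo p, (lo p + (lo p + len p)) / 2) /\
  wint (rcons p true) = ((lo p + (lo p + len p)) / 2, lo p + len p).
Proof. by rewrite /wint !lo_rcons !len_rcons /=; split; congr (_, _); lra. Qed.

Lemma subdivision_words D : dyadic_subdivision D -> exists2 ps, D = map wint ps &
  exists n, forall w : seq bool, size w = n ->
    exists2 p, p \in ps & exists r, w = p ++ r.
Proof.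
elim=> [|s1 a b s2 _ [ps eD [n hn]]].
  exists [:: [::]]; first by rewrite /wint /= /len expr0 add0r.
  by by exists 0%N => w _; exists [::] => //; exists w.
have [ps1 [p [ps2 [eps e1 ep e2]]]] : exists ps1 p ps2, [/\ ps = ps1 ++ p :: ps2,
    map wint ps1 = s1, wint p = (a, b) & map wint ps2 = s2].
  elim: s1 ps eD {hn} => [|c s1 IH] [|p ps] //= [].
    by move=> -> ->; exists [::], p, ps.
  move=> -> /IH [ps1 [p' [ps2 [-> <- e2 <-]]]].
  by exists (p :: ps1), p', ps2.
have [h1 h2] := wint_halves p; case: (ep) => ea eb.
exists (ps1 ++ [:: rcons p false; rcons p true] ++ ps2).
  by rewrite !map_cat /= h1 h2 e1 e2 eb ea.
exists (maxn n (size p).+1) => w sw.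
have [|x] := hn (take n w); first by rewrite size_takel // sw leq_maxl.
rewrite eps mem_cat inE => hx [r er].
have ew : w = x ++ (r ++ drop n w) by rewrite catA -er cat_take_drop.
case/or3P: hx => [xp|/eqP xp|xp].
- by exists x; [rewrite mem_cat xp|exists (r ++ drop n w)].
- move: (r ++ drop n w) ew => [|c t] ew.
    by move: sw; rewrite ew cats0 xp => sp; have := leq_maxr n (size p).+1; rewrite -sp ltnn.
  exists (rcons p c); first by rewrite !mem_cat !inE; case: c {ew}; rewrite eqxx ?orbT.
  by exists t; rewrite cat_rcons ew xp.
- by exists x; [rewrite !mem_cat xp !orbT|exists (r ++ drop n w)].
Qed.

Section Dyadic.
Variables (X : Type) (pr : unit_itv R -> X) (f : X -> X).
Local Notation Q w := (pr (Qi w)).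

(** Prefix replacement of binary expansions, in the quotient of [0, 1] by [pr]. *)
Definition bcanon (h : X -> X) p q := forall u, h (Q (p +++ u)) = Q (q +++ u).

Lemma bcanon_cat h p q r : bcanon h p q -> bcanon h (p ++ r) (q ++ r).
Proof. by move=> c u; rewrite !sapp_cat. Qed.

(** Replacing [p] by [q] is the increasing affine map between the dyadic intervals
    named by [p] and [q]. *)
Lemma bcanon_linear p q : bcanon f p q -> maps_linearly_onto pr f (wint p) (wint q).
Proof.
move=> h; have lp := len_gt0 R p; have lq := len_gt0 R q.
have lp0 : len p != 0 by rewrite gt_eqF.
exists (len q / len p), (lo q - len q / len p * lo p); split.
  apply/seteqP; split=> [_ [t + <-]|t]; rewrite /= !in_itv /= => ht.
    have -> : len q / len p * t + (lo q - len q / len p * lo p) =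
      lo q + len q * ((t - lo p) / len p) by field.
    have : 0 <= (t - lo p) / len p <= 1.
      exact: coordinate.
    by move=> /andP[h0 h1]; rewrite lerDl lerD2l mulr_ge0 ?(ltW lq) //= ger_pMr.
  exists (lo p + len p * ((t - lo q) / len q)); last by field; rewrite lp0 gt_eqF.
  have : 0 <= (t - lo q) / len q <= 1.
    by apply/andP; split; [rewrite divr_ge0 ?(ltW lq) //|rewrite ler_pdivrMr //]; lra.
  by move=> /andP[h0 h1]; rewrite in_itv /= lerDl lerD2l mulr_ge0 ?(ltW lp) //= ger_pMr.
move=> s t; set x : R := val s; set y : R := val t; rewrite in_itv /= => hs ht.
have [|u hu] := @value_surj R ((x - lo p) / len p); first exact: coordinate.
have e1 : value (p +++ u) = x by rewrite value_sapp hu; field.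
have e2 : value (q +++ u) = y by rewrite value_sapp hu ht; field.
by rewrite -(_ : Qi (p +++ u) = s) ?h; [congr pr|]; exact: val_inj.
Qed.

Lemma linear_bcanon p q alpha beta : 0 < alpha ->
  (fun t => alpha * t + beta) @` `[(wint p).1, (wint p).2] = `[(wint q).1, (wint q).2]%classic ->
  (forall s t : unit_itv R, val s \in `[(wint p).1, (wint p).2] ->
      val t = alpha * val s + beta -> f (pr s) = pr t) -> bcanon f p q.
Proof.
move=> a0 /= im h u; have lp := len_gt0 R p; have lq := len_gt0 R q.
have img t : lo p <= t <= lo p + len p -> lo q <= alpha * t + beta <= lo q + len q.
  move=> ht; have : ((fun t => alpha * t + beta) @` `[lo p, lo p + len p]) (alpha * t + beta).
    by exists t => //=; rewrite in_itv.
  by rewrite im /= in_itv.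
have pre s : lo q <= s <= lo q + len q ->
    exists2 t, lo p <= t <= lo p + len p & s = alpha * t + beta.
  move=> hs; have : `[lo q, lo q + len q]%classic s by rewrite /= in_itv.
  by rewrite -im => -[t /=]; rewrite in_itv => ht <-; exists t.
have e1 : alpha * lo p + beta = lo q.
  have [|t ht e] := pre (lo q); first by lra.
  have : alpha * lo p <= alpha * t by rewrite ler_pM2l //; lra.
  have := img (lo p); lra.
have e2 : alpha * (lo p + len p) + beta = lo q + len q.
  have [|t ht e] := pre (lo q + len q); first by lra.
  have : alpha * t <= alpha * (lo p + len p) by rewrite ler_pM2l //; lra.
  have := img (lo p + len p); lra.
have e3 : alpha * len p = len q by lra.
apply: h => /=; last first.
  by rewrite !value_sapp mulrDr -e3 -e1; ring.
rewrite in_itv /= value_sapp lerDl lerD2l mulr_ge0 ?(ltW lp) ?value_ge0 //=.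
by rewrite ger_pMr // value_le1.
Qed.

(** Every long word has a prefix naming an interval of the given subdivision. *)
Lemma dyadic_map_bcanon :
  (forall p q alpha beta,
    (fun t => alpha * t + beta) @` `[(wint p).1, (wint p).2] = `[(wint q).1, (wint q).2]%classic ->
    (forall s t : unit_itv R, val s \in `[(wint p).1, (wint p).2] ->
      val t = alpha * val s + beta -> f (pr s) = pr t) -> 0 < alpha) ->
  dyadic_map pr f -> exists n, forall p, size p = n -> exists q, bcanon f p q.
Proof.
move=> pos [D [E [/subdivision_words [ps -> [n hn]] /subdivision_words [qs -> _] hD _]]].
exists n => w /hn [p pps [r ->]].
have [K /mapP [q _ ->] [alpha [beta [im h]]]] := hD _ (map_f wint pps).
exists (q ++ r); apply: bcanon_cat; exact: linear_bcanon (pos _ _ _ _ im h) im h.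
Qed.

(** The cells reached by halving [p] at most [n] times, as long as the cell is not
    [reg]. *)
Fixpoint leaves (reg : pred (seq bool)) n p : seq (seq bool) :=
  if reg p then [:: p] else
  if n is m.+1 then leaves reg m (rcons p false) ++ leaves reg m (rcons p true)
  else [:: p].

Lemma leaves_subdivision reg n p s1 s2 : dyadic_subdivision (s1 ++ wint p :: s2) ->
  dyadic_subdivision (s1 ++ map wint (leaves reg n p) ++ s2).
Proof.
elim: n p s1 s2 => [|n IH] p s1 s2 h /=; first by case: ifP.
case: ifP => // _; rewrite map_cat -catA; apply: (IH); rewrite -cat_rcons.
have [h1 h2] := wint_halves p.
rewrite cat_rcons -cat_rcons; apply: (IH).
by rewrite cat_rcons h1 h2; exact: dyadic_halve h.
Qed.

Lemma leavesP (reg : pred (seq bool)) n p x : 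
  (forall r, size r = n -> reg (p ++ r)) ->
  (x \in leaves reg n p) <-> exists2 r, x = p ++ r &
    reg x /\ forall r' t, r = r' ++ t -> t != [::] -> ~~ reg (p ++ r').
Proof.
elim: n p x => [|n IH] p x h; rewrite /leaves -/leaves.
  have rp : reg p by have := h [::] erefl; rewrite cats0.
  rewrite rp inE; split=> [/eqP ->|[[|a r] -> [_ H]]]; rewrite ?cats0 //.
    exists [::]; rewrite ?cats0 //; split=> // -[|b r'] [|c t] //.
  by have := H [::] _ erefl isT; rewrite cats0 rp.
case: ifP => rp.
  rewrite inE; split=> [/eqP ->|[[|a r] -> [_ H]]]; rewrite ?cats0 //.
    exists [::]; rewrite ?cats0 //; split=> // -[|b r'] [|c t] //.
  by have := H [::] _ erefl isT; rewrite cats0 rp.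
have hb b r : size r = n -> reg (rcons p b ++ r) by move=> sr; rewrite cat_rcons h //= sr.
rewrite mem_cat; split.
  have step b : x \in leaves reg n (rcons p b) -> exists2 r, x = p ++ r &
      reg x /\ forall r' t, r = r' ++ t -> t != [::] -> ~~ reg (p ++ r').
    move=> /(IH _ _ (hb b)) [r -> [rx H]]; exists (b :: r); first by rewrite cat_rcons.
    split=> // -[|c r'] t; first by rewrite cats0 rp.
    by move=> /= [<- er] tn; rewrite -cat_rcons; exact: H er tn.
  by case/orP => /step.
move=> [[|b r] -> [rx H]]; first by rewrite cats0 rp in rx.
suff : p ++ b :: r \in leaves reg n (rcons p b) by case: b {rx H} => ->; rewrite ?orbT.
apply/(IH _ _ (hb b)); exists r; first by rewrite cat_rcons.
split=> // r' t er tn; rewrite cat_rcons; apply: (H (b :: r') t) => //.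
by rewrite er.
Qed.

(** The coarsest cells on which [f] and its inverse act by prefix replacement
    are the leaves of two matching subdivisions. *)
Lemma bcanon_dyadic_map g : cancel f g -> cancel g f ->
  (forall h p q q', bcanon h p q -> bcanon h p q' -> q = q') ->
  (exists n, forall p, size p = n -> exists q, bcanon f p q) ->
  (exists n, forall p, size p = n -> exists q, bcanon g p q) -> dyadic_map pr f.
Proof.
move=> fK gK fun1 [n hf] [m hg].
pose reg h p := `[< exists q, bcanon h p q >].
have rf r : size r = n -> reg f ([::] ++ r) by move=> /hf ?; apply/asboolP.
have rg r : size r = m -> reg g ([::] ++ r) by move=> /hg ?; apply/asboolP.
have can h k p q : cancel h k -> bcanon h p q -> bcanon k q p.
  by move=> hK c u; rewrite -c hK.
have key h k n1 m1 p q : cancel h k -> cancel k h ->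
    (forall r, size r = n1 -> reg h ([::] ++ r)) ->
    (forall r, size r = m1 -> reg k ([::] ++ r)) ->
    p \in leaves (reg h) n1 [::] -> bcanon h p q -> q \in leaves (reg k) m1 [::].
  move=> hK kK rh rk /(leavesP _ rh) [r -> [_ H]] /= c; apply/(leavesP _ rk).
  exists q => //; split; first by apply/asboolP; exists r; exact: can c.
  move=> q0 z eq zn; apply/negP => /asboolP [p0 c0].
  have ep : r = p0 ++ z.
    by apply: (fun1 k q); [exact: can c|rewrite eq; exact: bcanon_cat].
  have /negP := H _ _ ep zn; apply; apply/asboolP; exists q0; exact: can c0.
exists (map wint (leaves (reg f) n [::])), (map wint (leaves (reg g) m [::])).
have unit : wint [::] = (0, 1) by rewrite /wint /= /len expr0 add0r.
split.
- by have := @leaves_subdivision (reg f) n [::] [::] [::]; rewrite cats0 unit; apply; exact: dyadic_unit.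
- by have := @leaves_subdivision (reg g) m [::] [::] [::]; rewrite cats0 unit; apply; exact: dyadic_unit.
- move=> J /mapP [p pl ->]; have /(leavesP _ rf) [_ _ [/asboolP [q c] _]] := pl.
  exists (wint q); first by apply: map_f; exact: key pl c.
  exact: bcanon_linear.
- move=> K /mapP [q ql ->]; have /(leavesP _ rg) [_ _ [/asboolP [p c] _]] := ql.
  exists (wint p); first by apply: map_f; exact: key ql c.
  by apply: bcanon_linear; exact: can c.
Qed.

End Dyadic.

End Thompson.

Section Groups.
Import Order.TTheory GRing.Theory Num.Theory numFieldNormedType.Exports.
Local Open Scope ring_scope.
Variable R : realType.
Implicit Types (w v : nat -> bool) (p q r : seq bool).
Local Notation Qi := (@Qi R).
Local Notation Qc := (@Qc R).
Local Notation value := (@value R).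
Local Notation lo := (@lo R).
Local Notation len := (@len R).
Local Notation itv := (itv R).
Local Notation circ := (circ R).

Lemma unit_eq (x y : unit) : x = y. Proof. by case: x y => -[]. Qed.

Lemma canon_itv (f : unit_itv R -> unit_itv R) p q :
  canon (S := itv) f p q <-> bcanon id f p q.
Proof.
split=> [[_ _ h] u|h]; first by apply: h; exact: vsb.
by split=> [||u _]; [exact: vwb|exact: unit_eq|exact: h].
Qed.

Lemma canon_circ (f : circle R -> circle R) p q :
  canon (S := circ) f p q <-> bcanon (@circle_pt R) f p q.
Proof.
split=> [[_ _ h] u|h]; first by apply: h; exact: vsb.
by split=> [||u _]; [exact: vwb|exact: unit_eq|exact: h].
Qed.

Lemma bcanon_fun_itv h p q q' : bcanon (R := R) id h p q -> bcanon id h p q' -> q = q'.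
Proof.
by move=> /canon_itv c /canon_itv; apply: (@canon_fun itv _ _ _ _ _ c); exact: vwb.
Qed.

Lemma bcanon_fun_circ h p q q' : bcanon (@circle_pt R) h p q ->
  bcanon (@circle_pt R) h p q' -> q = q'.
Proof.
by move=> /canon_circ c /canon_circ; apply: (@canon_fun circ _ _ _ _ _ c); exact: vwb.
Qed.

Lemma tame_itv (f : unit_itv R -> unit_itv R) : tame (S := itv) f <->
  exists n, forall p, size p = n -> exists q, bcanon id f p q.
Proof.
split=> -[n h]; exists n => p.
  by move=> sp; have [|q /canon_itv c] := h p _ sp; [exact: vwb|exists q].
by move=> _ /h [q /canon_itv c]; exists q.
Qed.

Lemma tame_circ (f : circle R -> circle R) : tame (S := circ) f <->
  exists n, forall p, size p = n -> exists q, bcanon (@circle_pt R) f p q.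
Proof.
split=> -[n h]; exists n => p.
  by move=> sp; have [|q /canon_circ c] := h p _ sp; [exact: vwb|exists q].
by move=> _ /h [q /canon_circ c]; exists q.
Qed.

Lemma twin_Qi p : Qi (p +++ false ::: cst true) = Qi (p +++ true ::: cst false).
Proof. by apply/Qi_eq; right; exists p; left. Qed.

Lemma twin_Qc p : Qc (p +++ false ::: cst true) = Qc (p +++ true ::: cst false).
Proof. by congr circle_pt; exact: twin_Qi. Qed.

(** Monotonicity spreads from long cells to all cells through the common ends
    of the two halves of a cell. *)
Lemma tame_monotone (f : unit_itv R -> unit_itv R) : tame (S := itv) f ->
  forall s t : unit_itv R, val s <= val t :> R -> val (f s) <= val (f t) :> R.
Proof.
move=> /tame_itv [n h].
pose F w : R := val (f (Qi w)).
have mono m p : (n <= size p + m)%N ->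
    forall u v, value u <= value v -> F (p +++ u) <= F (p +++ v).
  elim: m p => [|m IH] p.
    rewrite addn0 => np u v uv.
    have [q c] := h (take n p) (size_takel np).
    have {}c : bcanon id f p (q ++ drop n p) by rewrite -{1}(cat_take_drop n p); exact: bcanon_cat.
    rewrite /F !c /= !value_sapp lerD2l ler_pM2l //; exact: len_gt0.
  move=> np.
  have IH' b u v : value u <= value v -> F (p +++ b ::: u) <= F (p +++ b ::: v).
    by rewrite -!sapp_rcons; apply: IH; rewrite size_rcons addSnnS.
  move=> u v; rewrite (scons_eta u) (scons_eta v); move: (sdrop 1 u) (sdrop 1 v) => u' v'.
  rewrite !value_scons; have bu := value_bounds R u'; have bv := value_bounds R v'.
  case: (u 0) (v 0) => -[] /= uv; try by apply: IH'; lra.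
    have eu : u' = cst false by apply/(value_eq0 R); lra.
    have ev : v' = cst true by apply/(value_eq1 R); lra.
    by rewrite /F eu ev twin_Qi.
  apply: (@le_trans _ _ (F (p +++ false ::: cst true))).
    by apply: IH'; rewrite value_cst /=; lra.
  by rewrite {1}/F twin_Qi; apply: IH'; rewrite value_cst /=; lra.
move=> s t; have [u _ <-] := Qi_surj s; have [v _ <-] := Qi_surj t => uv.
exact: (mono n [::] (leqnn n) u v uv).
Qed.

(** Since [f] is increasing, its slopes are positive, so that it replaces prefixes. *)
Lemma thompson_F_tame (f : homeo (unit_itv R)) : thompson_F R f <-> tame (S := itv) f.
Proof.
split=> [[inc dm]|tf].
  apply/tame_itv; apply: dyadic_map_bcanon dm => p q alpha beta /= im h.
  have lp := len_gt0 R p.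
  have ex (s : R) : lo p <= s <= lo p + len p -> exists x y : unit_itv R,
      [/\ val x = s, val y = alpha * s + beta & f x = y].
    move=> hs.
    have s01 : s \in (`[0, 1]%classic : set R).
      by rewrite inE /= in_itv /=; have := lo_ge0 R p; have := hi_le1 R p; lra.
    have t01 : alpha * s + beta \in (`[0, 1]%classic : set R).
      have : ((fun t => alpha * t + beta) @` `[lo p, lo p + len p]) (alpha * s + beta).
        by exists s => //=; rewrite in_itv.
      rewrite im inE /= !in_itv /= => ht.
      by have := lo_ge0 R q; have := hi_le1 R q; lra.
    exists (SigSub s01), (SigSub t01); split=> //; apply: h => //=.
  have [|x [y [ex1 ey fxy]]] := ex (lo p); first by lra.
  have [|x' [y' [ex' ey' fxy']]] := ex (lo p + len p); first by lra.
  have : (val y : R) < val y'.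
    by rewrite -fxy -fxy'; apply: inc; rewrite ex1 ex'; lra.
  rewrite ey ey' => hh; have : 0 < alpha * len p by lra.
  by rewrite pmulr_lgt0.
split.
  move=> s t st; rewrite lt_neqAle tame_monotone ?(ltW st) // andbT.
  apply/eqP => /val_inj /(can_inj (homeo_funK f)) e.
  by move: st; rewrite e ltxx.
apply: (bcanon_dyadic_map (homeo_funK f) (homeo_invK f)).
- exact: bcanon_fun_itv.
- exact/tame_itv.
- by apply/tame_itv; exact: (tame_homeoV tf).
Qed.

Definition congr1Z (x y : R) := exists i : int, x = y + i%:~R.

Lemma Qc_congr w v : Qc w = Qc v <-> congr1Z (value w) (value v).
Proof.
rewrite Qc_eq; split.
  case=> [->|[h|[[-> ->]|[-> ->]]]]; rewrite ?value_cst /=.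
  - by exists 0; rewrite addr0.
  - by exists 0; rewrite addr0; apply/value_eq; right.
  - by exists (-1); rewrite mulrN1z; lra.
  - by exists 1; lra.
move=> [i e]; have bw := value_bounds R w; have bv := value_bounds R v.
have i1 : (i <= 1)%R by rewrite -(ler_int R); lra.
have i2 : (-1 <= i)%R by rewrite -(ler_int R) mulrN1z; lra.
have [i0|[i0|i0]] : i = 0 \/ i = 1 \/ i = -1 by lia.
- by move: e; rewrite i0 addr0 => /value_eq [|]; [left|right; left].
- move: e; rewrite i0 => e; right; right; right.
  by split; [apply/(value_eq1 R)|apply/(value_eq0 R)]; lra.
- move: e; rewrite i0 mulrN1z => e; right; right; left.
  by split; [apply/(value_eq0 R)|apply/(value_eq1 R)]; lra.
Qed.

(** [f] lifts, on the cell [p], to an increasing continuous real function. *)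
Definition lifts (f : circle R -> circle R) p (F : (nat -> bool) -> R) :=
  [/\ forall u, exists w, f (Qc (p +++ u)) = Qc w /\ congr1Z (F u) (value w),
      forall u v, value u < value v -> F u < F v,
      forall u v, value u = value v -> F u = F v
    & forall y, F (cst false) <= y <= F (cst true) -> exists u, F u = y].

Lemma congr1Z_trans x y z : congr1Z x y -> congr1Z y z -> congr1Z x z.
Proof. by move=> [i ->] [j ->]; exists (j + i); rewrite intrD addrA. Qed.

Lemma congr1Z_sym x y : congr1Z x y -> congr1Z y x.
Proof. by move=> [i ->]; exists (- i); rewrite mulrNz addrK. Qed.

(** The lifts of the two halves of a cell match after adding an integer, because
    the halves share an end. *)
Lemma tame_lifts (f : circle R -> circle R) : tame (S := circ) f -> exists F, lifts f [::] F.
Proof.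
move=> /tame_circ [n h].
suff H m p : (n <= size p + m)%N -> exists F, lifts f p F by exact: (H n [::]).
elim: m p => [|m IH] p.
  rewrite addn0 => np; have [q c] := h (take n p) (size_takel np).
  have {}c : bcanon (@circle_pt R) f p (q ++ drop n p).
    by rewrite -{1}(cat_take_drop n p); exact: bcanon_cat.
  move: (q ++ drop n p) c => {}q c; have lq := len_gt0 R q.
  exists (fun u => value (q +++ u)); split=> [u|u v|u v|y].
  - by exists (q +++ u); split; [exact: c|exists 0; rewrite addr0].
  - by rewrite !value_sapp ltrD2l ltr_pM2l.
  - by rewrite !value_sapp => ->.
  rewrite !value_sapp !value_cst /= mulr0 addr0 mulr1 => /coordinate hy.
  have [u hu] := value_surj hy; exists u; rewrite value_sapp hu; field.
  by rewrite gt_eqF.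
move=> np.
have np' b : (n <= size (rcons p b) + m)%N by rewrite size_rcons addSnnS.
have [F0 [c0 m0 e0 s0]] := IH _ (np' false).
have [F1 [c1 m1 e1 s1]] := IH _ (np' true).
have [d hd] : congr1Z (F0 (cst true)) (F1 (cst false)).
  have [w [fw ww]] := c0 (cst true); have [v [fv vv]] := c1 (cst false).
  apply: (congr1Z_trans ww); apply: congr1Z_trans (congr1Z_sym vv).
  by apply/Qc_congr; rewrite -fw -fv !sapp_rcons twin_Qc.
have le0 u : F0 u <= F0 (cst true).
  have := value_le1 R u; rewrite le_eqVlt => /orP[/eqP h1|h1].
    by rewrite (e0 u (cst true)) // value_cst h1.
  by apply/ltW/m0; rewrite value_cst.
have ge1 u : F1 (cst false) <= F1 u.
  have := value_ge0 R u; rewrite le_eqVlt => /orP[/eqP h1|h1].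
    by rewrite (e1 (cst false) u) // value_cst -h1.
  by apply/ltW/m1; rewrite value_cst.
pose F u := if u 0 then F1 (sdrop 1 u) + d%:~R else F0 (sdrop 1 u).
exists F; split.
- move=> u; rewrite (scons_eta u) /F /=; set u' := sdrop 1 u.
  have -> : sdrop 1 (u 0 ::: u') = u' by apply: funext.
  case: (u 0); rewrite -sapp_rcons.
    have [w [-> ww]] := c1 u'; exists w; split=> //.
    by apply: congr1Z_trans ww; exists d.
  by have [w [-> ww]] := c0 u'; exists w.
- move=> u v; rewrite /F (scons_eta u) (scons_eta v) /= !value_scons.
  set u' := sdrop 1 u; set v' := sdrop 1 v.
  have -> : sdrop 1 (u 0 ::: u') = u' by apply: funext.
  have -> : sdrop 1 (v 0 ::: v') = v' by apply: funext.
  have bu := value_bounds R u'; have bv := value_bounds R v'.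
  have := le0 u'; have := ge1 v'.
  case: (u 0) (v 0) => -[] /= hv hu uv.
  + by rewrite ltrD2r; apply: m1; lra.
  + by exfalso; lra.
  + have [h1|h1] := ltP (value u') 1.
      have : F0 u' < F0 (cst true) by apply: m0; rewrite value_cst.
      by lra.
    have : F1 (cst false) < F1 v' by apply: m1; rewrite value_cst /=; lra.
    by lra.
  + by apply: m0; lra.
- move=> u v; rewrite /F (scons_eta u) (scons_eta v) /= !value_scons.
  set u' := sdrop 1 u; set v' := sdrop 1 v.
  have -> : sdrop 1 (u 0 ::: u') = u' by apply: funext.
  have -> : sdrop 1 (v 0 ::: v') = v' by apply: funext.
  have bu := value_bounds R u'; have bv := value_bounds R v'.
  case: (u 0) (v 0) => -[] /= uv.
  + by congr (_ + _); apply: e1; lra.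
  + have -> : u' = cst false by apply/(value_eq0 R); lra.
    have -> : v' = cst true by apply/(value_eq1 R); lra.
    by [].
  + have -> : v' = cst false by apply/(value_eq0 R); lra.
    have -> : u' = cst true by apply/(value_eq1 R); lra.
    by [].
  + by apply: e0; lra.
move=> y; rewrite /F /=.
have -> b : sdrop 1 (cst b) = cst b by apply: funext.
move=> hy; have [h1|h1] := leP y (F0 (cst true)).
  have [|u hu] := s0 y; first by lra.
  by exists (false ::: u); rewrite -hu /=; congr F0; apply: funext.
have [|u hu] := s1 (y - d%:~R); first by lra.
exists (true ::: u) => /=; have -> : sdrop 1 (true ::: u) = u by apply: funext.
by rewrite hu subrK.
Qed.

Definition ccw (a b c : R) := [\/ a < b < c, b < c < a | c < a < b].

Lemma ccw_fractional (a b c fa fb fc : R) (i j k : int) :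
  a < b -> b < c -> c < a + 1 ->
  a = fa + i%:~R -> b = fb + j%:~R -> c = fc + k%:~R ->
  0 <= fa < 1 -> 0 <= fb < 1 -> 0 <= fc < 1 -> ccw fa fb fc.
Proof.
move=> ab bc ca ea eb ec ha hb hc.
have lt_le (x y : R) (m n : int) : x + m%:~R < y + n%:~R -> 0 <= x < 1 -> 0 <= y < 1 -> (m <= n)%R.
  move=> h hx hy; rewrite -ltzD1 -(ltr_int R) intrD; lra.
have ij : (i <= j)%R by apply: (lt_le fa fb); rewrite -?ea -?eb.
have jk : (j <= k)%R by apply: (lt_le fb fc); rewrite -?eb -?ec.
have ki : (k <= i + 1)%R by apply: (lt_le fc fa); rewrite // intrD -ec addrA -ea.
have [[e1 e2]|[[e1 e2]|[e1 e2]]] : (j = i /\ k = i) \/ (j = i /\ k = i + 1) \/ (j = i + 1 /\ k = i + 1) by lia.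
- by apply: Or31; move: ea eb ec; rewrite e1 e2; lra.
- by apply: Or33; move: ea eb ec; rewrite e1 e2 intrD; lra.
- by apply: Or32; move: ea eb ec; rewrite e1 e2 intrD; lra.
Qed.

Lemma circle_rep (x : circle R) w y : x = Qc w -> congr1Z y (value w) ->
  exists (r : unit_itv R) (i : int),
    [/\ x = circle_pt r, 0 <= (val r : R) < 1 & y = val r + i%:~R].
Proof.
move=> ex [i ey]; have bw := value_bounds R w.
have [w1|w1] := ltP (value w) 1.
  by exists (Qi w), i; split=> //=; lra.
have ew : w = cst true by apply/(value_eq1 R); lra.
exists (Qi (cst false)), (i + 1); split=> /=.
- by rewrite ex ew; apply/Qc_eq; right; right; right.
- by rewrite value_cst /=; lra.
- by rewrite ey ew !value_cst intrD /=; lra.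
Qed.

(** By injectivity the lift increases by exactly 1 around the circle, so it
    preserves the cyclic order. *)
Lemma tame_cyclic (f : homeo (circle R)) : tame (S := circ) f -> cyclic_order_preserving f.
Proof.
move=> /tame_lifts [F [cF mF eF sF]].
have [d hd] : congr1Z (F (cst true)) (F (cst false)).
  have [w [fw ww]] := cF (cst true); have [v [fv vv]] := cF (cst false).
  apply: (congr1Z_trans ww); apply: congr1Z_trans (congr1Z_sym vv).
  by apply/Qc_congr; rewrite -fw -fv; congr (f _); apply/Qc_eq; right; right; right.
have F01 : F (cst false) < F (cst true) by apply: mF; rewrite !value_cst ltr01.
have d1 : d = 1.
  have d0 : (0 < d)%R by rewrite -(ltr_int R); lra.
  have [//|d2] : d = 1 \/ (2 <= d)%R by lia.
  have d2' : (2 : R) <= d%:~R by rewrite -(ler_int R) in d2; lra.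
  have [|u hu] := sF (F (cst false) + 1); first by lra.
  have [w [fw ww]] := cF u; have [v [fv vv]] := cF (cst false).
  have : Qc u = Qc (cst false).
    apply: (can_inj (homeo_funK f)); rewrite /= in fw fv; rewrite fw fv.
    apply/Qc_congr; apply: (congr1Z_trans (congr1Z_sym ww)); apply: congr1Z_trans vv.
    by exists 1; rewrite hu.
  move=> eQ; exfalso; move/Qc_eq: eQ => [e|[h|[[_ h]|[e _]]]].
  - by move: hu; rewrite e; lra.
  - have e : value u = value (cst false) by apply/value_eq; right.
    by move: hu; rewrite (eF _ _ e); lra.
  - by have := congr1 (fun g => g 0%N) h.
  - by move: hu; rewrite e; lra.
have upper u : value u < 1 -> F (cst false) <= F u < F (cst false) + 1.
  move=> u1; apply/andP; split.
    have := value_ge0 R u; rewrite le_eqVlt => /orP[/eqP h1|h1].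
      by rewrite (eF (cst false) u) // value_cst -h1.
    by apply/ltW/mF; rewrite value_cst.
  have : F u < F (cst true) by apply: mF; rewrite value_cst.
  by rewrite hd d1.
have key s t u : (val s : R) < val t -> (val t : R) < val u -> (val u : R) < 1 ->
  exists s' t' u', [/\ f (circle_pt s) = circle_pt s', f (circle_pt t) = circle_pt t',
    f (circle_pt u) = circle_pt u', val s' < 1 /\ val t' < 1 /\ val u' < 1
    & ccw (val s') (val t') (val u')].
  have [ws _ <-] := Qi_surj s; have [wt _ <-] := Qi_surj t; have [wu _ <-] := Qi_surj u.
  move=> /= st tu u1; have [ws' [es cs]] := cF ws; have [wt' [et ct]] := cF wt.
  have [wu' [eu cu]] := cF wu.
  have [s' [i [fs bs ei]]] := circle_rep es cs.
  have [t' [j [ft bt ej]]] := circle_rep et ct.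
  have [u' [k [fu bu ek]]] := circle_rep eu cu.
  exists s', t', u'; split=> //; first by case/andP: bs; case/andP: bt; case/andP: bu.
  have us := upper ws; have uu := upper wu.
  apply: (ccw_fractional (mF _ _ st) (mF _ _ tu) _ ei ej ek) => //.
  have /us : value ws < 1 by lra.
  by have := uu u1; lra.
move=> x y z [s [t [u [-> -> -> [s1 [t1 u1]] [/andP[h1 h2]|/andP[h1 h2]|/andP[h1 h2]]]]]].
- have [s' [t' [u' [es et eu b c]]]] := key _ _ _ h1 h2 u1.
  by exists s', t', u'.
- have [t' [u' [s' [et eu es b c]]]] := key _ _ _ h1 h2 s1.
  exists s', t', u'; split=> //; first by case: b => ? [].
  by case: c => ?; [apply: Or32|apply: Or33|apply: Or31].
- have [u' [s' [t' [eu es et b c]]]] := key _ _ _ h1 h2 t1.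
  exists s', t', u'; split=> //; first by case: b => ? [].
  by case: c => ?; [apply: Or33|apply: Or31|apply: Or32].
Qed.

Lemma circle_pt_inj (s t : unit_itv R) : (val s : R) < 1 -> (val t : R) < 1 ->
  circle_pt s = circle_pt t -> val s = val t :> R.
Proof.
move=> s1 t1 /same_circleP; rewrite /same_circle_point !inE.
case/orP => [/eqP //|/andP[/orP[]/eqP e1 /orP[]/eqP e2]]; rewrite ?e1 ?e2 //.
- by move: t1; rewrite e2 ltxx.
- by move: s1; rewrite e1 ltxx.
Qed.

(** A negative slope would reverse the cyclic order of three points of an interval. *)
Lemma thompson_T_tame (f : homeo (circle R)) : thompson_T R f <-> tame (S := circ) f.
Proof.
have q1 : 0 < (1 / 4 : R) < 1 by lra.
have q2 : 0 < (1 / 2 : R) < 1 by lra.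
have q3 : 0 < (3 / 4 : R) < 1 by lra.
have q12 : (1 / 4 : R) < 1 / 2 by lra.
have q23 : (1 / 2 : R) < 3 / 4 by lra.
split=> [[cyc dm]|tf]; last first.
  split; first exact: tame_cyclic.
  apply: (bcanon_dyadic_map (homeo_funK f) (homeo_invK f)).
  - exact: bcanon_fun_circ.
  - exact/tame_circ.
  - by apply/tame_circ; exact: (tame_homeoV tf).
apply/tame_circ; apply: dyadic_map_bcanon dm => p q alpha beta /= im h.
have lp := len_gt0 R p; have lq := len_gt0 R q.
have img (s : R) : lo p <= s <= lo p + len p -> lo q <= alpha * s + beta <= lo q + len q.
  move=> hs; have : ((fun t => alpha * t + beta) @` `[lo p, lo p + len p]) (alpha * s + beta).
    by exists s => //=; rewrite in_itv.
  by rewrite im /= in_itv.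
rewrite ltNge; apply/negP; rewrite le_eqVlt => /orP[/eqP a0|a0].
  have pre s : lo q <= s <= lo q + len q -> s = beta.
    move=> hs; have : `[lo q, lo q + len q]%classic s by rewrite /= in_itv.
    by rewrite -im => -[t _ <-]; rewrite a0 mul0r add0r.
  have := pre (lo q); have := pre (lo q + len q); lra.
have ex (c : R) : 0 < c < 1 -> exists x y : unit_itv R,
    [/\ val x = lo p + len p * c, val y = alpha * (lo p + len p * c) + beta,
        (val x : R) < 1, (val y : R) < 1 & f (circle_pt x) = circle_pt y].
  move=> /andP[c0 c1]; have lc0 : 0 < len p * c by rewrite mulr_gt0.
  have lc1 : len p * c < len p by rewrite gtr_pMr.
  have hs : lo p <= lo p + len p * c <= lo p + len p by lra.
  have s01 : lo p + len p * c \in (`[0, 1]%classic : set R).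
    by rewrite inE /= in_itv /=; have := lo_ge0 R p; have := hi_le1 R p; lra.
  have t01 : alpha * (lo p + len p * c) + beta \in (`[0, 1]%classic : set R).
    have ht := img _ hs.
    by rewrite inE /= in_itv /=; have := lo_ge0 R q; have := hi_le1 R q; lra.
  exists (SigSub s01), (SigSub t01); split=> //.
  - by rewrite /=; have := hi_le1 R p; lra.
  - rewrite /=; have := img (lo p); have := hi_le1 R q.
    have : alpha * (len p * c) < 0 by rewrite nmulr_rlt0.
    by lra.
  by apply: h => //=; rewrite in_itv.
have [|x1 [y1 [ex1 ey1 lx1 ly1 f1]]] := ex (1 / 4); first exact: q1.
have [|x2 [y2 [ex2 ey2 lx2 ly2 f2]]] := ex (1 / 2); first exact: q2.
have [|x3 [y3 [ex3 ey3 lx3 ly3 f3]]] := ex (3 / 4); first exact: q3.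
have /cyc : counterclockwise (circle_pt x1) (circle_pt x2) (circle_pt x3).
  exists x1, x2, x3; split=> //; apply: Or31.
  by rewrite ex1 ex2 ex3 !ltrD2l !(ltr_pM2l lp) q12.
rewrite f1 f2 f3 => -[z1 [z2 [z3 [e1 e2 e3 [l1 [l2 l3]]]]]].
rewrite -(circle_pt_inj ly1 l1 e1) -(circle_pt_inj ly2 l2 e2) -(circle_pt_inj ly3 l3 e3).
have d12 : (val y2 : R) < val y1.
  by rewrite ey1 ey2 ltrD2r ltr_nM2l // ltrD2l (ltr_pM2l lp).
have d23 : (val y3 : R) < val y2.
  by rewrite ey2 ey3 ltrD2r ltr_nM2l // ltrD2l (ltr_pM2l lp).
by case=> /andP[u1 u2];
  [have := lt_trans u1 d12|have := lt_trans u1 d23|have := lt_trans u2 d12];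
  rewrite ltxx.
Qed.

End Groups.

(** * Gluing along red edges and along the central circle *)

Lemma glue_sapp p u v : glue u v -> glue (p +++ u) (p +++ v).
Proof.
case=> [->|[q [j [t [t' [jt jt' -> ->]]]]]]; first by left.
by right; exists (p ++ q), j, t, t'; rewrite !sapp_cat.
Qed.

Lemma glue_sym u v : glue u v -> glue v u.
Proof.
case=> [->|[q [j [t [t' [jt jt' -> ->]]]]]]; first by left.
by right; exists q, j, t', t.
Qed.

Lemma junction_first j t t' : at_junction j t -> at_junction j t' -> t 0 = t' 0 -> t = t'.
Proof.
move=> [a [s [ja ->]]] [b [s' [jb ->]]] /= ab; move: jb; rewrite -ab ja => -[->].
by [].
Qed.

Lemma glue_scons_inv a u v : glue (a ::: u) (a ::: v) -> glue u v.
Proof.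
case=> [/scons_inj [_ ->]|[[|b q] [j [t [t' [jt jt' eu ev]]]]]]; first by left.
  rewrite /= in eu ev; have e : t = t' by apply: junction_first jt jt' _; rewrite -eu -ev.
  by left; have [] : a = a /\ u = v by apply: scons_inj; rewrite eu ev.
move: eu ev => /= /scons_inj [_ ->] /scons_inj [_ ->].
by right; exists q, j, t, t'.
Qed.

Lemma glue_sapp_inv p u v : glue (p +++ u) (p +++ v) -> glue u v.
Proof. by elim: p => // a p IH /glue_scons_inv. Qed.

Lemma glue_scons_neq a b u v : a != b -> glue (a ::: u) (b ::: v) ->
  exists j s t, [/\ role j a = Some s, role j b = Some t,
    u = end_tail (lcol Blue a) s & v = end_tail (lcol Blue b) t].
Proof.
move=> ab [/scons_inj [e _]|]; first by rewrite e eqxx in ab.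
move=> [[|c q] [j [t [t' [jt jt' eu ev]]]]]; last first.
  move: eu ev => /= /scons_inj [e1 _] /scons_inj [e2 _].
  by rewrite e1 e2 eqxx in ab.
rewrite /= in eu ev; move: jt jt'; rewrite -eu -ev.
move=> [a' [s [ja /scons_inj[ea ->]]]] [b' [s' [jb /scons_inj[eb ->]]]].
by exists j, s, s'; rewrite ea eb.
Qed.

Lemma junction_glue j a b s t : role j a = Some s -> role j b = Some t ->
  glue (a ::: end_tail (lcol Blue a) s) (b ::: end_tail (lcol Blue b) t).
Proof. by move=> ja jb; right; exists [::], j; do 2 eexists; split; [exists a, s|exists b, t| |]. Qed.

(** ** Words along a red edge *)

Definition rl (b : bool) : letter := if b then r2 else r1.
Definition rw (w : nat -> bool) : nat -> letter := rl \o w.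

Lemma rl_inj : injective rl. Proof. by case=> -[]. Qed.

Lemma rw_inj : injective rw.
Proof. by move=> w v e; apply: funext => n; apply: rl_inj; have := congr1 (fun f => f n) e. Qed.

Lemma rw_scons b w : rw (b ::: w) = rl b ::: rw w.
Proof. by apply: funext => -[]. Qed.

Lemma rw_sapp z w : rw (z +++ w) = map rl z +++ rw w.
Proof. by elim: z => //= b z <-; rewrite rw_scons. Qed.

Lemma rw_cst b : rw (cst b) = end_tail Red (~~ b).
Proof. by case: b. Qed.

Lemma vs_rw c w : c = Red -> vs c (rw w).
Proof.
move=> -> n; elim: n w => // n IH w; rewrite (scons_eta w) rw_scons mkseq_scons /=.
by have := IH (sdrop 1 w); case: (w 0).
Qed.

Lemma vw_map_rl z : vw Red (map rl z).
Proof. by elim: z => // b z; case: b. Qed.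

Lemma ec_map_rl z : ec Red (map rl z) = Red.
Proof. by elim: z => // b z; case: b. Qed.

Lemma red_split u : vs Red u -> (exists w, u = rw w) \/
  (exists z u', u = map rl z +++ rs ::: u' /\ vs Blue u').
Proof.
move=> vu; have [[n hn]|h] := pselect (exists n, u n = rs); last first.
  left; exists (fun n => u n == r2); apply: funext => n; rewrite /rw /=.
  have {}h k : u k != rs by apply/eqP => e; apply: h; exists k.
  have okr k : okc (ec Red (mkseq u k)) (u k).
    by have := vu k.+1; rewrite mkseqS vword_rcons => /andP[].
  have red k : ec Red (mkseq u k) = Red.
    elim: k => // k IH; rewrite mkseqS endc_rcons.
    by have := okr k; rewrite IH; have := h k; case: (u k).
  by have := okr n; rewrite red; have := h n; case: (u n).
right; elim: n u vu hn => [|n IH] u; rewrite (scons_eta u) => /vstream_scons [ok vu] /=.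
  by move=> e; exists [::], (sdrop 1 u); rewrite e; move: vu; rewrite e.
move=> hn; have [e|[b eb]] : u 0 = rs \/ exists b, u 0 = rl b.
    by move: ok; case: (u 0) => // _; [right; exists false|right; exists true|left].
  by exists [::], (sdrop 1 u); rewrite e; move: vu; rewrite e.
have [|z [u' [e vu']]] := IH (sdrop 1 u) _ hn; first by move: vu; rewrite eb; case: b {eb}.
by exists (b :: z), u'; rewrite eb {1}e.
Qed.

Lemma rs_inj z z' u u' : map rl z +++ rs ::: u = map rl z' +++ rs ::: u' -> z = z' /\ u = u'.
Proof.
elim: z z' => [|b z IH] [|b' z'] /=.
- by move/scons_inj => [].
- by move/scons_inj => []; case: b'.
- by move/scons_inj => []; case: b.
- by move/scons_inj => [/rl_inj -> /IH [-> ->]].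
Qed.

(** Along a red edge the junctions are the midpoints of dyadic intervals. *)
Lemma glue_rw w v : glue (rw w) (rw v) -> w = v \/ twins w v.
Proof.
move=> g; have [|/first_difference] := pselect (w = v); first by left.
move=> [p [a [b [w' [v' [ab ew ev]]]]]]; right; exists p.
move: g; rewrite ew ev !rw_sapp !rw_scons => /glue_sapp_inv /glue_scons_neq [].
  by apply: contra ab => /eqP /rl_inj ->.
move=> j [s [t [ja jb]]].
have tl c r : role j (rl c) = Some r -> r = c by case: c; case: (j) => //= -[].
move: (tl _ _ ja) (tl _ _ jb) => -> ->.
have cc c x : rw x = end_tail (lcol Blue (rl c)) c -> x = cst (~~ c).
  by case: c => e; apply: rw_inj; rewrite e rw_cst.
move=> /cc -> /cc ->.
by case: a b ab {ew ev ja jb} => -[] // _; [right|left].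
Qed.

Lemma twins_glue_rw w v : twins w v -> glue (rw w) (rw v).
Proof.
move=> [p [[-> ->]|[-> ->]]]; rewrite !rw_sapp !rw_scons !rw_cst; apply: glue_sapp.
  exact: (@junction_glue Jm r1 r2 false true).
exact: (@junction_glue Jm r2 r1 true false).
Qed.

(** The address of the source of a blue cell, by which a primary cell is attached. *)
Definition bt : nat -> letter := end_tail Blue true.

Lemma vs_bt : vs Blue bt. Proof. exact: vs_end_tail. Qed.

Lemma glue_rw_rs w z u : glue (rw w) (map rl z +++ rs ::: u) ->
  u = bt /\ (w = z +++ false ::: cst true \/ w = z +++ true ::: cst false).
Proof.
elim: z w => [|b z IH] w; rewrite (scons_eta w) rw_scons /=.
  move=> /glue_scons_neq [|j [s [t [ja jb ew ->]]]]; first by case: (w 0).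
  have [ej et] : j = Jm /\ t = true by case: j {ja ew} jb => //= -[].
  split; first by rewrite et.
  have cc c x : rw x = end_tail (lcol Blue (rl c)) c -> x = cst (~~ c).
    by case: c => e; apply: rw_inj; rewrite e rw_cst.
  move: ja ew; rewrite ej; case: (w 0) => /= -[<-].
    by move/(cc true) => ->; right.
  by move/(cc false) => ->; left.
have [->|nb] := eqVneq (w 0) b.
  by move=> /glue_scons_inv /IH [-> [->|->]]; split=> //; [left|right].
move=> /glue_scons_neq [|j [s [t [ja jb _]]]].
  by apply: contra nb => /eqP /rl_inj ->.
move=> e; exfalso; have h k : (map rl z +++ rs ::: u) (size z) = rs -> end_tail Red k (size z) != rs.
  by case: k.
have hs : (map rl z +++ rs ::: u) (size z) = rs by rewrite sappE size_map ltnn subnn.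
have := h t hs; move: e; have -> : lcol Blue (rl b) = Red by case: b {nb jb}.
by move=> <-; rewrite hs eqxx.
Qed.

Lemma glue_rs z z' u u' : glue (map rl z +++ rs ::: u) (map rl z' +++ rs ::: u') ->
  z = z' /\ glue u u'.
Proof.
have bad y v b k : map rl y +++ rs ::: v <> end_tail (lcol Blue (rl b)) k.
  move=> /(congr1 (fun f => f (size y))).
  by rewrite sappE size_map ltnn subnn /=; case: b; case: k.
elim: z z' => [|b z IH] [|b' z'] /=.
- by move=> /glue_scons_inv.
- by move=> /glue_scons_neq [|j [s [t [_ _ _ /bad]]]]; first by case: b'.
- by move=> /glue_scons_neq [|j [s [t [_ _ /bad]]]]; first by case: b.
have [->|nb] := eqVneq b b'; first by move=> /glue_scons_inv /IH [-> ?].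
move=> /glue_scons_neq [|j [s [t [_ _ /bad]]]] //.
by apply: contra nb => /eqP /rl_inj ->.
Qed.

Lemma rs_glue z b : glue (map rl z +++ rs ::: bt) (rw (z +++ b ::: cst (~~ b))).
Proof.
rewrite rw_sapp rw_scons rw_cst negbK; apply: glue_sapp.
by case: b; [exact: (@junction_glue Jm rs r2 true true)|exact: (@junction_glue Jm rs r1 true false)].
Qed.

(** ** The central circle *)

(** Addresses on the central circle, run through from [a]: along [e_D] to [b], then
    along [e_U] back to [a]. *)
Definition cl (b : bool) : letter := if b then bu else bd.
Definition cw (w : nat -> bool) : nat -> letter := cl (w 0) ::: rw (sdrop 1 w).
Definition cww (z : seq bool) : word := if z is b :: z' then cl b :: map rl z' else [::].

Lemma cl_inj : injective cl. Proof. by case=> -[]. Qed.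

Lemma cw_scons b w : cw (b ::: w) = cl b ::: rw w.
Proof. by congr (_ ::: _); apply: funext. Qed.

Lemma cw_sapp b z w : cw ((b :: z) +++ w) = cww (b :: z) +++ rw w.
Proof. by rewrite [_ +++ _]/= cw_scons rw_sapp. Qed.

Lemma vs_cw w : vs Blue (cw w).
Proof. by apply/vstream_scons; split; [case: (w 0)|apply: vs_rw; case: (w 0)]. Qed.

(** Equality of points of the circle, in terms of binary expansions. *)
Definition ceq (w v : nat -> bool) := w = v \/ twins w v \/
  (w = cst false /\ v = cst true) \/ (w = cst true /\ v = cst false).

Lemma twins_cons b w v : twins w v -> twins (b ::: w) (b ::: v).
Proof. by move=> [p [[-> ->]|[-> ->]]]; exists (b :: p); [left|right]. Qed.

Lemma glue_cw w v : glue (cw w) (cw v) <-> ceq w v.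
Proof.
rewrite (scons_eta w) (scons_eta v); move: (w 0) (v 0) (sdrop 1 w) (sdrop 1 v).
move=> b c {}w {}v; rewrite !cw_scons; split.
  have [->|bc] := eqVneq b c.
    by move=> /glue_scons_inv /glue_rw [->|/twins_cons h]; [left|right; left].
  move=> /glue_scons_neq [|j [s [t [jb jc]]]].
    by apply: contra bc => /eqP /cl_inj ->.
  have cc d k x : rw x = end_tail (lcol Blue (cl d)) k -> x = cst (~~ k).
    by case: d => e; apply: rw_inj; rewrite e rw_cst negbK.
  move=> /cc -> /cc ->; case: b c bc jb jc => -[] // _; case: j => //= -[<-] [<-].
  - by right; right; right; split; rewrite [RHS]cstE.
  - by right; left; exists [::]; right.
  - by right; right; left; split; rewrite [RHS]cstE.
  - by right; left; exists [::]; left.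
case=> [/scons_inj [-> ->]|[[[|d p] H]|H]]; first by left.
- case: H => -[/= /scons_inj [-> ->] /scons_inj [-> ->]]; rewrite !rw_cst.
    exact: (@junction_glue Jy bd bu false true).
  exact: (@junction_glue Jy bu bd true false).
- have -> : b = d by case: H => -[/= /scons_inj [? _] /scons_inj [? _]].
  have -> : c = d by case: H => -[/= /scons_inj [_ _] /scons_inj [? _]] //; case: H => -[/= /scons_inj [? _] _].
  apply: (@glue_sapp [:: cl d]); apply: twins_glue_rw; exists p.
  by case: H => -[/= /scons_inj [_ ->] /scons_inj [_ ->]]; [left|right].
- case: H => -[]; rewrite (cstE false) (cstE true) => /scons_inj [-> ->] /scons_inj [-> ->]; rewrite !rw_cst.
    exact: (@junction_glue Jx bd bu true false).
  exact: (@junction_glue Jx bu bd false true).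
Qed.

(** The maximal blue cells, named by the dyadic point of the circle where they
    are attached: [None] is [0] and [Some z] is the midpoint of the arc [z]. *)
Definition prim (i : option (seq bool)) : word :=
  match i with
  | None => [:: b_minus]
  | Some [::] => [:: b_plus]
  | Some z => rcons (cww z) rs
  end.

Definition vtx (i : option (seq bool)) : nat -> bool :=
  if i is Some z then z +++ true ::: cst false else cst false.

Lemma vw_prim i : vw Blue (prim i).
Proof.
case: i => [[|b z]|] //; rewrite /prim vword_rcons /=.
by case: b => /=; rewrite vw_map_rl ec_map_rl.
Qed.

Lemma ec_prim i : ec Blue (prim i) = Blue.
Proof. by case: i => [[|b z]|] //; rewrite /prim endc_rcons. Qed.

Lemma prim_cons b z u : prim (Some (b :: z)) +++ u = cl b ::: map rl z +++ rs ::: u.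
Proof. by rewrite /prim sapp_rcons. Qed.

Lemma vs_prim i u : vs Blue (prim i +++ u) <-> vs Blue u.
Proof. by rewrite vstream_sapp ec_prim vw_prim; split=> [[]|]. Qed.

Lemma circle_split u : vs Blue u -> (exists w, u = cw w) \/
  (exists i u', u = prim i +++ u' /\ vs Blue u').
Proof.
rewrite (scons_eta u) => /vstream_scons [ok vu].
have red b : u 0 = cl b -> (exists w, u 0 ::: sdrop 1 u = cw w) \/
  (exists i u', u 0 ::: sdrop 1 u = prim i +++ u' /\ vs Blue u').
  move=> e; move: vu; rewrite e; have -> : lcol Blue (cl b) = Red by case: b {e}.
  move=> /red_split [[w ->]|[z [u' [-> vu']]]].
    by left; exists (b ::: w); rewrite cw_scons.
  by right; exists (Some (b :: z)), u'; rewrite prim_cons.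
move: ok vu red; case E : (u 0) => // _ vu red.
- by right; exists None, (sdrop 1 u).
- by right; exists (Some [::]), (sdrop 1 u).
- exact: (red true).
- exact: (red false).
Qed.

Lemma prim_inj i j u v : prim i +++ u = prim j +++ v -> i = j /\ u = v.
Proof.
case: i j => [[|b z]|] [[|c y]|]; rewrite ?prim_cons /= => /scons_inj [] //.
- by case: c.
- by case: b.
- by move=> /cl_inj -> /rs_inj [-> ->].
- by case: b.
- by case: c.
Qed.

Lemma prim_vtx i : glue (prim i +++ bt) (cw (vtx i)).
Proof.
case: i => [[|b z]|]; rewrite /vtx.
- rewrite /= cw_scons rw_cst; exact: (@junction_glue Jy b_plus bu true true).
- rewrite prim_cons cw_sapp; apply: (@glue_sapp [:: cl b]).
  by have := rs_glue z true; rewrite rw_sapp.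
- rewrite cstE cw_scons rw_cst; exact: (@junction_glue Jx b_minus bd true true).
Qed.

(** The junction at which a primary cell is attached is its only contact with the
    circle. *)
Lemma glue_cw_prim w i u : glue (cw w) (prim i +++ u) -> u = bt /\ ceq w (vtx i).
Proof.
rewrite (scons_eta w); move: (w 0) (sdrop 1 w) => b {}w; rewrite cw_scons.
have cc d k x : rw x = end_tail (lcol Blue (cl d)) k -> x = cst (~~ k).
  by case: d => e; apply: rw_inj; rewrite e rw_cst negbK.
case: i => [[|c z]|]; rewrite /vtx ?prim_cons.
- move=> /glue_scons_neq [|j [s [t [jb jc /cc -> ->]]]]; first by case: b.
  have [ej et] : j = Jy /\ t = true by case: j {jb} jc => //= -[].
  rewrite et; split=> //; move: jb; rewrite ej; case: b => /= -[<-]; first by left.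
  by right; left; exists [::]; left.
- have [->|bc] := eqVneq b c.
    move=> /glue_scons_inv /glue_rw_rs [-> [->|->]]; split=> //; last by left.
    by right; left; exists (c :: z); left.
  move=> /glue_scons_neq [|j [s [t [_ _ _ e]]]].
    by apply: contra bc => /eqP /cl_inj ->.
  exfalso; have := congr1 (fun f => f (size z)) e.
  by rewrite sappE size_map ltnn subnn /=; case: c {bc e}; case: t.
- move=> /glue_scons_neq [|j [s [t [jb jc /cc -> ->]]]]; first by case: b.
  have [ej et] : j = Jx /\ t = true by case: j {jb} jc => //= -[].
  rewrite et; split=> //; move: jb; rewrite ej; case: b => /= -[<-].
    by right; right; right; split=> //; rewrite [RHS]cstE.
  by left; rewrite [RHS]cstE.
Qed.

Lemma glue_prim i j u v : glue (prim i +++ u) (prim j +++ v) -> i = j /\ glue u v.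
Proof.
have rsE z (x : nat -> letter) c k : map rl z +++ rs ::: x <> end_tail (lcol Blue (cl c)) k.
  move=> /(congr1 (fun f => f (size z))).
  by rewrite sappE size_map ltnn subnn /=; case: c; case: k.
case: i j => [[|b z]|] [[|c y]|]; rewrite ?prim_cons.
- by move/glue_scons_inv.
- by move/glue_scons_neq => [|k [s [t [_ _ _ /rsE]]]]; first by case: c.
- by move/glue_scons_neq => [|k [s [t []]]] //; case: k.
- by move/glue_scons_neq => [|k [s [t [_ _ /rsE]]]]; first by case: b.
- have [->|bc] := eqVneq b c; first by move/glue_scons_inv/glue_rs => [->].
  move/glue_scons_neq => [|k [s [t [_ _ /rsE]]]] //.
  by apply: contra bc => /eqP /cl_inj ->.
- by move/glue_scons_neq => [|k [s [t [_ _ /rsE]]]]; first by case: b.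
- by move/glue_scons_neq => [|k [s [t []]]] //; case: k.
- by move/glue_scons_neq => [|k [s [t [_ _ _ /rsE]]]]; first by case: c.
- by move/glue_scons_inv.
Qed.

(** * The rigid stabilizer of the central component *)

Notation acanon := (canon (S := air)).

Lemma acanonP (f : Airplane -> Airplane) p q : acanon f p q <->
  [/\ vw Blue q, ec Blue p = ec Blue q &
      forall u, vs (ec Blue p) u -> f (P (p +++ u)) = P (q +++ u)].
Proof. by []. Qed.

(** Both isomorphisms are obtained as relations between the two groups. *)
Lemma isomorphic_rel (G G' : groupType) (H : set G) (K : set G') (T : G -> G' -> Prop) :
  subgroup K ->
  (forall x, H x -> exists2 y, K y & T x y) ->
  (forall y, K y -> exists2 x, H x & T x y) ->
  (forall x y y', T x y -> T x y' -> y = y') ->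
  (forall x x' y, K y -> T x y -> T x' y -> x = x') ->
  (forall x x' y y', K y -> K y' -> T x y -> T x' y' -> T (x * x')%g (y * y')%g) ->
  (forall x y, K y -> T x y -> T x^-1%g y^-1%g) -> isomorphic H K.
Proof.
move=> sK HK KH funK funH TM TV.
have KV y : K y -> K y^-1%g.
  by move=> Ky; have := group_closedV sK (mem_set Ky); rewrite inE.
have KM y y' : K y -> K y' -> K (y * y')%g.
  by move=> Ky Ky'; have := group_closedM sK (mem_set Ky) (mem_set Ky'); rewrite inE.
have K1 : K 1%g by case: sK; rewrite inE.
have HT x y : K y -> T x y -> H x.
  by move=> Ky Txy; have [x' Hx' Tx'y] := KH _ Ky; rewrite (funH _ _ _ Ky Txy Tx'y).
have T1 : T 1%g 1%g.
  have [x _ Tx] := KH _ K1.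
  by have := TM _ _ _ _ K1 (KV _ K1) Tx (TV _ _ K1 Tx); rewrite !mulgV.
have sH : subgroup H.
  split=> [|x x']; rewrite !inE; first exact: HT T1.
  move=> /HK [y Ky Ty] /HK [y' Ky' Ty'].
  exact: HT (KM _ _ Ky (KV _ Ky')) (TM _ _ _ _ Ky (KV _ Ky') Ty (TV _ _ Ky' Ty')).
have /choice [phi hphi] x : exists y, H x -> K y /\ T x y.
  by have [/HK [y Ky Ty]|nH] := pselect (H x); [exists y|exists 1%g].
split=> //; exists phi; last first.
  move=> x x'; rewrite !inE => Hx Hx'; have [Ky Ty] := hphi _ Hx; have [Ky' Ty'] := hphi _ Hx'.
  have Txy := TM _ _ _ _ Ky Ky' Ty Ty'.
  have [_ Tz] := hphi _ (HT _ _ (KM _ _ Ky Ky') Txy).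
  exact: funK Tz Txy.
split=> [x /hphi [] //|x x'|y Ky].
  rewrite !inE => /hphi [Ky Ty] /hphi [_ Ty'] e; apply: funH Ky Ty _.
  by rewrite e.
have [x Hx Tx] := KH _ Ky; exists x => //.
by have [_ Ty] := hphi _ Hx; exact: funK Ty Tx.
Qed.

Lemma P_cong u v : vs Blue u -> vs Blue v -> glue u v -> P u = P v.
Proof. by move=> vu vv; move/P_glue; apply. Qed.

Lemma boundary_central x : boundary Central x <-> exists w, x = P (cw w).
Proof.
split=> [[w [c [u [-> cc ew hu]]]]|[w ->]].
  have [b ec'] : exists b, c = renw [:: cl b].
    by move: cc; rewrite !inE => /orP[] /eqP ->; [exists true|exists false].
  have er : u = rw (fun n => u n == r2).
    by apply: funext => n; rewrite /rw /rl /=; have := hu n; rewrite !inE => /orP[] /eqP ->.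
  exists (b ::: (fun n => u n == r2)).
  by rewrite ptE ew prependE ec' -rens_prepend // rensK cw_scons -er.
have [w' ew ->] := P_pt (vs_cw w).
exists w', (renw [:: cl (w 0)]), (rw (sdrop 1 w)); split=> //.
- by case: (w 0).
- by rewrite ew prependE -rens_prepend.
by move=> n; rewrite /rw /=; case: (sdrop 1 w n).
Qed.

Lemma red_word_split p : vw Red p -> (exists z, p = map rl z) \/
  (exists z r, p = map rl z ++ rs :: r).
Proof.
elim: p => [|a p IH] /=; first by left; exists [::].
case: a => // /andP[_ vp]; last by right; exists [::], p.
  by case: (IH vp) => [[z ->]|[z [r ->]]]; [left; exists (false :: z)|right; exists (false :: z), r].
by case: (IH vp) => [[z ->]|[z [r ->]]]; [left; exists (true :: z)|right; exists (true :: z), r].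
Qed.

Lemma word_circle_split p : vw Blue p -> p != [::] ->
  (exists b z, p = cww (b :: z)) \/ (exists i r, p = prim i ++ r).
Proof.
case: p => // a p /andP[oka vp] _.
have red b : a = cl b -> (exists b z, a :: p = cww (b :: z)) \/ (exists i r, a :: p = prim i ++ r).
  move=> e; move: vp; rewrite e; have -> : lcol Blue (cl b) = Red by case: b {e}.
  case/red_word_split => [[z ->]|[z [r ->]]]; first by left; exists b, z.
  by right; exists (Some (b :: z)), r; rewrite cat_rcons.
move: oka red; case: a vp => // vp _ red.
- by right; exists None, p.
- by right; exists (Some [::]), p.
- exact: (red true).
- exact: (red false).
Qed.

Lemma vw_cww z : vw Blue (cww z).
Proof. by case: z => //= b z; case: b => /=; rewrite vw_map_rl. Qed.

Lemma ec_cww b z : ec Blue (cww (b :: z)) = Red.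
Proof. by rewrite /=; case: b => /=; exact: ec_map_rl. Qed.

Lemma blue_prim p : vw Blue p -> ec Blue p = Blue -> p != [::] -> exists i r, p = prim i ++ r.
Proof.
move=> vp ep pn; case: (word_circle_split vp pn) => [[b [z e]]|//].
by move: ep; rewrite e ec_cww.
Qed.

(** Words eventually equal to [b_plus] are the blue addresses of vertices; a
    vertex has at most one. *)
Definition plus_tail (u : nat -> letter) := exists p, u = p +++ cst b_plus.

Lemma plus_tail_sapp p u : plus_tail u -> plus_tail (p +++ u).
Proof. by move=> [q ->]; exists (p ++ q); rewrite sapp_cat. Qed.

Lemma sapp_plus_tail p u : plus_tail (p +++ u) -> plus_tail u.
Proof.
move=> [q]; have [pq|/ltnW qp] := leqP (size p) (size q).
  by move/sapp_prefix => /(_ pq) [r _ ->]; exists r.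
move/esym/sapp_prefix => /(_ qp) [r _]; move=> e; exists [::].
elim: r e => [|a r IH] //=; rewrite {1}cstE => /scons_inj [_ /IH].
by [].
Qed.

Lemma plus_tail_end_tail c s : plus_tail (end_tail c s) -> c = Blue.
Proof.
have bad a : a != b_plus -> ~ plus_tail (cst a).
  move=> ab [p] /(congr1 (fun f => f (size p))).
  by rewrite sappE ltnn subnn => /eqP; rewrite (negPf ab).
by case: c s => -[] // h; exfalso; [exact: (@bad r1 isT h)|exact: (@bad r2 isT h)].
Qed.

Lemma plus_tail_eq u v : plus_tail u -> plus_tail v -> glue u v -> u = v.
Proof.
move=> pu pv [//|[p [j [t [t' [jt jt' eu ev]]]]]]; move: pu pv; rewrite eu ev.
move=> /sapp_plus_tail + /sapp_plus_tail; move: jt jt' => [a [s [ja ->]]] [b [s' [jb ->]]].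
move=> /(@sapp_plus_tail [:: a]) /plus_tail_end_tail la /(@sapp_plus_tail [:: b]) /plus_tail_end_tail lb.
suff ab : a = b by move: jb; rewrite -ab ja => -[->].
by case: j ja jb; case: a la => //; case: b lb.
Qed.

Lemma plus_tail_bt : plus_tail bt.
Proof. by exists [:: b_minus]. Qed.

Lemma sapp_bt r : r +++ bt = bt -> r = [::].
Proof.
case: r => // a r /(congr1 (fun f => f (size r).+1)).
by rewrite sappE ltnn subnn.
Qed.

Lemma primary_blueP e : primary_blue e <-> exists i, e = edge_of (prim i).
Proof.
have pn i : prim i != [::] by case: i => [[|b z]|].
have inc p r : vw Blue (p ++ r) -> p != [::] -> cell (edge_of (p ++ r)) `<=` cell (edge_of p).
  move=> vpr pn' x; have := vpr; rewrite vword_cat => /andP[vp vr].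
  have npr : p ++ r != [::] by case: (p) pn'.
  move=> /(cellP _ vpr npr) [u vu ->].
  apply/cellP => //; exists (r +++ u); rewrite ?sapp_cat //.
  by apply/vstream_sapp; rewrite -endc_cat.
have cnt p q : vw Blue p -> vw Blue q -> p != [::] -> q != [::] ->
    cell (edge_of p) `<=` cell (edge_of q) -> exists r, p = q ++ r.
  move=> vp vq pn' qn h; apply: (@cell_prefix air) => // u vu.
  have /(cellP _ vq qn) [v vv e'] : cell (edge_of q) (P (p +++ u)).
    by apply: h; apply/cellP => //; exists u.
  by exists v.
split.
  move=> [/is_edgeP [p [vp pn' ->]] cp max]; rewrite edge_of_col // in cp.
  have [i [r e']] := blue_prim vp cp pn'; exists i.
  have H : is_edge (edge_of (prim i)) by apply/is_edgeP; exists (prim i); rewrite vw_prim.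
  have := max _ H; rewrite edge_of_col ?vw_prim ?ec_prim //.
  have vpr : vw Blue (prim i ++ r) by rewrite -e'.
  rewrite {1}e' => /(_ erefl (inc _ _ vpr (pn i))) ecell.
  have [|r'] := cnt _ _ (vw_prim i) vp (pn i) pn'; first by rewrite ecell.
  by move=> e2; congr edge_of; move: e2; rewrite e' -catA => /(congr1 size); rewrite !size_cat
    => /eqP; rewrite -[X in X == _]addn0 eqn_add2l eq_sym addn_eq0 => /andP[/nilP -> _]; rewrite cats0.
move=> [i ->]; split; first by apply/is_edgeP; exists (prim i); rewrite vw_prim.
  by rewrite edge_of_col ?vw_prim ?ec_prim.
move=> e' /is_edgeP [q [vq qn ->]]; rewrite edge_of_col // => cq h.
have [r er] := cnt _ _ (vw_prim i) vq (pn i) qn h.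
have [j [r' er']] := blue_prim vq cq qn.
have : prim i +++ bt = prim j +++ (r' ++ r) +++ bt by rewrite er er' !sapp_cat.
move=> /prim_inj [ij] /esym /sapp_bt /(congr1 size)/eqP.
by rewrite size_cat addn_eq0 => /andP[/nilP e1 _]; rewrite er' e1 cats0 ij.
Qed.

Section RistC0.
Variable R : realType.
Local Notation Qc := (@Qc R).
Local Notation circ := (circ R).
Implicit Types (f : homeo Airplane) (g : homeo (circle R)).

Lemma P_cw w v : P (cw w) = P (cw v) <-> Qc w = Qc v.
Proof. by rewrite P_glue; [rewrite glue_cw Qc_eq|exact: vs_cw|exact: vs_cw]. Qed.

Lemma P_prim_bt i : P (prim i +++ bt) = P (cw (vtx i)).
Proof.
apply: P_cong; [exact/vs_prim/vs_bt|exact: vs_cw|exact: prim_vtx].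
Qed.

(** [f] acts on the central circle as [g], and moves the maximal blue cells
    canonically, following the points to which they are attached. *)
Definition tiedC f g :=
  (forall w w', g (Qc w) = Qc w' -> f (P (cw w)) = P (cw w')) /\
  (forall i j, g (Qc (vtx i)) = Qc (vtx j) -> forall u, vs Blue u ->
     f (P (prim i +++ u)) = P (prim j +++ u)).

Lemma vtx_of q : exists j, q +++ cst false = vtx j.
Proof.
elim/last_ind: q => [|q [] [j ej]]; first by exists None.
  by exists (Some q); rewrite sapp_rcons.
by exists j; rewrite sapp_rcons -cstE.
Qed.

Lemma vtx_pad i n : exists2 p, size p = n & exists m, vtx i = (p ++ m) +++ cst false.
Proof.
have [z ->] : exists z, vtx i = z +++ cst false.
  by case: i => [z|]; [exists (rcons z true); rewrite sapp_rcons|exists [::]].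
have e : z +++ cst false = (z ++ nseq n false) +++ cst false by rewrite sapp_cat sapp_nseq_cst.
exists (take n (z ++ nseq n false)); first by rewrite size_takel // size_cat size_nseq leq_addl.
by exists (drop n (z ++ nseq n false)); rewrite cat_take_drop.
Qed.

Lemma Qc_repr x : exists w, x = Qc w.
Proof. by have [w _ <-] := Qc_surj x; exists w. Qed.

(** Replacing prefixes preserves the expansions ending in zeros. *)
Lemma tame_vertex g i : tame (S := circ) g -> exists j, g (Qc (vtx i)) = Qc (vtx j).
Proof.
move=> /tame_circ [n h]; have [p sp [m ->]] := vtx_pad i n.
have [q /(_ (m +++ cst false)) c] := h p sp.
by have [j ej] := vtx_of (q ++ m); exists j; rewrite -ej !sapp_cat.
Qed.

Lemma tiedC_comp f f' g g' : tame (S := circ) g' ->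
  tiedC f g -> tiedC f' g' -> tiedC (f * f')%g (g * g')%g.
Proof.
move=> tg' [a b] [a' b']; split=> [w w'|i j] /= h.
  have [v ev] := Qc_repr (g' (Qc w)).
  by rewrite (a' w v ev); apply: a; rewrite -ev.
move=> u vu; have [k ek] := tame_vertex i tg'.
by rewrite (b' _ _ ek u vu); apply: b => //; rewrite -ek.
Qed.

Lemma tiedC_inv f g : tiedC f g -> tiedC f^-1%g g^-1%g.
Proof.
move=> [a b]; split=> [w w'|i j] /= h.
  apply: (can_inj (homeo_funK f)); rewrite /= homeo_invK; apply/esym/a.
  by rewrite -h homeo_invK.
move=> u vu; apply: (can_inj (homeo_funK f)); rewrite /= homeo_invK; apply/esym/b => //.
by rewrite -h homeo_invK.
Qed.

Lemma tiedC_fun f g g' : tiedC f g -> tiedC f g' -> g = g'.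
Proof.
move=> [a _] [a' _]; apply: homeoP => x; have [w ->] := Qc_repr x.
have [v ev] := Qc_repr (g (Qc w)); have [v' ev'] := Qc_repr (g' (Qc w)).
by rewrite ev ev'; apply/P_cw; rewrite -(a _ _ ev) -(a' _ _ ev').
Qed.

Lemma tiedC_inj f f' g : tame (S := circ) g -> tiedC f g -> tiedC f' g -> f = f'.
Proof.
move=> tg [a b] [a' b']; apply: homeoP => x; have [u vu <-] := P_surj x.
have [[w ->]|[i [u' [-> vu']]]] := circle_split vu.
  by have [v ev] := Qc_repr (g (Qc w)); rewrite (a _ _ ev) (a' _ _ ev).
by have [j ej] := tame_vertex i tg; rewrite (b _ _ ej) // (b' _ _ ej).
Qed.

Lemma cw_prefix q x w : q != [::] -> cw w = q +++ x -> exists b z, q = cww (b :: z).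
Proof.
case: q => // a q _; rewrite (scons_eta w) cw_scons /= => /scons_inj [<-] e.
exists (w 0), (mkseq (sdrop 1 w) (size q)); rewrite /cww; congr (_ :: _).
have := congr1 (fun t => mkseq t (size q)) e; rewrite mkseq_sapp_size => {1}<-.
by rewrite /mkseq -map_comp.
Qed.

(** Preserving the central circle is enough to act on it as an element of [T]. *)
Lemma circle_action f : TA f ->
  (forall w, exists w', f (P (cw w)) = P (cw w')) ->
  (forall w', exists w, f (P (cw w)) = P (cw w')) ->
  exists2 g : homeo (circle R), tame (S := circ) g &
    forall w w', g (Qc w) = Qc w' -> f (P (cw w)) = P (cw w').
Proof.
move=> /TA_tame /tame_nonempty [n h] hf hf'.
pose rel y y' := exists w w', [/\ y = Qc w, y' = Qc w' & f (P (cw w)) = P (cw w')].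
have [|||||g tg hg] := @rel_homeo circ rel.
- by move=> x; have [w ->] := Qc_repr x; have [w' e] := hf w; exists (Qc w'), w, w'.
- by move=> y; have [w ->] := Qc_repr y; have [w' e] := hf' w; exists (Qc w'), w', w.
- move=> x y y' [w [w1 [-> -> e1]]] [v [w2 [/P_cw ev -> e2]]].
  by apply/P_cw; rewrite -e1 -e2 ev.
- move=> x x' y [w [w1 [-> -> e1]]] [v [w2 [-> /P_cw ev e2]]].
  by apply/P_cw/(can_inj (homeo_funK f)); rewrite /= in e1 e2 *; rewrite e1 e2.
- exists n.+1 => p _ sp; case: p sp => // b z [sz].
  have [|_ [q qn c]] := h (cww (b :: z)) (vw_cww _); first by rewrite /= size_map sz.
  move: c => /acanonP; rewrite ec_cww => -[vq ecq hq].
  have [w' ew'] := hf ((b :: z) +++ gbit); rewrite cw_sapp in ew'.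
  have e : cw w' = q +++ rw gbit.
    apply: P_generic; last by rewrite -ew' -hq //; exact: vs_rw.
    - by apply/vstream_sapp; split=> //; rewrite -ecq; exact: vs_rw.
    - exact: vs_cw.
    - apply: generic_sapp => a; rewrite !inE => ha m.
      have [k mk gk] := @gbit_hits [::] (a != r2) m; exists k => //.
      by move: gk; rewrite /rw /= => ->; case/or3P: ha => /eqP ->.
  have [c' [z' eq]] := cw_prefix qn e.
  exists (c' :: z'); split; [exact: vwb|exact: unit_eq|move=> u _].
  exists ((b :: z) +++ u), ((c' :: z') +++ u); split=> //.
  by rewrite !cw_sapp -eq; apply: hq; exact: vs_rw.
exists g => // w w' e; have [v [v' [/P_cw ev ev' h']]] := hg (Qc w).
by rewrite ev h'; apply/P_cw; rewrite -ev' e.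
Qed.

(** The image of a primary cell is the primary cell attached at the image of its
    attaching point, since a vertex has at most one blue address. *)
Lemma rist_C0_tied f : rist_C0 f -> exists2 g : homeo (circle R), tame (S := circ) g & tiedC f g.
Proof.
move=> [Tf bf pf].
have [||g tg hg] := circle_action Tf.
- move=> w; have : boundary Central (f (P (cw w))).
    by rewrite -bf; exists (P (cw w)) => //; apply/boundary_central; exists w.
  by move/boundary_central.
- move=> w'; have : boundary Central (P (cw w')) by apply/boundary_central; exists w'.
  by rewrite -bf => -[_ /boundary_central [w ->]] e; exists w.
exists g => //; split=> // i j e u vu.
have pn k : prim k != [::] by case: k => [[|b z]|].
have : primary_blue (edge_of (prim i)) by apply/primary_blueP; exists i.
move=> /pf /(extends_canon _ (vw_prim i) (pn i)) [q qn /acanonP].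
rewrite ec_prim => -[vq ecq hq].
have [k [r er]] := blue_prim vq (esym ecq) qn.
have vqb : vs Blue (q +++ bt) by apply/vstream_sapp; rewrite -ecq; split=> //; exact: vs_bt.
have : P (q +++ bt) = P (prim j +++ bt).
  have e' := hg _ _ e; rewrite P_prim_bt -e' -P_prim_bt; apply/esym/hq; exact: vs_bt.
move/P_glue => /(_ vqb ((vs_prim _ _).2 vs_bt)); rewrite er sapp_cat => /glue_prim [kj].
move/plus_tail_eq => /(_ (plus_tail_sapp _ plus_tail_bt) plus_tail_bt) /sapp_bt r0.
by have := hq u vu; rewrite er r0 cats0 kj.
Qed.

(** The relation that extends [g] to the primary cells is functional because [g]
    permutes the dyadic points, where these cells are attached. *)
Lemma tied_rist_C0 g : tame (S := circ) g -> exists2 f : homeo Airplane, rist_C0 f & tiedC f g.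
Proof.
pose rel (h : homeo (circle R)) x x' :=
  (exists w w', [/\ x = P (cw w), x' = P (cw w') & h (Qc w) = Qc w']) \/
  (exists i j u, [/\ vs Blue u, x = P (prim i +++ u), x' = P (prim j +++ u) &
     h (Qc (vtx i)) = Qc (vtx j)]).
have tot (h : homeo (circle R)) x : tame (S := circ) h -> exists x', rel h x x'.
  move=> th; have [u vu <-] := P_surj x.
  have [[w ->]|[i [u' [-> vu']]]] := circle_split vu.
    by have [v ev] := Qc_repr (h (Qc w)); exists (P (cw v)); left; exists w, v.
  have [j ej] := tame_vertex i th; exists (P (prim j +++ u')).
  by right; exists i, j, u'.
have inv h x x' : rel h x x' -> rel h^-1%g x' x.
  case=> [[w [w' [-> -> e]]]|[i [j [u [vu -> -> e]]]]].
    by left; exists w', w; split=> //; rewrite -e /= homeo_funK.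
  by right; exists j, i, u; split=> //; rewrite -e /= homeo_funK.
have mix h w w' i j u : vs Blue u -> P (cw w) = P (prim i +++ u) -> h (Qc w) = Qc w' ->
    h (Qc (vtx i)) = Qc (vtx j) -> P (cw w') = P (prim j +++ u).
  move=> vu /P_glue-/(_ (vs_cw _) ((vs_prim _ _).2 vu)) /glue_cw_prim [-> cwi] e1 e2.
  rewrite P_prim_bt; apply/P_cw; rewrite -e1 -e2; congr (h _).
  exact/Qc_eq.
have fn h x y y' : rel h x y -> rel h x y' -> y = y'.
  case=> [[w [w' [-> -> e]]]|[i [j [u [vu -> -> e]]]]];
    case=> [[v [v' [ev -> e']]]|[k [l [u' [vu' ek -> e']]]]].
  - by apply/P_cw; rewrite -e -e'; congr (h _); apply/P_cw.
  - exact: mix vu' ek e e'.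
  - by apply/esym; apply: mix vu (esym ev) e' e.
  have [ik g'] : i = k /\ glue u u'.
    by move: ek => /P_glue-/(_ ((vs_prim _ _).2 vu) ((vs_prim _ _).2 vu')) /glue_prim.
  have -> : j = l.
    have : P (prim j +++ bt) = P (prim l +++ bt).
      by rewrite !P_prim_bt; apply/P_cw; rewrite -e -e' ik.
    by move/P_glue => /(_ ((vs_prim _ _).2 vs_bt) ((vs_prim _ _).2 vs_bt)) /glue_prim [].
  by apply: P_cong; [exact/vs_prim|exact/vs_prim|exact: glue_sapp].
move=> tg; have tgV := tame_homeoV tg.
have [|||||f tf hf] := @rel_homeo air (rel g).
- by move=> x; exact: tot.
- by move=> y; have [x /inv h] := tot _ y tgV; exists x; rewrite invgK in h.
- exact: fn.
- by move=> x x' y /inv + /inv; exact: fn.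
- move/tame_circ: (tg) => [n h]; exists n.+1 => p vp sp.
  have pn : p != [::] by case: p sp {vp}.
  have [[b [z ep]]|[i [r ep]]] := word_circle_split vp pn; last first.
    have [j ej] := tame_vertex i tg; exists (prim j ++ r).
    move: vp; rewrite ep vword_cat => /andP[_ vr].
    split; first by rewrite vword_cat [vword _ _ _ _]vw_prim /= [endc _ _ _]ec_prim -(ec_prim i).
      by rewrite !endc_cat; congr endc; rewrite [LHS]ec_prim [RHS]ec_prim.
    move=> u vu; right; exists i, j, (r +++ u); rewrite !sapp_cat; split=> //.
    apply/vstream_sapp; rewrite -(ec_prim i); split=> //.
    by rewrite -endc_cat.
  have sz : size (take n (b :: z)) = n.
    by apply: size_takel; move: sp; rewrite ep /= size_map => -[->].
  have [q c0] := h _ sz.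
  have {c0} c := bcanon_cat (drop n (b :: z)) c0; rewrite cat_take_drop in c.
  have [b' [z' eq]] : exists b' z', q ++ drop n (b :: z) = b' :: z'.
    have : size (drop n (b :: z)) = 1.
      by rewrite size_drop; move: sp; rewrite ep /= size_map => ->; rewrite subSn // subnn.
    by case: q c => [|b' q] c; case: (drop n (b :: z)) c => // d [|] // c _; do 2 eexists.
  rewrite {}eq in c; exists (cww (b' :: z')).
  split; [exact: vw_cww|by rewrite ep [LHS]ec_cww [RHS]ec_cww|].
  rewrite ep [endc _ _ _]ec_cww => u /red_split [[w ->]|[y [u' [-> vu']]]].
    by left; exists ((b :: z) +++ w), ((b' :: z') +++ w); rewrite !cw_sapp; split=> //; exact: (c w).
  right; exists (Some ((b :: z) ++ y)), (Some ((b' :: z') ++ y)), u'.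
  rewrite !prim_cons /= !map_cat !sapp_cat; split=> //.
  by have := c (y +++ true ::: cst false); rewrite /vtx -!sapp_cat.
exists f; last first.
  split=> [w w' e|i j e u vu].
    by apply: fn (hf _) _; left; exists w, w'.
  by apply: fn (hf _) _; right; exists i, j, u.
have key w w' : g (Qc w) = Qc w' -> f (P (cw w)) = P (cw w').
  by move=> e; apply: fn (hf _) _; left; exists w, w'.
split; first exact/TA_tame.
  apply/seteqP; split=> [_ [_ /boundary_central [w ->] <-]|_ /boundary_central [w ->]].
    by have [v ev] := Qc_repr (g (Qc w)); apply/boundary_central; exists v; exact: key.
  have [v ev] := Qc_repr (g^-1%g (Qc w)); exists (P (cw v)).
    by apply/boundary_central; exists v.
  by apply: key; rewrite -ev /= homeo_invK.
move=> e /primary_blueP [i ->]; have [j ej] := tame_vertex i tg.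
apply/extends_canon; [exact: vw_prim|by case: (i) => [[|b z]|]|].
exists (prim j); first by case: (j) => [[|b z]|].
apply/acanonP; split; [exact: vw_prim|by rewrite !ec_prim|].
rewrite ec_prim => u vu; apply: fn (hf _) _.
by right; exists i, j, u.
Qed.

Lemma rist_C0_iso : isomorphic rist_C0 (thompson_T R).
Proof.
have eT : thompson_T R = [set g | tame (S := circ) g].
  by apply/seteqP; split=> g /thompson_T_tame.
rewrite eT; apply: (@isomorphic_rel _ _ _ _ tiedC).
- exact: tame_subgroup.
- exact: rist_C0_tied.
- exact: tied_rist_C0.
- exact: tiedC_fun.
- move=> f f' g; exact: tiedC_inj.
- by move=> f f' g g' _ tg'; exact: tiedC_comp.
- by move=> f g _; exact: tiedC_inv.
Qed.

End RistC0.

(** * The horizon *)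

(** Addresses on the horizon in absolute terms: a digit says whether the next
    half is the left or the right one. A blue cell points in the direction of its
    last digit, so the letter says whether the direction is kept. *)
Definition hl (o b : bool) : letter := if b == o then b_plus else b_minus.
Definition hw (o : bool) (w : nat -> bool) : nat -> letter :=
  fun n => hl (if n is m.+1 then w m else o) (w n).
Fixpoint hww (o : bool) (z : seq bool) : word :=
  if z is b :: z' then hl o b :: hww b z' else [::].

(** The red edge of a component, below a cell of direction [o], that runs from
    left to right ([c = true]) or from right to left. *)
Definition ab (o c : bool) : letter := if o == c then bd else bu.

Lemma hw_scons o b w : hw o (b ::: w) = hl o b ::: hw b w.
Proof. by apply: funext => -[|[|n]]. Qed.

Lemma hw_sapp o z w : hw o (z +++ w) = hww o z +++ hw (last o z) w.
Proof. by elim: z o => //= b z IH o; rewrite hw_scons IH. Qed.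

Lemma hww_cat o y z : hww o (y ++ z) = hww o y ++ hww (last o y) z.
Proof. by elim: y o => //= b y IH o; rewrite IH. Qed.

Lemma hl_inj o : injective (hl o).
Proof. by case: o => -[] []. Qed.

Lemma hw_inj o : injective (hw o).
Proof.
move=> w v e; apply: contrapT => /first_difference [p [a [b [w' [v' [ab' ew ev]]]]]].
move: e; rewrite ew ev !hw_sapp !hw_scons => /sapp_inj /scons_inj [/hl_inj e _].
by rewrite e eqxx in ab'.
Qed.

Lemma hw_cst b : hw b (cst b) = cst b_plus.
Proof. by apply: funext => -[|n]; rewrite /hw /hl eqxx. Qed.

Lemma hw_cstN b : hw b (cst (~~ b)) = bt.
Proof. by rewrite cstE hw_scons hw_cst /bt /= /hl; case: b. Qed.

Lemma hw_neg o w : hw (~~ o) (negb \o w) = hw o w.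
Proof. by apply: funext => -[|n]; rewrite /hw /hl /= (inj_eq negb_inj). Qed.

Lemma vs_hw c o w : c = Blue -> vs c (hw o w).
Proof.
move=> -> n; elim: n o w => // n IH o w; rewrite (scons_eta w) hw_scons mkseq_scons /=.
by have := IH (w 0) (sdrop 1 w); rewrite /hl; case: ifP.
Qed.

Lemma vw_hww o z : vw Blue (hww o z).
Proof. by elim: z o => //= b z IH o; have := IH b; rewrite /hl; case: ifP. Qed.

Lemma ec_hww o z : ec Blue (hww o z) = Blue.
Proof. by elim: z o => //= b z IH o; have := IH b; rewrite /hl; case: ifP. Qed.

Lemma lcol_ab o c : lcol Blue (ab o c) = Red.
Proof. by rewrite /ab; case: ifP. Qed.

Lemma okc_ab o c : okc Blue (ab o c).
Proof. by rewrite /ab; case: ifP. Qed.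

Lemma vw_ab o z c : vw Blue (rcons (hww o z) (ab (last o z) c)).
Proof. by rewrite vword_rcons vw_hww ec_hww okc_ab. Qed.

Lemma ec_ab o z c : ec Blue (rcons (hww o z) (ab (last o z) c)) = Red.
Proof. by rewrite endc_rcons -(lcol_ab (last o z) c) /lcol. Qed.

Lemma blue_letter o a : okc Blue a -> (exists b, a = hl o b) \/ (exists c, a = ab o c).
Proof.
case: a => // _; rewrite /hl /ab.
- by left; exists (~~ o); case: o.
- by left; exists o; case: o.
- by right; exists (~~ o); case: o.
- by right; exists o; case: o.
Qed.

Lemma lcol_hl o b : lcol Blue (hl o b) = Blue.
Proof. by rewrite /hl; case: ifP. Qed.

Lemma word_hor_split o p : vw Blue p -> (exists z, p = hww o z) \/
  (exists z c r, p = hww o z ++ ab (last o z) c :: r).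
Proof.
elim: p o => [|a p IH] o; first by left; exists [::].
move=> /= /andP[/(blue_letter o) [[b ->]|[c ->]] vp]; last by right; exists [::], c, p.
move: vp; rewrite lcol_hl => /(IH b) [[z ->]|[z [c [r ->]]]].
  by left; exists (b :: z).
by right; exists (b :: z), c, r.
Qed.

Lemma hor_split o u : vs Blue u -> (exists w, u = hw o w) \/
  (exists z c u', u = hww o z +++ ab (last o z) c ::: u' /\ vs Red u').
Proof.
move=> vu; have [[n]|h] := pselect (exists n, u n = bu \/ u n = bd); last first.
  left; pose d := fix d o (u : nat -> letter) n := if n is m.+1
    then d ((u 0 == b_plus) == o) (sdrop 1 u) m else (u 0 == b_plus) == o.
  exists (d o u); apply: funext => n; elim: n o u vu h => [|n IH] o u vu h.
    have := vu 1; rewrite /mkseq /hw /hl /=; have := h.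
    case E : (u 0) => // h'; case: (o) => // _; exfalso; apply: h'; exists 0; rewrite E; tauto.
  move: vu; rewrite {1}(scons_eta u) => /vstream_scons [ok vu].
  have l0 : lcol Blue (u 0) = Blue.
    by move: ok h; case E : (u 0) => // _ h; exfalso; apply: h; exists 0; rewrite E; tauto.
  rewrite l0 in vu; have h1 : ~ exists n, sdrop 1 u n = bu \/ sdrop 1 u n = bd.
    by move=> [k hk]; apply: h; exists k.+1.
  by rewrite -[LHS]/(sdrop 1 u n) (IH ((u 0 == b_plus) == o) _ vu h1) /hw /=; case: n {IH}.
elim: n o u vu => [|n IH] o u; rewrite {1}(scons_eta u) => /vstream_scons [ok vu] hn.
  have [c ec'] : exists c, u 0 = ab o c.
    by case: hn => ->; [exists (~~ o)|exists o]; rewrite /ab; case: (o).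
  right; exists [::], c, (sdrop 1 u); rewrite -ec' -scons_eta; split=> //.
  by move: vu; rewrite ec' lcol_ab.
have [[b eb]|[c ec']] := blue_letter o ok; last first.
  right; exists [::], c, (sdrop 1 u); rewrite -ec' -scons_eta; split=> //.
  by move: vu; rewrite ec' lcol_ab.
move: vu; rewrite eb lcol_hl => vu.
have [[w ew]|[z [c [u' [eu vu']]]]] := IH b _ vu hn.
  by left; exists (b ::: w); rewrite hw_scons -eb -ew -scons_eta.
by right; exists (b :: z), c, u'; rewrite /= -eb -eu -scons_eta.
Qed.

Lemma glue_hw o w v : glue (hw o w) (hw o v) -> w = v.
Proof.
move=> g; apply: contrapT => /first_difference [p [a [b [w' [v' [ab' ew ev]]]]]].
move: g; rewrite ew ev !hw_sapp !hw_scons => /glue_sapp_inv /glue_scons_neq [].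
  by apply: contra ab' => /eqP /hl_inj ->.
move=> j [s [t []]]; move: ab'; rewrite /hl; case: a {ew} => /= ab'; case: b ab' {ev} => // _;
  by case: (last o p); case: j.
Qed.

Lemma glue_hw_ab o w z c u : glue (hw o w) (hww o z +++ ab (last o z) c ::: u) ->
  exists b, w = z +++ b ::: cst (~~ b) /\ u = end_tail Red (b (+) c).
Proof.
elim: z o w => [|d z IH] o w; rewrite (scons_eta w) hw_scons /=.
  move=> /glue_scons_neq [|j [s [t [ja jb]]]].
    by rewrite /hl /ab; case: ifP; case: ifP.
  rewrite lcol_hl lcol_ab => ew ->; exists (w 0).
  have es : s = true by move: ja; rewrite /hl; case: ifP; case: (j) => //= _ [].
  move: ew; rewrite es -/bt -(hw_cstN (w 0)) => /hw_inj ->; split=> //; congr end_tail.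
  by move: ja jb; rewrite /hl /ab; case: (o); case: (w 0); case: (c); case: (j) => //= _ [].
have [->|wd] := eqVneq (w 0) d.
  by move=> /glue_scons_inv /IH [b [-> ->]]; exists b.
move=> /glue_scons_neq [|j [s [t [ja jb _]]]].
  by apply: contra wd => /eqP /hl_inj ->.
by move: ja jb wd; rewrite /hl; case: (o); case: (w 0); case: (d); case: (j).
Qed.

Lemma hw_ab_glue o z b c :
  glue (hw o (z +++ b ::: cst (~~ b))) (hww o z +++ ab (last o z) c ::: end_tail Red (b (+) c)).
Proof.
rewrite hw_sapp hw_scons hw_cstN; apply: glue_sapp.
rewrite /bt -(lcol_hl (last o z) b) -(lcol_ab (last o z) c).
case: (last o z); case: b; case: c;
  by [apply: (@junction_glue Jx)|apply: (@junction_glue Jy)].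
Qed.

Lemma glue_ab o z c u z' c' u' :
  glue (hww o z +++ ab (last o z) c ::: u) (hww o z' +++ ab (last o z') c' ::: u') ->
  z = z' /\ ((c = c' /\ glue u u') \/
   (c' = ~~ c /\ exists s, u = end_tail Red s /\ u' = end_tail Red (~~ s))).
Proof.
have bad k o1 y d x : hww o1 y +++ ab (last o1 y) d ::: x <> end_tail Blue k.
  move=> /(congr1 (fun f => f (size (hww o1 y)))).
  by rewrite sappE ltnn subnn /= /ab; case: k; case: ifP; case: (size _).
elim: z z' o => [|b z IH] [|b' z'] o /=.
- have [->|cc] := eqVneq c c'.
    by move=> /glue_scons_inv g; split=> //; left.
  move=> /glue_scons_neq [|j [s [t [ja jb]]]].
    by apply: contra cc; rewrite /ab; case: (o); case: (c); case: (c').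
  rewrite !lcol_ab => -> ->; split=> //; right; split; first by case: (c) (c') cc => -[].
  exists s; split=> //; congr end_tail.
  by move: ja jb cc; rewrite /ab; case: (o); case: (c); case: (c'); case: j => //= -[<-] [<-].
- move=> /glue_scons_neq [|j [s [t [_ _ _]]]]; first by rewrite /hl /ab; case: ifP; case: ifP.
  by rewrite lcol_hl => /bad.
- move=> /glue_scons_neq [|j [s [t [_ _]]]]; first by rewrite /hl /ab; case: ifP; case: ifP.
  by rewrite lcol_hl => /bad.
have [->|bb] := eqVneq b b'; first by move=> /glue_scons_inv /IH [->].
move=> /glue_scons_neq [|j [s [t [_ _]]]]; first by apply: contra bb => /eqP /hl_inj ->.
by rewrite lcol_hl => /bad.
Qed.

Lemma ab_glue o z c s : glue (hww o z +++ ab (last o z) c ::: end_tail Red s)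
  (hww o z +++ ab (last o z) (~~ c) ::: end_tail Red (~~ s)).
Proof.
apply: glue_sapp; rewrite -{1}(lcol_ab (last o z) c) -(lcol_ab (last o z) (~~ c)).
case: (last o z); case: c; case: s;
  by [apply: (@junction_glue Jx)|apply: (@junction_glue Jy)].
Qed.

(** No junction lies at [l] and [r], so nothing is glued there. *)
Lemma glue_leaf s u : glue (end_tail Blue s) u -> u = end_tail Blue s.
Proof.
case=> [//|[p [j [t [t' [[a [k [ja et]]] _ e _]]]]]]; exfalso; move: e; rewrite et.
have pl q : cst b_plus <> q +++ a ::: end_tail (lcol Blue a) k.
  move=> e; have := congr1 (fun f => f (size q)) e.
  rewrite sappE ltnn subnn /cst /= => ea; move: e ja; rewrite -ea; case: j {et} => //= e [ek].
  by have := congr1 (fun f => f (size q).+1) e; rewrite sappE ltnNge leqnSn subSnn -ek.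
case: s; last exact: pl.
case: p => [|b p]; last by move=> /scons_inj [_ /pl].
move=> /scons_inj [ea]; move: ja; rewrite -ea; case: j {et} => //= -[<-].
by move=> /(congr1 (fun f => f 0)).
Qed.

(** A base vertex is never created by a replacement, so it is an end of every
    edge above an edge ending at it. *)
Lemma base_vertex_chain v p : p != [::] -> vw Blue p -> inl v \in ends (edge_of p) ->
  forall q r, p = q ++ r -> q != [::] -> (inl v : vertex) \in ends (edge_of q).
Proof.
move=> pn vp h q r; elim/last_ind: r p pn vp h => [|r a IH] p pn vp h.
  by rewrite cats0 => <-.
rewrite -rcons_cat => ep qn; apply: (IH (q ++ r)) => //; move: vp h; rewrite ep vword_rcons.
- by case: (q) qn.
- by case/andP.
move=> /andP[vqr oka]; have qrn : q ++ r != [::] by case: (q) qn.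
rewrite edge_of_rcons // => h.
have ra : sub (edge_of (q ++ r)) a \in replacement (edge_of (q ++ r)).
  by apply/replacementP; exists a; rewrite ?edge_of_col.
by have [//|[k]] := replacement_ends ra h.
Qed.

Lemma vertex_point_base v x : vertex_point (inl v) x <-> exists a s,
  [/\ okc Blue a, ends_at (base_edge a) s = inl v & x = P (a ::: end_tail (lcol Blue a) s)].
Proof.
split=> [[w [-> [N _ h]]]|[a [s [oka ea ->]]]].
  set u := rens (val w); have vu : vs Blue u := val_valid w.
  have inc k : inl v \in ends (edge_of (mkseq u k.+1)).
    have [e /is_edgeP [p [vp pn ->]]] := h (N + k).+1 (leqW (leq_addr _ _)).
    rewrite edge_of_name // => -[ep ve]; have {}ep : p = mkseq u (N + k).+1.
      by rewrite /u mkseq_rens -ep renwK.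
    apply: (base_vertex_chain pn vp ve (r := drop k.+1 p)) => //.
    rewrite ep -[LHS](cat_take_drop k.+1); congr (_ ++ _).
    by rewrite /mkseq -map_take take_iota (minn_idPl _) // ltnS leq_addl.
  have eu := scons_eta u; move: (vu); rewrite eu => /vstream_scons [oka vu'].
  have [s es] : exists s, ends_at (base_edge (u 0)) s = inl v.
    by have := inc 0; rewrite /ends !inE => /orP[] /eqP ->; [exists true|exists false].
  exists (u 0), s; split=> //; rewrite ptE -/u {1}eu; congr (P (_ ::: _)).
  rewrite -base_col //; apply: stays_end_tail; [exact: fresh_base|by rewrite base_col|].
  by move=> k; rewrite es; have := inc k; rewrite {1}eu mkseq_scons.
have vu : vs Blue (a ::: end_tail (lcol Blue a) s).
  by apply/vstream_scons; split=> //; exact: vs_end_tail.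
have [w ew ->] := P_pt vu; exists w; split=> //; exists 1 => // -[|n] //= _.
set u := _ ::: _ in vu ew.
exists (edge_of (mkseq u n.+1)); first by apply/is_edgeP; exists (mkseq u n.+1).
split; first by rewrite edge_of_name // ew mkseq_rens.
by rewrite /u mkseq_scons /= -ea -base_col //; exact: end_tail_stays.
Qed.

Definition Pl : Airplane := P (end_tail Blue true).
Definition Pr : Airplane := P (end_tail Blue false).

Lemma vertex_l x : vertex_point (inl vl) x <-> x = P (b_minus ::: cst b_plus).
Proof.
rewrite vertex_point_base; split=> [[a [s []]]|->]; last by exists b_minus, false.
by case: a => // _; case: s.
Qed.

Lemma vertex_r x : vertex_point (inl vr) x <-> x = Pr.
Proof.
rewrite vertex_point_base; split=> [[a [s []]]|->].
  by case: a => // _; case: s => // _ ->; rewrite /Pr [end_tail _ _]cstE.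
by exists b_plus, false; split=> //; rewrite /Pr [end_tail _ _]cstE.
Qed.

(** With the points [l] and [r] included. *)
Definition on_horizon (v : nat -> letter) := vs Blue v /\ forall n, v n <> rs.

Lemma leaf_P s u : vs Blue u -> P u = P (end_tail Blue s) -> u = end_tail Blue s.
Proof.
by move=> vu /esym /P_glue-/(_ (vs_end_tail _ _) vu) /glue_leaf.
Qed.

Lemma on_horizon_cw w : on_horizon (cw w).
Proof.
split; first exact: vs_cw.
by case=> [|n] /=; [case: (w 0)|rewrite /rw /=; case: (sdrop 1 w n)].
Qed.

Lemma base_vertex_circle v x : v = va \/ v = vb -> vertex_point (inl v) x ->
  exists w, x = P (cw w).
Proof.
have c b s : exists w, P (cl b ::: end_tail Red s) = P (cw w).
  by exists (b ::: cst (~~ s)); rewrite cw_scons rw_cst negbK.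
move=> hv /vertex_point_base [a [s [oka e ->]]].
case: hv => ev; rewrite ev in e; case: a oka e => //= _; case: s => //= _.
- by exists (vtx None); exact: (P_cong ((vs_prim None _).2 vs_bt) (vs_cw _) (prim_vtx None)).
- exact: (c true false).
- exact: (c false true).
- by exists (vtx (Some [::])); exact: (P_cong ((vs_prim (Some [::]) _).2 vs_bt) (vs_cw _) (prim_vtx _)).
- exact: (c true true).
- exact: (c false false).
Qed.

Lemma HorP x : Hor x <-> [/\ exists2 v, on_horizon v & x = P v, x <> Pl & x <> Pr].
Proof.
have ray a : okc Blue a -> (exists w u, [/\ x = pt w, val w = prepend [:: ren a] u &
    forall n, u n != rs]) -> exists u, on_horizon (a ::: u) /\ x = P (a ::: u).
  move=> oka [w [u [-> ew hu]]]; exists u.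
  have e : rens (val w) = a ::: u by rewrite ew prependE /rens /= renK; congr (_ ::: _); apply: funext.
  rewrite ptE e; split=> //; split; first by rewrite -e; exact: val_valid.
  by case=> [|n] /=; [case: (a) oka|apply/eqP].
split.
- case=> [[[]|[]]|].
  + move=> /(ray b_minus isT) [u [hu ex]]; rewrite /setU /= => nv.
    split; first by exists (b_minus ::: u).
      by move=> e; apply: nv; right; apply/vertex_l.
    rewrite ex => /(leaf_P hu.1) /(congr1 (fun f => f 0)).
    by [].
  + move=> /(ray b_plus isT) [u [hu ex]]; rewrite /setU /= => nv.
    split; first by exists (b_plus ::: u).
      rewrite ex => /(leaf_P hu.1) /(congr1 (fun f => f 0)).
      by [].
    by move=> e; apply: nv; right; apply/vertex_r.
  + move=> /boundary_central [w ->]; split; first by exists (cw w); [exact: on_horizon_cw|].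
      by move=> /(leaf_P (vs_cw _)) /(congr1 (fun f => f 0)) /=; case: (w 0).
    by move=> /(leaf_P (vs_cw _)) /(congr1 (fun f => f 0)) /=; case: (w 0).
move=> [[v [vv hv] ex] nl nr].
have ray' a vx vy : v 0 = a -> a != bu -> a != bd -> vx = va \/ vx = vb ->
    ~ vertex_point (inl vy) x -> (horizontal_ray (ren a) (inl vx) (inl vy) `|` boundary Central) x.
  move=> e0 na nb hx ny.
  have [hv'|nv] := pselect (vertex_point (inl vx) x).
    by right; apply/boundary_central; exact: base_vertex_circle hx hv'.
  left; split; last by case.
  have [w ew eP] := P_pt vv; exists w, (sdrop 1 v); split; first by rewrite ex.
    by rewrite ew /rens e0 prependE.
  by move=> n; apply/eqP; exact: hv.
have ok := vv 1; rewrite /mkseq /= andbT in ok.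
case E : (v 0) ok => // _.
- have [] := ray' b_minus va vl E isT isT (or_introl erefl).
  + by move/vertex_l.
  + by left; left.
  + by right.
- have [] := ray' b_plus vb vr E isT isT (or_intror erefl).
  + by move/vertex_r.
  + by left; right.
  + by right.
all: right; apply/boundary_central; move: (vv); rewrite (scons_eta v) E => /vstream_scons [_].
all: move=> /red_split [[w ew]|[z [u' [ez _]]]].
- by exists (true ::: w); rewrite cw_scons -ew ex {1}(scons_eta v) E.
- by case: (hv (size z).+1); rewrite -[LHS]/(sdrop 1 v (size z)) ez sappE size_map ltnn subnn.
- by exists (false ::: w); rewrite cw_scons -ew ex {1}(scons_eta v) E.
- by case: (hv (size z).+1); rewrite -[LHS]/(sdrop 1 v (size z)) ez sappE size_map ltnn subnn.
Qed.

Lemma on_horizon_split o v : on_horizon v -> (exists w, v = hw o w) \/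
  (exists z c w, v = hww o z +++ ab (last o z) c ::: rw w).
Proof.
move=> [vv hv]; have [[w ->]|[z [c [u [e vu]]]]] := hor_split o vv; first by left; exists w.
right; exists z, c; have [[w ew]|[y [u' [ey _]]]] := red_split vu.
  by exists w; rewrite e ew.
case: (hv (size (hww o z) + (size y).+1)); rewrite e sappE ltnNge leq_addr /= addKn /= ey.
by rewrite sappE size_map ltnn subnn.
Qed.

Lemma on_horizon_hw w : on_horizon (hw true w).
Proof.
split; first exact: vs_hw.
by move=> n; rewrite /hw /hl; case: ifP.
Qed.

Lemma on_horizon_ab z c w : on_horizon (hww true z +++ ab (last true z) c ::: rw w).
Proof.
split; first by rewrite -sapp_rcons; apply/vstream_sapp; rewrite vw_ab ec_ab; split=> //; exact: vs_rw.
elim: z true => [|b z IH] o [|n] /=.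
- by rewrite /ab; case: ifP.
- by rewrite /rw /=; case: (w n).
- by rewrite /hl; case: ifP.
- exact: IH.
Qed.

Lemma horizon_red_edges e : (exists C, [/\ lies_on_Hor C, is_edge e & name e \in red_pair C]) <->
  exists z c, e = edge_of (rcons (hww true z) (ab (last true z) c)).
Proof.
have nn z c : rcons (hww true z) (ab (last true z) c) != [::] by case: (hww _ _).
have ed q : name e = renw q -> q != [::] -> vw Blue q -> is_edge e -> e = edge_of q.
  move=> nq qn vq /is_edgeP [p [vp pn ee]]; move: nq; rewrite ee edge_of_name //.
  by move=> /(can_inj renwK) ->.
have cases o (a : letter) : a \in [:: bu; bd] -> exists c, a = ab o c.
  by rewrite !inE => /orP[] /eqP ->; [exists (~~ o)|exists o]; rewrite /ab; case: (o).
split=> [[[|e'] [[ic lC] ie nC]]|[z [c ->]]].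
- have [a au ea] : exists2 a, a \in [:: bu; bd] & name e = renw [:: a].
    by move: nC; rewrite !inE => /orP[] /eqP ->; [exists bu|exists bd].
  have [c ec'] := cases true _ au; exists [::], c; rewrite -[rcons _ _]/[:: ab true c] -ec'; apply: ed => //.
  by move: au; rewrite !inE => /orP[] /eqP ->.
- case: ic => /is_edgeP [p [vp pn ee]] _.
  case: lC => c0 [t [c0E ne ht]].
  have ep : p = ren c0 :: t by move: ne; rewrite ee edge_of_name // => /(congr1 renw); rewrite renwK.
  have [z ez] : exists z, p = hww true z.
    case: (word_hor_split true vp) => [//|[z [c [r er]]]]; exfalso.
    have : ab (last true z) c \in p by rewrite er mem_cat mem_head orbT.
    rewrite ep inE => /orP[/eqP|/(allP ht)]; last by rewrite /ab /= !inE; case: ifP.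
    by move: c0E; rewrite !inE /ab => /orP[] /eqP -> /=; case: ifP.
  have [a au ea] : exists2 a, a \in [:: bu; bd] & name e = renw (rcons p a).
    move: nC; rewrite /red_pair ee edge_of_name // !inE => /orP[] /eqP ->; [exists bu|exists bd] => //;
    by case: (p) pn.
  have [c ec'] := cases (last true z) _ au; exists z, c; rewrite -ec' -ez.
  apply: ed => //; first by case: (p).
  by rewrite ez ec' vw_ab.
have ie : is_edge (edge_of (rcons (hww true z) (ab (last true z) c))).
  by apply/is_edgeP; exists (rcons (hww true z) (ab (last true z) c)); rewrite vw_ab nn.
have [z0|zn] := eqVneq z [::].
  exists Central; split=> //; rewrite z0 /= /ab; by case: c {ie}.
have hn : hww true z != [::] by case: (z) zn.
have ih : is_edge (edge_of (hww true z)).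
  by apply/is_edgeP; exists (hww true z); rewrite vw_hww.
exists (OfBlue (edge_of (hww true z))); split=> //.
  split; first by split=> //; rewrite edge_of_col ?vw_hww ?ec_hww.
  rewrite edge_of_name ?vw_hww //; case: (z) zn => // b y _ /=.
  exists (ren (hl true b)), (hww b y); split=> //; first by case: b.
  by apply/allP; elim: y b => //= d y IH b x; rewrite inE => /orP[/eqP ->|/IH //]; rewrite /hl !inE; case: ifP.
rewrite /= !edge_of_name ?vw_hww ?vw_ab // !inE /ab; case: (hww true z) hn => //= a p _.
by case: ifP; rewrite eqxx ?orbT.
Qed.

(** * The rigid stabilizer of the horizon *)

Notation hor := (hw true).
Notation horw := (hww true).
Notation red z c := (rcons (hww true z) (ab (last true z) c)).
Notation mid z := (z +++ true ::: cst false).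

Section RistHor.
Import Order.TTheory GRing.Theory Num.Theory.
Variable R : realType.
Local Notation Qi := (@Qi R).
Local Notation itv := (itv R).
Local Notation bcan := (bcanon (R := R) id).
Implicit Types (f : homeo Airplane) (g : homeo (unit_itv R)).

Lemma P_hor w v : P (hor w) = P (hor v) -> w = v.
Proof. by move/P_glue => /(_ (vs_hw _ _ erefl) (vs_hw _ _ erefl)) /glue_hw. Qed.

Lemma vs_red z c u : vs Blue (red z c +++ u) <-> vs Red u.
Proof. by rewrite vstream_sapp vw_ab ec_ab; split=> [[]|]. Qed.

Lemma P_hor_red w z c u : vs Red u -> P (hor w) = P (red z c +++ u) ->
  exists b, w = z +++ b ::: cst (~~ b) /\ u = end_tail Red (b (+) c).
Proof.
move=> vu /P_glue-/(_ (vs_hw _ _ erefl) ((vs_red _ _ _).2 vu)).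
by rewrite sapp_rcons => /glue_hw_ab.
Qed.

Lemma P_red_end z b c :
  P (red z c +++ end_tail Red (b (+) c)) = P (hor (z +++ b ::: cst (~~ b))).
Proof.
apply/esym/P_cong; [exact: vs_hw|exact/vs_red/vs_end_tail|].
by rewrite sapp_rcons; exact: hw_ab_glue.
Qed.

Lemma P_red_inj z c u z' c' u' : vs Red u -> vs Red u' ->
  P (red z c +++ u) = P (red z' c' +++ u') ->
  z = z' /\ ((c = c' /\ glue u u') \/
    (c' = ~~ c /\ exists s, u = end_tail Red s /\ u' = end_tail Red (~~ s))).
Proof.
move=> vu vu' /P_glue-/(_ ((vs_red _ _ _).2 vu) ((vs_red _ _ _).2 vu')).
by rewrite !sapp_rcons => /glue_ab.
Qed.

Lemma cst_side (a b : bool) r : cst a <> r +++ b ::: cst (~~ b).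
Proof.
move=> e; have := congr1 (fun t => t (size r)) e.
have := congr1 (fun t => t (size r).+1) e.
by rewrite !sappE ltnn ltnNge leqnSn subSnn subnn /= /cst => -> /eqP; case: (b).
Qed.

Lemma side_inj z b z' b' : z +++ b ::: cst (~~ b) = z' +++ b' ::: cst (~~ b') ->
  z = z' /\ b = b'.
Proof.
wlog h : z b z' b' / size z <= size z'.
  move=> H e; have [h|/ltnW h] := leqP (size z) (size z'); first exact: H.
  by have [-> ->] := H _ _ _ _ h (esym e).
move=> /sapp_prefix /(_ h) [[|d r] -> /scons_inj []]; first by rewrite cats0.
by move=> _ /cst_side.
Qed.

Lemma Qi_mid z z' : Qi (mid z) = Qi (mid z') -> z = z'.
Proof.
move/Qi_eq => [/(@side_inj z true z' true) []//|[p [[e _]|[e _]]]].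
  by have [_] := @side_inj z true p false e.
by have [_] := @side_inj z' true p false e.
Qed.

Lemma Qi_side z b : Qi (z +++ b ::: cst (~~ b)) = Qi (mid z).
Proof. by case: b => //; exact: twin_Qi. Qed.

Lemma Qi_to_side w z b : Qi w = Qi (mid z) -> (exists2 q, w = q +++ cst (~~ b) & True) ->
  w = z +++ b ::: cst (~~ b).
Proof.
have tail q (d d' : bool) p : q +++ cst d = p +++ cst d' -> d = d'.
  move=> e; have := congr1 (fun t => t (size p + size q)) e.
  by rewrite !sappE !ltnNge leq_addr leq_addl.
move=> e [q eq _]; move: e; rewrite eq => /Qi_eq [|[p [[e1 e2]|[e2 e1]]]].
- case: b {eq} => // e; have := tail q true false (rcons z true).
  by rewrite sapp_rcons => /(_ e).
- have [-> _] := @side_inj z true p true e2; rewrite e1.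
  case: b {eq} e1 => // e1; have := tail q false true (rcons p false).
  by rewrite sapp_rcons => /(_ e1).
- by have [_] := @side_inj z true p false e2.
Qed.

(** ** Elements of [F] acting on expansions *)

(** Every expansion has an image under a tame map, whereas a point may have two
    expansions. *)
Definition theta g (w w' : nat -> bool) :=
  exists p q u, [/\ bcan g p q, w = p +++ u & w' = q +++ u].

Lemma theta_Qi g w w' : theta g w w' -> g (Qi w) = Qi w'.
Proof. by move=> [p [q [u [c -> ->]]]]; exact: c. Qed.

Lemma theta_total g w : tame (S := itv) g -> exists w', theta g w w'.
Proof.
move=> /tame_itv [n h]; have [q c] := h (mkseq w n) (size_mkseq _ _).
by exists (q +++ sdrop n w), (mkseq w n), q, (sdrop n w); rewrite sapp_mkseq.
Qed.

Lemma theta_fun g w w1 w2 : theta g w w1 -> theta g w w2 -> w1 = w2.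
Proof.
have key p q u p' q' u' : bcan g p q -> bcan g p' q' -> p +++ u = p' +++ u' ->
    size p <= size p' -> q +++ u = q' +++ u'.
  move=> c c' e s; have [r ep ->] := sapp_prefix e s.
  have -> : q' = q ++ r by apply: bcanon_fun_itv c' _; rewrite ep; exact: bcanon_cat.
  by rewrite sapp_cat.
move=> [p [q [u [c ew ->]]]] [p' [q' [u' [c' ew' ->]]]]; rewrite ew in ew'.
have [s|/ltnW s] := leqP (size p) (size p'); first exact: key ew' s.
by apply/esym; apply: key s.
Qed.

Lemma theta_inv g w w' : theta g w w' -> theta g^-1%g w' w.
Proof.
move=> [p [q [u [c -> ->]]]]; exists q, p, u; split=> // v.
by apply: (can_inj (homeo_funK g)); rewrite /= homeo_invK c.
Qed.

Lemma theta_comp g g' w v w' : theta g' w v -> theta g v w' -> theta (g * g')%g w w'.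
Proof.
move=> [p [q [u [c -> ->]]]] [p' [q' [u' [c' e ->]]]].
pose r := mkseq u (size p').
have [||s es eu] := sapp_prefix (p := p') (q := q ++ r) (u := u') (v := sdrop (size p') u).
- by rewrite sapp_cat sapp_mkseq.
- by rewrite size_cat size_mkseq leq_addl.
exists (p ++ r), (q' ++ s), (sdrop (size p') u); split.
- have c1 := bcanon_cat r c; have c2 := bcanon_cat s c'.
  by move=> x /=; rewrite c1 es; exact: c2.
- by rewrite sapp_cat sapp_mkseq.
- by rewrite eu sapp_cat.
Qed.

(** Prefix replacement keeps the constant tail of an expansion, which tells from
    which side it reaches the dyadic number. *)
Lemma theta_side g z z' b w' : g (Qi (mid z)) = Qi (mid z') ->
  theta g (z +++ b ::: cst (~~ b)) w' -> w' = z' +++ b ::: cst (~~ b).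
Proof.
move=> e th; apply: Qi_to_side.
  by rewrite -e -(Qi_side z b) (theta_Qi th).
have [p [q [u [_ ew ->]]]] := th.
suff [r ->] : exists r, u = r +++ cst (~~ b) by exists (q ++ r); rewrite ?sapp_cat.
move: ew; rewrite -sapp_rcons => ew.
have [s|/ltnW s] := leqP (size p) (size (rcons z b)).
  by have [r _ ->] := sapp_prefix (esym ew) s; exists r.
have [r _ er] := sapp_prefix ew s; exists [::] => /=.
by elim: r er => //= x r IH; rewrite {1}cstE => /scons_inj [_ /IH].
Qed.

Lemma tame_zero g : tame (S := itv) g -> g (Qi (cst false)) = Qi (cst false).
Proof.
move=> tg; have [x ex] : exists x, g x = Qi (cst false).
  by exists (g^-1%g (Qi (cst false))); rewrite /= homeo_invK.
apply: val_inj; apply: le_anti; apply/andP; split; last first.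
  by rewrite [X in (X <= _)%O](value_cst R false); case/andP: (unit_itvP (g (Qi (cst false)))).
rewrite -{2}ex; apply: tame_monotone => //=.
by rewrite value_cst; case/andP: (unit_itvP x).
Qed.

(** A tame map preserves the dyadic numbers and fixes 0, hence permutes the midpoints
    of dyadic intervals. *)
Lemma tame_mid g z : tame (S := itv) g -> exists z', g (Qi (mid z)) = Qi (mid z').
Proof.
move=> tg; move/tame_itv: (tg) => [n h].
have e : mid z = take n (rcons z true ++ nseq n false) +++
    (drop n (rcons z true ++ nseq n false) +++ cst false).
  by rewrite -sapp_cat cat_take_drop sapp_cat sapp_nseq_cst sapp_rcons.
have [|q c] := h (take n (rcons z true ++ nseq n false)).
  by rewrite size_takel // size_cat size_nseq leq_addl.
have [q' eq] : exists q', g (Qi (mid z)) = Qi (q' +++ cst false).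
  by rewrite e c -sapp_cat; eexists.
elim/last_ind: q' eq => [|q' [] IH] eq.
- have : Qi (mid z) = Qi (cst false).
    by apply: (can_inj (homeo_funK g)); rewrite /= in eq *; rewrite eq tame_zero.
  move/Qi_eq => [e1|[p [[_ e1]|[e1 _]]]].
  - by case: (@cst_side false true z (esym e1)).
  - by case: (@cst_side false true p e1).
  - by case: (@cst_side false false p e1).
- by exists q'; rewrite eq sapp_rcons.
- by apply: IH; rewrite eq sapp_rcons -cstE.
Qed.

(** [f] acts on the horizon as [g], and moves the components lying on it
    canonically, from left to right. *)
Definition tiedH f g :=
  (forall w w', theta g w w' -> f (P (hor w)) = P (hor w')) /\
  (forall z z', g (Qi (mid z)) = Qi (mid z') -> forall c u, vs Red u ->
     f (P (red z c +++ u)) = P (red z' c +++ u)).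

Lemma tiedH_comp f f' g g' : tame (S := itv) g -> tame (S := itv) g' ->
  tiedH f g -> tiedH f' g' -> tiedH (f * f')%g (g * g')%g.
Proof.
move=> tg tg' [a b] [a' b']; split=> [w w' th|z z' e c u vu] /=.
  have [v th1] := theta_total w tg'; have [w2 th2] := theta_total v tg.
  by rewrite (theta_fun th (theta_comp th1 th2)) (a' _ _ th1) (a _ _ th2).
have [y ey] := tame_mid z tg'.
by rewrite (b' _ _ ey) // (b _ z') // -ey.
Qed.

Lemma tiedH_inv f g : tiedH f g -> tiedH f^-1%g g^-1%g.
Proof.
move=> [a b]; split=> [w w' /theta_inv th|z z' e c u vu] /=;
  apply: (can_inj (homeo_funK f)); rewrite /= homeo_invK; apply/esym.
  by apply: a; rewrite invgK in th.
by apply: b => //; rewrite -e /= homeo_invK.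
Qed.

Lemma tiedH_fun f g g' : tame (S := itv) g -> tame (S := itv) g' ->
  tiedH f g -> tiedH f g' -> g = g'.
Proof.
move=> tg tg' [a _] [a' _]; apply: homeoP => x; have [w _ <-] := Qi_surj x.
have [v th] := theta_total w tg; have [v' th'] := theta_total w tg'.
rewrite (theta_Qi th) (theta_Qi th'); congr (Qi _); apply: P_hor.
by rewrite -(a _ _ th) -(a' _ _ th').
Qed.

Lemma tiedH_inj f f' g : tame (S := itv) g -> tiedH f g -> tiedH f' g -> f = f'.
Proof.
move=> tg [a b] [a' b']; apply: homeoP => x; have [u vu <-] := P_surj x.
have [[w ->]|[z [c [u' [-> vu']]]]] := hor_split true vu.
  by have [v th] := theta_total w tg; rewrite (a _ _ th) (a' _ _ th).
by rewrite -sapp_rcons; have [z' e] := tame_mid z tg; rewrite (b _ _ e) // (b' _ _ e).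
Qed.

(** The relation that extends [g] is functional where a component meets the horizon,
    because [g] preserves midpoints and sides. *)
Lemma tied_rist_Hor g : tame (S := itv) g -> exists2 f : homeo Airplane, rist_Hor f & tiedH f g.
Proof.
pose rel (h : homeo (unit_itv R)) x x' :=
  (exists w w', [/\ x = P (hor w), x' = P (hor w') & theta h w w']) \/
  (exists z z' c u, [/\ vs Red u, x = P (red z c +++ u), x' = P (red z' c +++ u) &
     h (Qi (mid z)) = Qi (mid z')]).
have tot (h : homeo (unit_itv R)) x : tame (S := itv) h -> exists x', rel h x x'.
  move=> th; have [u vu <-] := P_surj x.
  have [[w ->]|[z [c [u' [-> vu']]]]] := hor_split true vu.
    by have [v hv] := theta_total w th; exists (P (hor v)); left; exists w, v.
  rewrite -sapp_rcons; have [z' e] := tame_mid z th; exists (P (red z' c +++ u')).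
  by right; exists z, z', c, u'.
have inv (h : homeo (unit_itv R)) x x' : rel h x x' -> rel h^-1%g x' x.
  case=> [[w [w' [-> -> e]]]|[z [z' [c [u [vu -> -> e]]]]]].
    by left; exists w', w; split=> //; exact: theta_inv.
  by right; exists z', z, c, u; split=> //; rewrite -e /= homeo_funK.
have mix (h : homeo (unit_itv R)) w w' z z' c u : vs Red u -> P (hor w) = P (red z c +++ u) ->
    theta h w w' -> h (Qi (mid z)) = Qi (mid z') -> P (hor w') = P (red z' c +++ u).
  move=> vu /(P_hor_red vu) [b [-> ->]] th e.
  by rewrite P_red_end (theta_side e th).
have fn (h : homeo (unit_itv R)) x y y' : rel h x y -> rel h x y' -> y = y'.
  case=> [[w [w' [-> -> e]]]|[z [z' [c [u [vu -> -> e]]]]]];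
    case=> [[v [v' [ev -> e']]]|[y1 [y2 [d [u' [vu' ev -> e']]]]]].
  - by move: ev e' => /P_hor <- e'; rewrite (theta_fun e e').
  - exact: mix vu' ev e e'.
  - by apply/esym; apply: mix vu (esym ev) e' e.
  have [zy H] := P_red_inj vu vu' ev; rewrite -zy in e'.
  have <- : z' = y2 by apply: Qi_mid; rewrite -e -e'.
  case: H => [[<- gu]|[-> [s [-> ->]]]].
    by apply: P_cong; [exact/vs_red|exact/vs_red|exact: glue_sapp].
  apply: P_cong; [exact/vs_red/vs_end_tail|exact/vs_red/vs_end_tail|].
  by rewrite !sapp_rcons; exact: ab_glue.
move=> tg; have tgV := tame_homeoV tg.
have [|||||f tf hf] := @rel_homeo air (rel g).
- by move=> x; exact: tot.
- by move=> y; have [x /inv h] := tot _ y tgV; exists x; rewrite invgK in h.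
- exact: fn.
- by move=> x x' y /inv + /inv; exact: fn.
- move/tame_itv: (tg) => [n h]; exists n.+1 => p vp sp.
  have [[z ep]|[z [c [r ep]]]] := word_hor_split true vp; last first.
    have [z' e] := tame_mid z tg; exists (red z' c ++ r).
    move: vp; rewrite ep -cat_rcons => vp.
    have vr : vw Red r by move: vp; rewrite vword_cat ec_ab => /andP[].
    have ecr y : ec Blue (red y c ++ r) = ec Red r by rewrite endc_cat ec_ab.
    split; first by rewrite [vword _ _ _ _](_ : _ = vw Blue (red z' c ++ r)) // vword_cat vw_ab ec_ab.
      by rewrite [LHS]ecr [RHS]ecr.
    rewrite [endc _ _ _]ecr => u vu; right; exists z, z', c, (r +++ u).
    by rewrite !sapp_cat; split=> //; apply/vstream_sapp.
  elim/last_ind: z ep => [|z b _] ep; first by move: sp; rewrite ep.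
  have sz : size z = n.
    have : size (horw (rcons z b)) = size (rcons z b).
      by elim: (rcons z b) true => //= ? ? IH o; rewrite IH.
    by rewrite -ep sp size_rcons => -[].
  have [q0 c0] := h z sz; have c := bcanon_cat [:: b] c0; rewrite !cats1 in c.
  exists (horw (rcons q0 b)).
  split; [exact: vw_hww|by rewrite ep [LHS]ec_hww [RHS]ec_hww|].
  rewrite ep [endc _ _ _]ec_hww => u /(hor_split b) [[w ->]|[y [d [u' [-> vu']]]]].
    left; exists (rcons z b +++ w), (rcons q0 b +++ w); rewrite !hw_sapp !last_rcons; split=> //.
    by exists (rcons z b), (rcons q0 b), w.
  right; exists (rcons z b ++ y), (rcons q0 b ++ y), d, u'.
  by rewrite !sapp_rcons !hww_cat !last_cat !last_rcons !sapp_cat; split=> //.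
have keyw w w' : theta g w w' -> f (P (hor w)) = P (hor w').
  by move=> th; apply: fn (hf _) _; left; exists w, w'.
have keyz z z' c u : g (Qi (mid z)) = Qi (mid z') -> vs Red u ->
    f (P (red z c +++ u)) = P (red z' c +++ u).
  by move=> e vu; apply: fn (hf _) _; right; exists z, z', c, u.
have hh b : hor (cst b) = end_tail Blue (~~ b).
  by case: b; [exact: hw_cst|exact: (hw_cstN true)].
have ends b : f (P (end_tail Blue b)) = P (end_tail Blue b).
  have th d : g (Qi (cst d)) = Qi (cst d) -> forall w', theta g (cst d) w' -> w' = cst d.
    move=> e w' /theta_Qi; rewrite e => /(congr1 val) /=; rewrite value_cst.
    by case: d {e} => /esym; [move/(value_eq1 R)|move/(value_eq0 R)].
  have e0 := tame_zero tg.
  have e1 : g (Qi (cst true)) = Qi (cst true).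
    have [x ex] : exists x, g x = Qi (cst true).
      by exists (g^-1%g (Qi (cst true))); rewrite /= homeo_invK.
    apply: val_inj; apply: le_anti; apply/andP; split.
      by rewrite [X in (_ <= X)%O](value_cst R true); case/andP: (unit_itvP (g (Qi (cst true)))).
    rewrite -{1}ex; apply: tame_monotone => //=.
    by rewrite value_cst; case/andP: (unit_itvP x).
  have [w' tw] := theta_total (cst (~~ b)) tg.
  have ew : w' = cst (~~ b) by apply: th tw; case: (b).
  by have := keyw _ _ tw; rewrite ew hh negbK.
exists f; last by split=> [w w'|z z' e c u]; [exact: keyw|exact: keyz].
have keyh v : on_horizon v -> exists2 v', on_horizon v' & f (P v) = P v'.
  move=> /(on_horizon_split true) [[w ->]|[z [c [w ->]]]].
    by have [w' tw] := theta_total w tg; exists (hor w'); [exact: on_horizon_hw|exact: keyw].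
  have [z' e] := tame_mid z tg; exists (red z' c +++ rw w).
    by rewrite sapp_rcons; exact: on_horizon_ab.
  by rewrite -sapp_rcons; apply: keyz => //; exact: vs_rw.
have finj := can_inj (homeo_funK f).
split.
- exact/TA_tame.
- apply/seteqP; split=> [_ [x /HorP [[v hv ->] nl nr] <-]|y /HorP [[v hv ey] nl nr]].
    have [v' hv' e] := keyh v hv; apply/HorP; split; first by exists v'.
      by move=> e0; apply: nl; apply: finj; rewrite /= in e0 *; rewrite e0 [RHS](ends true).
    by move=> e0; apply: nr; apply: finj; rewrite /= in e0 *; rewrite e0 [RHS](ends false).
  have [v' hv' ef] : exists2 v', on_horizon v' & f (P v') = P v.
    have := on_horizon_split true hv => -[[w ew]|[z [c [w ew]]]].
      have [w' tw] := theta_total w tgV; exists (hor w'); first exact: on_horizon_hw.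
      by rewrite ew; apply: keyw; have := theta_inv tw; rewrite invgK.
    have [z' e] := tame_mid z tgV; exists (red z' c +++ rw w).
      by rewrite sapp_rcons; exact: on_horizon_ab.
    rewrite ew -sapp_rcons; apply: keyz; last exact: vs_rw.
    by rewrite -e /= homeo_invK.
  exists (P v'); last by rewrite ef.
  apply/HorP; split; first by exists v'.
    by move=> e; apply: nl; rewrite ey -ef e /Pl (ends true).
  by move=> e; apply: nr; rewrite ey -ef e /Pr (ends false).
- move=> x; rewrite inE => -[/vertex_l ->|/vertex_r ->]; first exact: (ends true).
  exact: (ends false).
move=> C e lC ie nC.
have [z [c ee]] : exists z c, e = edge_of (red z c).
  by apply/horizon_red_edges; exists C.
have nn y : red y c != [::] by case: (horw y).
have [z' ez] := tame_mid z tg; rewrite ee.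
apply/extends_canon; [exact: vw_ab|exact: nn|]; exists (red z' c); first exact: nn.
apply/acanonP; rewrite !ec_ab; split=> //; first exact: vw_ab.
by move=> u vu; exact: keyz.
Qed.

End RistHor.

(** Below a red edge of a component, the parameters [hor] reach only the two ends
    of the edge, so a red cell with both ends there is the whole edge. *)
Lemma red_ends q w v : vw Blue q -> ec Blue q = Red ->
  P (q +++ cst r1) = P (hor w) -> P (q +++ cst r2) = P (hor v) ->
  exists e c, [/\ q = red e c, w = e +++ ~~ c ::: cst c & v = e +++ c ::: cst (~~ c)].
Proof.
move=> vq eq h1 h2; have vs1 s : vs Blue (q +++ end_tail Red s).
  by apply/vstream_sapp; rewrite eq; split=> //; exact: vs_end_tail.
have [[z ez]|[z [c [r ez]]]] := word_hor_split true vq; first by rewrite ez ec_hww in eq.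
have vr s : vs Red (r +++ end_tail Red s).
  by have := vs1 s; rewrite ez sapp_cat -sapp_rcons => /vs_red.
have e s : q +++ end_tail Red s = red z c +++ r +++ end_tail Red s.
  by rewrite ez -cat_rcons sapp_cat.
have := h1; rewrite -[cst r1]/(end_tail Red true) e => /esym /(P_hor_red (vr true)) [b [ew er]].
have := h2; rewrite -[cst r2]/(end_tail Red false) e => /esym /(P_hor_red (vr false)) [b' [ev er']].
have sz x : (r +++ x) (size r) = x 0 by rewrite sappE ltnn subnn.
have bc : b (+) c = true.
  have := congr1 (fun t => t (size r)) er; rewrite sz /=.
  by case: (b (+) c).
have bc' : b' (+) c = false.
  have := congr1 (fun t => t (size r)) er'; rewrite sz /=.
  by case: (b' (+) c).
have r0 : r = [::].
  case: r er er' {ez vr e sz} => // a r; rewrite bc bc' /=.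
  move=> /(congr1 (fun t => t 0)) /= -> /(congr1 (fun t => t 0)) /=.
  by [].
exists z, c; rewrite ez r0 cats1 ew ev; split=> //.
  have -> : b = ~~ c by case: (b) (c) bc => -[].
  by rewrite negbK.
by have -> : b' = c by case: (b') (c) bc' => -[].
Qed.

Section Forward.
Import Order.TTheory GRing.Theory Num.Theory.
Variable R : realType.
Local Notation Qi := (@Qi R).
Local Notation itv := (itv R).
Local Notation bcan := (bcanon (R := R) id).
Implicit Types (f : homeo Airplane) (g : homeo (unit_itv R)).

Section Fix.
Variable f : homeo Airplane.
Hypothesis Tf : TA f.
Hypothesis fHor : f @` Hor = Hor.
Hypothesis fl : f Pl = Pl.
Hypothesis fr : f Pr = Pr.
Hypothesis fred : forall z c, exists2 q, q != [::] & acanon f (red z c) q.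

Lemma horizon_stable v : on_horizon v -> exists2 v', on_horizon v' & f (P v) = P v'.
Proof.
move=> hv; have [e|nl] := pselect (P v = Pl).
  by exists (hor (cst false)); [exact: on_horizon_hw|rewrite e fl (hw_cstN true)].
have [e|nr] := pselect (P v = Pr).
  by exists (hor (cst true)); [exact: on_horizon_hw|rewrite e fr hw_cst].
have : Hor (f (P v)) by rewrite -fHor; exists (P v) => //; apply/HorP; split=> //; exists v.
by move=> /HorP [[v' hv' ->] _ _]; exists v'.
Qed.

Lemma horizon_onto v' : on_horizon v' -> exists2 v, on_horizon v & f (P v) = P v'.
Proof.
move=> hv; have [e|nl] := pselect (P v' = Pl).
  by exists (hor (cst false)); [exact: on_horizon_hw|rewrite (hw_cstN true) e].
have [e|nr] := pselect (P v' = Pr).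
  by exists (hor (cst true)); [exact: on_horizon_hw|rewrite hw_cst e].
have : Hor (P v') by apply/HorP; split=> //; exists v'.
by rewrite -fHor => -[_ /HorP [[v hv' ->] _ _] e]; exists v.
Qed.

(** [f] replaces the digits [z] by [z'], reversing the later ones if [s]. *)
Definition digit_map z z' s := forall w, f (P (hor (z +++ w))) =
  P (hor (z' +++ (if s then negb \o w else w))).

Lemma digit_map_cat z z' s y : digit_map z z' s ->
  digit_map (z ++ y) (z' ++ (if s then map negb y else y)) s.
Proof.
move=> h w; rewrite !sapp_cat h; congr (P (hor (_ +++ _))).
case: s {h} => //; elim: y => // b y /= <-; by apply: funext => -[].
Qed.

Lemma horizon_word p : on_horizon (p +++ cst b_minus) -> exists z, p = horw z.
Proof.
move=> [vv hv]; have vp : vw Blue p by case/vstream_sapp: vv.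
have [//|[z [c [r ez]]]] := word_hor_split true vp; exfalso.
have : vs Red (r +++ cst b_minus).
  by have := vv; rewrite ez sapp_cat -sapp_rcons => /vs_red.
move=> /red_split [[w e]|[y [u' [e _]]]].
  have := congr1 (fun t => t (size r)) e.
  by rewrite sappE ltnn subnn /rw /=; case: (w _).
case: (hv (size (red z c) + size y)).
rewrite ez -cat_rcons sapp_cat e sappE ltnNge leq_addr /= addKn.
by rewrite sappE size_map ltnn subnn.
Qed.

(** The cell to which a deep cell of the horizon is moved contains the image of a
    generic point of the horizon, so its address is again on the horizon. *)
Lemma deep_digit_map : exists n, forall z, n <= size z -> exists z' s, digit_map z z' s.
Proof.
have [n h] := tame_nonempty ((TA_tame f).1 Tf); exists n => z nz.
have szz o y : size (hww o y) = size y by elim: y o => //= b y IH o; rewrite IH.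
have [|_ [q qn]] := h (horw z) (vw_hww _ _); first by rewrite szz.
move=> /acanonP; rewrite ec_hww => -[vq eq hq].
have vm : vs Blue (cst b_minus) := vs_gst Blue.
have om : on_horizon (horw z +++ cst b_minus).
  split; first by apply/vstream_sapp; rewrite vw_hww ec_hww.
  by elim: (z) true => [|b y IH] o [|k] //=; rewrite /hl; case: ifP.
have [v' hv'] := horizon_stable om; rewrite hq // => e.
have vqm : vs Blue (q +++ cst b_minus) by apply/vstream_sapp; rewrite -eq.
have ev := P_generic vqm hv'.1 (generic_sapp _ generic_cst) (esym e).
have [z' ez'] := horizon_word (eq_ind _ on_horizon hv' _ ev).
exists z', (last true z != last true z') => w.
rewrite !hw_sapp hq; last exact: vs_hw.
rewrite -ez'; congr (P (_ +++ _)).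
have [->//|ne] := eqVneq (last true z) (last true z').
by rewrite -(hw_neg (last true z)); congr hw; case: (last true z) (last true z') ne => -[].
Qed.

Lemma red_source z : exists q, [/\ vw Blue q, ec Blue q = Red &
  f (P (hor (z +++ false ::: cst true))) = P (q +++ cst r1) /\
  f (P (hor (z +++ true ::: cst false))) = P (q +++ cst r2)].
Proof.
have [q qn /acanonP] := fred z true; rewrite ec_ab => -[vq eq hq].
exists q; rewrite eq; split=> //.
have h s := hq (end_tail Red s) (vs_end_tail _ _).
by rewrite -(h true) -(h false) -(P_red_end z false true) -(P_red_end z true true).
Qed.

(** The direction is constant: the two halves of a cell of the horizon are
    separated by a component, whose red edges [f] moves canonically; so either
    both halves are reversed or none is. *)
Lemma direction n : (forall z, n <= size z -> exists z' s, digit_map z z' s) ->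
  forall z, exists s, forall y, n <= size (z ++ y) -> exists z', digit_map (z ++ y) z' s.
Proof.
move=> deep z.
suff H m : n <= size z + m -> exists s, forall y, n <= size (z ++ y) ->
    exists z', digit_map (z ++ y) z' s by exact: (H n (leq_addl _ _)).
elim: m z => [|m IH] z.
  rewrite addn0 => /deep [z' [s h]]; exists s => y _.
  by exists (z' ++ (if s then map negb y else y)); exact: digit_map_cat.
move=> nz; have IHb b := IH (rcons z b).
have [|s0 h0] := IHb false; first by rewrite size_rcons addSnnS.
have [|s1 h1] := IHb true; first by rewrite size_rcons addSnnS.
have [ns|sn] := leqP n (size z).
  have [z' [s h]] := deep z ns; exists s => y _.
  by exists (z' ++ (if s then map negb y else y)); exact: digit_map_cat.
suff s01 : s0 = s1.
  exists s0 => -[|b y] hy; first by move: hy; rewrite cats0 leqNgt sn.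
  by move: hy; rewrite -cat_rcons; case: b; [rewrite s01; exact: h1|exact: h0].
have [|z0 d0] := h0 (nseq n true); first by rewrite size_cat size_nseq leq_addl.
have [|z1 d1] := h1 (nseq n false); first by rewrite size_cat size_nseq leq_addl.
have [q [vq eq [f1 f2]]] := red_source z.
have cn (s b : bool) : (if s then negb \o cst b else cst b) = cst (s (+) b) by case: s.
have := d0 (cst true); rewrite sapp_cat sapp_nseq_cst sapp_rcons f1 cn => e1.
have := d1 (cst false); rewrite sapp_cat sapp_nseq_cst sapp_rcons f2 cn => e2.
have [e [c [_ w0 w1]]] := red_ends vq eq e1 e2.
have tl p (a : bool) r (b : bool) : p +++ cst a = r +++ cst b -> a = b.
  move=> h; have := congr1 (fun t => t (size p + size r)) h.
  by rewrite !sappE !ltnNge leq_addr leq_addl.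
rewrite -!sapp_rcons in w0 w1.
by move: (tl _ _ _ _ w0) (tl _ _ _ _ w1); case: (s0); case: (s1); case: (c).
Qed.

(** The direction is forward because [f] fixes [l]. *)
Lemma deep_forward : exists n, forall z, n <= size z -> exists z', digit_map z z' false.
Proof.
have [n deep] := deep_digit_map; exists n.
have [s hs] := direction deep [::]; have [|z' d] := hs (nseq n false).
  by rewrite size_nseq.
suff s0 : s = false by rewrite -s0.
have := d (cst false); rewrite /= sapp_nseq_cst (hw_cstN true) [X in X = _]fl => e.
have : P (hor (cst false)) = P (hor (z' +++ (if s then negb \o cst false else cst false))).
  by rewrite -e (hw_cstN true).
move/P_hor => /(congr1 (fun t => t (size z'))).
by rewrite sappE ltnn subnn; case: (s).
Qed.

(** The two red edges of a component are moved to red edges whose ends lie on the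
    horizon; these form one component, and the order of the ends is kept. *)
Lemma component_forward z : exists z', 
  [/\ f (P (hor (z +++ false ::: cst true))) = P (hor (z' +++ false ::: cst true)),
      f (P (hor (z +++ true ::: cst false))) = P (hor (z' +++ true ::: cst false))
    & forall c u, vs Red u -> f (P (red z c +++ u)) = P (red z' c +++ u)].
Proof.
have [n deep] := deep_forward.
have pad (b : bool) : exists y, f (P (hor (z +++ ~~ b ::: cst b))) = P (hor (y +++ cst b)).
  have e : z +++ ~~ b ::: cst b = (rcons z (~~ b) ++ nseq n b) +++ cst b.
    by rewrite sapp_cat sapp_nseq_cst sapp_rcons.
  have [|y d] := deep (rcons z (~~ b) ++ nseq n b).
    by rewrite size_cat size_nseq leq_addl.
  by exists y; rewrite e d.
have [y1 e1] := pad true; have [y0 e0] := pad false; rewrite /= in e1 e0.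
have tl p (a : bool) r (b : bool) : p +++ cst a = r +++ cst b -> a = b.
  move=> h; have := congr1 (fun t => t (size p + size r)) h.
  by rewrite !sappE !ltnNge leq_addr leq_addl.
have ends c q : acanon f (red z c) q -> exists z', [/\ q = red z' c,
    y1 +++ cst true = z' +++ false ::: cst true & y0 +++ cst false = z' +++ true ::: cst false].
  move=> /acanonP; rewrite ec_ab => -[vq eq hq].
  have h s : P (q +++ end_tail Red s) = f (P (hor (z +++ (s (+) c) ::: cst (~~ (s (+) c))))).
    rewrite -hq; last exact: vs_end_tail.
    by rewrite -(P_red_end z (s (+) c) c) addbK.
  have h1 := h true; have h2 := h false; rewrite /= in h1 h2.
  case: c {hq h} h1 h2 eq => /= h1 h2 eq.
    rewrite e1 in h1; rewrite e0 in h2; have [e [c [-> w1 w0]]] := red_ends vq (esym eq) h1 h2.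
    have c1 : c = true by move: w1; rewrite -!sapp_rcons => /tl.
    by exists e; rewrite w1 w0 c1.
  rewrite e0 in h1; rewrite e1 in h2; have [e [c [-> w1 w0]]] := red_ends vq (esym eq) h1 h2.
  have c1 : c = false by move: w1; rewrite -!sapp_rcons => /tl.
  by exists e; rewrite w1 w0 c1.
have [q _ cq] := fred z true; have [z' [eq w1 w0]] := ends _ _ cq.
have [q' _ cq'] := fred z false; have [z2 [eq' w1' w0']] := ends _ _ cq'.
have zz : z2 = z' by have [-> _] := @side_inj z2 false z' false (etrans (esym w1') w1).
exists z'; rewrite e1 e0 w1 w0; split=> // c u vu.
case: c; last first.
  by move: cq' => /acanonP [_ _]; rewrite ec_ab eq' zz; exact.
by move: cq => /acanonP [_ _]; rewrite ec_ab eq; exact.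
Qed.

(** Two expansions of a dyadic number surround a component lying on the horizon;
    the component is moved as a whole, so their images also represent one number. *)
Lemma horizon_action : exists2 g : homeo (unit_itv R), tame (S := itv) g & tiedH f g.
Proof.
pose rel (x x' : unit_itv R) := exists w w', [/\ x = Qi w, x' = Qi w' &
  f (P (hor w)) = P (hor w')].
have [n deep] := deep_forward.
have finj := can_inj (homeo_funK f).
have fw w : exists w', f (P (hor w)) = P (hor w').
  have [|z' d] := deep (mkseq w n); first by rewrite size_mkseq.
  by exists (z' +++ sdrop n w); rewrite -d sapp_mkseq.
have side z b : exists z', f (P (hor (z +++ b ::: cst (~~ b)))) =
    P (hor (z' +++ b ::: cst (~~ b))) /\ forall b', f (P (hor (z +++ b' ::: cst (~~ b')))) =
    P (hor (z' +++ b' ::: cst (~~ b'))).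
  have [z' [e1 e0 _]] := component_forward z; exists z'.
  by split; [case: b|case].
have fn w v w1 v1 : Qi w = Qi v -> f (P (hor w)) = P (hor w1) -> f (P (hor v)) = P (hor v1) ->
    Qi w1 = Qi v1.
  have tw (b : bool) p : Qi (p +++ b ::: cst (~~ b)) = Qi (mid p) by case: b => //; exact: twin_Qi.
  have key p b x1 y1 : f (P (hor (p +++ b ::: cst (~~ b)))) = P (hor x1) ->
      f (P (hor (p +++ ~~ b ::: cst b))) = P (hor y1) -> Qi x1 = Qi y1.
    have [z' [_ H]] := side p b; rewrite H -[in X in _ +++ ~~ b ::: cst X](negbK b) H.
    by move=> /P_hor <- /P_hor <-; rewrite !tw.
  move=> /Qi_eq [->|[p [[-> ->]|[-> ->]]]]; first by move=> -> /P_hor ->.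
    exact: (@key p false).
  exact: (@key p true).
have inj w v w1 v1 : Qi w1 = Qi v1 -> f (P (hor w)) = P (hor w1) -> f (P (hor v)) = P (hor v1) ->
    Qi w = Qi v.
  have key p b x y : f (P (hor x)) = P (hor (p +++ b ::: cst (~~ b))) ->
      f (P (hor y)) = P (hor (p +++ ~~ b ::: cst b)) -> Qi x = Qi y.
    move=> ex ey; have [|z' d] := deep (mkseq x n); first by rewrite size_mkseq.
    have := ex; rewrite -(sapp_mkseq n x) d -sapp_rcons => /P_hor e.
    have [r er] : exists r, sdrop n x = r +++ cst (~~ b).
      have [s|/ltnW s] := leqP (size z') (size (rcons p b)).
        by have [r _ ->] := sapp_prefix e s; exists r.
      have [r _ er] := sapp_prefix (esym e) s; exists [::] => /=.
      elim: r er => //= c r IH; rewrite {1}cstE => /scons_inj [_ /IH].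
      by [].
    have [r' er'] : exists r, x = r +++ cst (~~ b).
      by exists (mkseq x n ++ r); rewrite sapp_cat -er sapp_mkseq.
    have [t et] : exists t, x = t +++ b ::: cst (~~ b).
      elim/last_ind: r' er' => [|r' c IH] ex'.
        have := ex; rewrite ex' /=.
        have -> : f (P (hor (cst (~~ b)))) = P (hor (cst (~~ b))).
          by case: (b) => /=; [rewrite (hw_cstN true)|rewrite (hw_cst true)].
        by move/P_hor/cst_side.
      have [cb|cb] := eqVneq c b; first by exists r'; rewrite ex' cb sapp_rcons.
      have cb' : c = ~~ b by case: (c) (b) cb => -[].
      by apply: IH; rewrite ex' sapp_rcons cb' -cstE.
    have [t' [H1 H2]] := side t b.
    have ett : t' = p by move: ex; rewrite et H1 => /P_hor /side_inj [].
    have := H2 (~~ b); rewrite negbK ett -ey => /finj e'.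
    have /P_hor ey' : P (hor (t +++ ~~ b ::: cst b)) = P (hor y) by [].
    have := Qi_side R t (~~ b); rewrite negbK et -ey' => tw.
    by rewrite [RHS]tw sapp_mkseq; exact: Qi_side.
  move=> /Qi_eq [->|[p [[-> ->]|[-> ->]]]]; first by move=> <- /finj /P_hor ->.
    exact: (@key p false).
  exact: (@key p true).
have [|||||g tg hg] := @rel_homeo itv rel.
- move=> x; have [w _ <-] := Qi_surj x; have [w' e] := fw w.
  by exists (Qi w'), w, w'.
- move=> y; have [w' _ <-] := Qi_surj y.
  have [v hv e] := horizon_onto (on_horizon_hw w').
  have [[w ew]|[z [c [w ew]]]] := on_horizon_split true hv.
    by exists (Qi w), w, w'; rewrite -ew.
  have [z' [_ _ H]] := component_forward z.
  move: e; rewrite ew -sapp_rcons (H c (rw w) (vs_rw _ erefl)).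
  move/esym/(P_hor_red (vs_rw _ erefl)) => [b [eb er]].
  exists (Qi (z +++ b ::: cst (~~ b))), (z +++ b ::: cst (~~ b)), w'; split=> //.
  by rewrite -(P_red_end z b c) (H _ _ (vs_end_tail _ _)) eb P_red_end.
- by move=> x y y' [w [w1 [-> -> e1]]] [v [v1 [e -> e2]]]; exact: fn e e1 e2.
- by move=> x x' y [w [w1 [-> -> e1]]] [v [v1 [-> e e2]]]; exact: inj e e1 e2.
- exists n => z _ sz; have [|z' d] := deep z; first by rewrite sz.
  exists z'; split; [exact: vwb|exact: unit_eq|move=> u _].
  by exists (z +++ u), (z' +++ u).
have gw w w1 : f (P (hor w)) = P (hor w1) -> g (Qi w) = Qi w1.
  move=> e; have [v [v1 [e1 e2 e3]]] := hg (Qi w).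
  by rewrite [LHS]e2; exact: fn (esym e1) e3 e.
exists g => //; split.
- move=> w w' [p [q [u [c -> ->]]]].
  have [|z' d] := deep (p ++ mkseq u n); first by rewrite size_cat size_mkseq leq_addl.
  have cz : bcan g (p ++ mkseq u n) z' by move=> v; apply: gw.
  have ez : z' = q ++ mkseq u n by exact: bcanon_fun_itv cz (bcanon_cat _ c).
  by have := d (sdrop n u); rewrite ez !sapp_cat sapp_mkseq.
move=> z z' e c u vu; have [z1 [_ e1 H]] := component_forward z.
suff -> : z' = z1 by exact: H.
by apply: (@Qi_mid R); rewrite -e; exact: gw.
Qed.

End Fix.

Lemma rist_Hor_tied f : rist_Hor f -> exists2 g : homeo (unit_itv R), tame (S := itv) g & tiedH f g.
Proof.
move=> [Tf fH fix_ ext]; apply: horizon_action => //.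
- apply: fix_; rewrite inE; left; exact/vertex_l.
- apply: fix_; rewrite inE; right; exact/vertex_r.
move=> z c; have nn : red z c != [::] by case: (horw z).
have [C' [lC ie nC]] : exists C, [/\ lies_on_Hor C, is_edge (edge_of (red z c)) &
    name (edge_of (red z c)) \in red_pair C] by apply/horizon_red_edges; exists z, c.
by apply/(extends_canon f (vw_ab true z c) nn); exact: ext lC ie nC.
Qed.

Lemma rist_Hor_iso : isomorphic rist_Hor (thompson_F R).
Proof.
have eF : thompson_F R = [set g | tame (S := itv) g].
  by apply/seteqP; split=> g /thompson_F_tame.
rewrite eF; apply: (@isomorphic_rel _ _ _ _ (fun f g => tame (S := itv) g /\ tiedH f g)).
- exact: tame_subgroup.
- by move=> f /rist_Hor_tied [g tg t]; exists g.
- by move=> g tg; have [f rf t] := tied_rist_Hor tg; exists f.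
- by move=> f g g' [tg t] [tg' t']; exact: tiedH_fun t t'.
- by move=> f f' g tg [_ t] [_ t']; exact: tiedH_inj t t'.
- move=> f f' g g' tg tg' [_ t] [_ t']; split; last exact: tiedH_comp.
  exact: (@tame_comp itv).
- by move=> f g tg [_ t]; split; [exact: tame_homeoV|exact: tiedH_inv].
Qed.

End Forward.

(** A bijection of the streams that respects the gluing and replaces prefixes induces
    a homeomorphism. *)
Lemma map_homeo (S : presentation) (phi psi : (nat -> alph S) -> nat -> alph S) :
  let vs := vstream (@okl S) (@nxt S) in
  let Q := @point_of S in
  (forall u, vs (clr0 S) u -> vs (clr0 S) (phi u)) ->
  (forall u, vs (clr0 S) u -> vs (clr0 S) (psi u)) ->
  cancel phi psi -> cancel psi phi ->
  (forall u v, Q u = Q v -> Q (phi u) = Q (phi v)) ->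
  (forall u v, Q u = Q v -> Q (psi u) = Q (psi v)) ->
  (exists n, forall p, vword (@okl S) (@nxt S) (clr0 S) p -> size p = n ->
    exists q, [/\ vword (@okl S) (@nxt S) (clr0 S) q,
      endc (@nxt S) (clr0 S) p = endc (@nxt S) (clr0 S) q &
      forall u, phi (p +++ u) = q +++ u]) ->
  exists2 h : homeo (space S), tame h & forall u, vs (clr0 S) u -> h (Q u) = Q (phi u).
Proof.
move=> vs Q vphi vpsi phiK psiK cphi cpsi [n h].
pose rel x y := exists u, [/\ vs (clr0 S) u, x = Q u & y = Q (phi u)].
have [|||||g tg hg] := @rel_homeo S rel.
- by move=> x; have [u vu <-] := @point_surj S x; exists (Q (phi u)), u.
- move=> y; have [u vu <-] := @point_surj S y; exists (Q (psi u)), (psi u).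
  by rewrite psiK; split=> //; exact: vpsi.
- by move=> x y y' [u [vu -> ->]] [v [vv e ->]]; exact: cphi.
- by move=> x x' y [u [vu -> ->]] [v [vv -> /cpsi]]; rewrite !phiK.
- exists n => p vp sp; have [q [vq eq hq]] := h p vp sp; exists q; split=> // u vu.
  by exists (p +++ u); rewrite hq; split=> //; apply/vstream_sapp.
exists g => // u vu; have [v [vv e e']] := hg (Q u).
by rewrite [LHS]e' -(cphi _ _ e).
Qed.

(** * Maps of the interval and of the circle given by tables *)

(** The standard generator of [F], which maps the dyadic intervals 00, 01, 1 onto
    0, 10, 11; [slide1] is its copy on the right half of [0, 1]. *)
Definition slide (w : nat -> bool) : nat -> bool :=
  if w 0 then true ::: w
  else if w 1 then true ::: false ::: sdrop 2 w else sdrop 1 w.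
Definition unslide (w : nat -> bool) : nat -> bool :=
  if w 0 then (if w 1 then sdrop 1 w else false ::: true ::: sdrop 2 w)
  else false ::: w.
Definition slide1 (w : nat -> bool) : nat -> bool :=
  if w 0 then true ::: slide (sdrop 1 w) else w.
Definition unslide1 (w : nat -> bool) : nat -> bool :=
  if w 0 then true ::: unslide (sdrop 1 w) else w.

Lemma slideK : cancel slide unslide.
Proof.
by move=> w; rewrite (scons_eta w) (scons_eta (sdrop 1 w)); case: (w 0); case: (sdrop 1 w 0).
Qed.

Lemma unslideK : cancel unslide slide.
Proof.
by move=> w; rewrite (scons_eta w) (scons_eta (sdrop 1 w)); case: (w 0); case: (sdrop 1 w 0).
Qed.

Lemma slide1K : cancel slide1 unslide1.
Proof.
by move=> w; rewrite (scons_eta w); case: (w 0) => //; rewrite /slide1 /unslide1 /= slideK.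
Qed.

Lemma unslide1K : cancel unslide1 slide1.
Proof.
by move=> w; rewrite (scons_eta w); case: (w 0) => //; rewrite /slide1 /unslide1 /= unslideK.
Qed.

(** The maps that respect the double expansions of dyadic numbers. *)
Definition twin_map (phi : (nat -> bool) -> nat -> bool) := forall p, exists p',
  phi (p +++ false ::: cst true) = p' +++ false ::: cst true /\
  phi (p +++ true ::: cst false) = p' +++ true ::: cst false.

Lemma twin_map_twins phi w v : twin_map phi -> twins w v -> twins (phi w) (phi v).
Proof.
move=> h [p H]; have [p' [e1 e2]] := h p; exists p'.
by case: H => -[-> ->]; rewrite e1 e2; [left|right].
Qed.

Lemma slide_twins : twin_map slide.
Proof.
case=> [|[] [|b p]]; first by exists [:: true].
- by exists [:: true; true].
- by exists [:: true, true, b & p].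
- by exists [::]; split=> //=; rewrite [in RHS]cstE.
- by case: b; [exists [:: true, false & p]|exists (false :: p)].
Qed.

Lemma unslide_twins : twin_map unslide.
Proof.
case=> [|[] [|b p]]; first by exists [:: false].
- by exists [::]; split=> //=; rewrite [in RHS]cstE.
- by case: b; [exists (true :: p)|exists [:: false, true & p]].
- by exists [:: false; false].
- by exists [:: false, false, b & p].
Qed.

Lemma slide1_twins : twin_map slide1.
Proof.
case=> [|[] p]; [by exists [::]; split=> //; apply: funext => -[|[|k]]| |by exists (false :: p)].
by have [p' [e1 e2]] := slide_twins p; exists (true :: p'); rewrite /slide1 /= e1 e2.
Qed.

Lemma unslide1_twins : twin_map unslide1.
Proof.
case=> [|[] p]; [by exists [::]; split=> //; apply: funext => -[|[|k]]| |by exists (false :: p)].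
by have [p' [e1 e2]] := unslide_twins p; exists (true :: p'); rewrite /unslide1 /= e1 e2.
Qed.

Lemma itv_homeo (R : realType) phi psi : cancel phi psi -> cancel psi phi ->
  twin_map phi -> twin_map psi ->
  (exists n, forall p, size p = n -> exists q, forall u, phi (p +++ u) = q +++ u) ->
  exists2 g : homeo (unit_itv R), tame (S := itv R) g & forall u, g (Qi R u) = Qi R (phi u).
Proof.
move=> phiK psiK tphi tpsi [n h].
have cong chi : twin_map chi -> forall u v, Qi R u = Qi R v -> Qi R (chi u) = Qi R (chi v).
  by move=> tf u v /Qi_eq [-> //|tw]; apply/Qi_eq; right; exact: twin_map_twins.
have [|||||||g tg hg] := @map_homeo (itv R) phi psi => //.
- by move=> u _; exact: vsb.
- by move=> u _; exact: vsb.
- exact: cong.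
- exact: cong.
- by exists n => p _ /h [q hq]; exists q; split=> //; [exact: vwb|exact: unit_eq].
by exists g => // u; apply: hg; exact: vsb.
Qed.

Lemma circ_homeo (R : realType) phi psi : cancel phi psi -> cancel psi phi ->
  (forall u v, ceq u v -> ceq (phi u) (phi v)) ->
  (forall u v, ceq u v -> ceq (psi u) (psi v)) ->
  (exists n, forall p, size p = n -> exists q, forall u, phi (p +++ u) = q +++ u) ->
  exists2 g : homeo (circle R), tame (S := circ R) g & forall u, g (Qc R u) = Qc R (phi u).
Proof.
move=> phiK psiK tphi tpsi [n h].
have [|||||||g tg hg] := @map_homeo (circ R) phi psi => //.
- by move=> u _; exact: vsb.
- by move=> u _; exact: vsb.
- by move=> u v /Qc_eq /tphi e; apply/Qc_eq.
- by move=> u v /Qc_eq /tpsi e; apply/Qc_eq.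
- by exists n => p _ /h [q hq]; exists q; split=> //; [exact: vwb|exact: unit_eq].
by exists g => // u; apply: hg; exact: vsb.
Qed.

(** * Generation *)

Implicit Types f g : homeo Airplane.

(** ** Singular cells *)

(** The symmetry of a blue cell exchanging its two ends. Cells are compared up to it,
    because an element of [rist_Hor] may reverse the blue cells of the horizon. *)
Definition flipl (a : letter) : letter :=
  match a with
  | b_minus => b_plus | b_plus => b_minus | bu => bd | bd => bu | a => a
  end.
Definition flipb (s : bool) (u : nat -> letter) : nat -> letter :=
  if s then flipl (u 0) ::: sdrop 1 u else u.
Definition flipw (s : bool) (p : word) : word :=
  if s then (if p is a :: p' then flipl a :: p' else p) else p.

Lemma fliplK : involutive flipl. Proof. by case. Qed.

Lemma flipbK s : involutive (flipb s).
Proof. by case: s => // u; rewrite /flipb /= fliplK [RHS]scons_eta. Qed.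

Lemma flipb_comp s t u : flipb t (flipb s u) = flipb (s (+) t) u.
Proof. by case: s; case: t => //; exact: flipbK. Qed.

Lemma flipb_scons s a u : flipb s (a ::: u) = (if s then flipl a else a) ::: u.
Proof. by case: s. Qed.

Lemma flipb_sapp s p u :
  flipb s (p +++ u) = flipw s p +++ flipb (s && (p == [::])) u.
Proof. by case: s => //; case: p. Qed.

Lemma flipw_size s p : size (flipw s p) = size p.
Proof. by case: s p => [] [|a p]. Qed.

Lemma vs_flip s u : vs Blue u -> vs Blue (flipb s u).
Proof.
case: s => //; rewrite {1}(scons_eta u) => /vstream_scons [oka vu].
apply/vstream_scons; split; first by case: (u 0) oka.
by case: (u 0) vu oka.
Qed.

(** The empty word counts as the blue cell of which the base graph is the expansion. *)
Definition blue (p : word) : Prop := vw Blue p /\ ec Blue p = Blue.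

Lemma blue_nil : blue [::]. Proof. by []. Qed.

Lemma blue_cat p r : blue p -> blue (p ++ r) <-> blue r.
Proof. by move=> [vp ep]; rewrite /blue vword_cat endc_cat vp ep. Qed.

Lemma blue_flip s r : blue r -> blue (flipw s r).
Proof. by case: s r => [] [|[] r] //; case. Qed.

Lemma blue_vs p u : blue p -> vs Blue (p +++ u) <-> vs Blue u.
Proof. by move=> [vp ep]; rewrite vstream_sapp ep; split=> [[]|]. Qed.

Lemma blue_prim_word i : blue (prim i).
Proof. by split; [exact: vw_prim|exact: ec_prim]. Qed.

Lemma blue_cell_prefix p q : blue p -> blue q ->
  (forall u, vs Blue u -> exists2 v, vs Blue v & P (p +++ u) = P (q +++ v)) ->
  exists r, p = q ++ r.
Proof.
move=> [vp ep] [vq eq] h; apply: (@cell_prefix air) => // u; rewrite [endc _ _ _]ep => vu.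
by have [v vv e] := h u vu; exists v => //; rewrite [endc _ _ _]eq.
Qed.

(** [f] moves the blue cell [p] canonically onto the blue cell [q], after a half
    turn if [s]. *)
Definition fcanon f p q s := [/\ blue p, blue q &
  forall u, vs Blue u -> f (P (p +++ u)) = P (q +++ flipb s u)].

Lemma fcanon_cat f p q s r : fcanon f p q s -> blue r ->
  fcanon f (p ++ r) (q ++ flipw s r) (s && (r == [::])).
Proof.
move=> [bp bq h] br; split; [exact/blue_cat|apply/blue_cat => //; exact: blue_flip|].
move=> u vu; rewrite !sapp_cat h; last exact/blue_vs.
by rewrite flipb_sapp.
Qed.

Lemma fcanon_comp g f p q r s t : fcanon f p q s -> fcanon g q r t ->
  fcanon (g * f)%g p r (s (+) t).
Proof.
move=> [bp bq h] [_ br h']; split=> // u vu /=.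
by rewrite h // h'; [rewrite flipb_comp|exact: vs_flip].
Qed.

Lemma fcanon_inv f p q s : fcanon f p q s -> fcanon f^-1%g q p s.
Proof.
move=> [bp bq h]; split=> // u vu; apply: (can_inj (homeo_funK f)).
by rewrite /= homeo_invK h ?flipbK //; exact: vs_flip.
Qed.

Lemma fcanon_fun f p q q' s s' : fcanon f p q s -> fcanon f p q' s' -> q = q'.
Proof.
move=> [bp bq h] [_ bq' h'].
have inc t t' y y' : (forall u, vs Blue u -> P (y +++ flipb t u) = P (y' +++ flipb t' u)) ->
    blue y -> blue y' -> exists r, y = y' ++ r.
  move=> e by_ by'; apply: blue_cell_prefix => // u vu.
  exists (flipb t' (flipb t u)); first by do 2 apply: vs_flip.
  by rewrite -e; [rewrite flipbK|exact: vs_flip].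
have [|//|//|r er] := inc s s' q q'; first by move=> u vu; rewrite -h // -h'.
have [|//|//|r' er'] := inc s' s q' q; first by move=> u vu; rewrite -h // -h'.
move: (er'); rewrite er -catA => /(congr1 size); rewrite !size_cat => /eqP.
by rewrite -[X in X == _]addn0 eqn_add2l eq_sym addn_eq0 => /andP[/nilP -> _]; rewrite cats0.
Qed.

(** A homeomorphism is injective, so the cell would be the whole space. *)
Lemma fcanon_whole f p s : fcanon f p [::] s -> p = [::].
Proof.
move=> [bp _ h]; have [|r] := @blue_cell_prefix [::] p blue_nil bp; last by case: p {bp h}.
move=> u vu; have [v vv ev] := P_surj (f (P u)); exists (flipb s v); first exact: vs_flip.
by apply: (can_inj (homeo_funK f)); rewrite h ?flipbK //; exact: vs_flip.
Qed.

Definition regular f p := exists q s, fcanon f p q s.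

Lemma regular_cat f p r : regular f p -> blue r -> regular f (p ++ r).
Proof. by move=> [q [s h]] br; do 2 eexists; exact: fcanon_cat h br. Qed.

Definition singular f p := [/\ p != [::], blue p & ~ regular f p].

(** [f] has at most [k] singular cells. *)
Definition cplx f k := exists2 s : seq word, size s <= k & forall p, singular f p -> p \in s.

(** Long cells are moved canonically, so the singular ones have bounded length. *)
Lemma cplx_exists f : TA f -> exists k, cplx f k.
Proof.
move=> /TA_tame /tame_nonempty [n h].
exists (size (flatten [seq words air m | m <- iota 0 n])).
exists (flatten [seq words air m | m <- iota 0 n]) => // p [pn [vp ep] nr].
apply/flattenP; exists (words air (size p)); last exact: (@wordsP air).
apply/map_f; rewrite mem_iota add0n /= ltnNge; apply/negP => np; apply: nr.
have [_ [q qn]] := h p vp np; move=> /acanonP; rewrite ep => -[vq eq hq].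
by exists q, false.
Qed.

(** A regular cell of [f] has a regular image for the inverse of [f], hence for [g]. *)
Lemma singular_left g f p : (forall q, singular g q -> singular f^-1%g q) ->
  singular (g * f)%g p -> singular f p.
Proof.
move=> gf [pn bp nr]; split=> // -[q [s h]].
have qn : q != [::] by apply: contraNneq pn => e; rewrite e in h; rewrite (fcanon_whole h).
have [[r [t h']]|nq] := pselect (regular g q).
  by apply: nr; exists r, (s (+) t); exact: fcanon_comp h h'.
have [|_ _] := gf q; first by split=> //; have [] := h.
by apply; exists p, s; exact: fcanon_inv.
Qed.

Lemma cplx_left g f k : (forall q, singular g q -> singular f^-1%g q) ->
  cplx f k -> cplx (g * f)%g k.
Proof. by move=> gf [s sk h]; exists s => // p /(singular_left gf) /h. Qed.

(** Composition on the right trades the singular cells of [g] for those of its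
    inverse, and permutes the others. *)
Lemma cplx_right g f k (A B : seq word) : uniq A ->
  (forall q, q \in A -> singular g q) -> (forall q, q \in A -> singular f q) ->
  (forall q, singular g^-1%g q -> q \in B) -> cplx f k ->
  exists2 s : seq word, size A + size s <= k &
    forall p, singular (f * g^-1)%g p -> p \in B ++ s.
Proof.
move=> uA gA Af gB [s sk h].
pose m q := if pselect (regular g q) is left H then projT1 (cid H) else [::].
exists [seq m q | q <- s & q \notin A].
  rewrite size_map (leq_trans _ sk) // -(count_predC (mem A) s) size_filter leq_add2r.
  rewrite -size_filter; apply: uniq_leq_size => // q qA.
  by rewrite mem_filter; apply/andP; split=> //; apply: h; exact: Af.
move=> p sp; rewrite mem_cat; have [pB|pB] := boolP (p \in B); first by [].
rewrite orFb; have [pn bp nr] := sp.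
have [[q [t hq]]|np] := pselect (regular g^-1%g p); last first.
  by case/negP: pB; apply: gB; split.
have qn : q != [::] by apply: contraNneq pn => e; rewrite e in hq; rewrite (fcanon_whole hq).
have hg : fcanon g q p t by have := fcanon_inv hq; rewrite invgK.
have bq : blue q by case: hg.
apply/mapP; exists q; last first.
  rewrite /m; case: pselect => [H|[]]; last by exists p, t.
  case: cid => p' [t' /= h']; exact: fcanon_fun hg h'.
rewrite mem_filter; apply/andP; split.
  by apply/negP => /gA [_ _]; apply; exists p, t.
apply: h; split=> // -[r [t' h']]; apply: nr; exists r, (t (+) t'); exact: fcanon_comp hq h'.
Qed.

Lemma subgroupP (G : groupType) (H : set G) : subgroup H <->
  [/\ H 1%g, forall x y, H x -> H y -> H (x * y)%g & forall x, H x -> H x^-1%g].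
Proof.
split=> [[h1 hD]|[h1 hM hV]]; last first.
  by split=> [|x y]; rewrite !inE // => hx hy; apply: hM => //; exact: hV.
have hV x : H x -> H x^-1%g.
  move=> hx; have : (1 * x^-1)%g \in H by apply: hD; [exact: h1|exact/mem_set].
  by rewrite mul1g inE.
split=> //; first by rewrite inE in h1.
move=> x y hx /hV hy; have : (x * (y^-1)^-1)%g \in H by apply: hD; exact/mem_set.
by rewrite invgK inE.
Qed.

(** ** Moving the primary cells *)

(** The half turn of the circle. *)
Definition turn (w : nat -> bool) : nat -> bool := ~~ w 0 ::: sdrop 1 w.

Lemma turnK : involutive turn.
Proof. by move=> w; rewrite /turn /= negbK [RHS]scons_eta. Qed.

Lemma turn_ceq u v : ceq u v -> ceq (turn u) (turn v).
Proof.
have tc b : turn (cst b) = ~~ b ::: cst b by [].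
case=> [->|[|[[-> ->]|[-> ->]]]]; first by left.
- move=> [[|b p]]; last first.
    by move=> [[-> ->]|[-> ->]]; right; left; exists (~~ b :: p); [left|right].
  have e (b : bool) : turn (b ::: cst (~~ b)) = cst (~~ b) by rewrite /turn [RHS]cstE.
  by move=> [[-> ->]|[-> ->]]; right; right; [right|left];
    rewrite /= (e true) (e false).
- by right; left; exists [::]; right; rewrite !tc.
- by right; left; exists [::]; left; rewrite !tc.
Qed.

Lemma slide_cst b : slide (cst b) = cst b.
Proof. by case: b; apply: funext => -[|k]. Qed.

Lemma unslide_cst b : unslide (cst b) = cst b.
Proof. by rewrite -[in LHS](slide_cst b) slideK. Qed.

Section Moves.
Variable R : realType.

Definition conn i j := exists2 t, rist_C0 t & fcanon t (prim i) (prim j) false.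

Lemma tied_conn (g : homeo (circle R)) i j : tame (S := circ R) g -> g (Qc R (vtx i)) = Qc R (vtx j) -> conn i j.
Proof.
move=> tg e; have [f rf [_ b]] := tied_rist_C0 tg; exists f => //.
by split; [exact: blue_prim_word|exact: blue_prim_word|move=> u vu; exact: b].
Qed.

Lemma rist_C0_subgroup : subgroup rist_C0.
Proof. by have [] := rist_C0_iso R. Qed.

Lemma conn_trans i j k : conn i j -> conn j k -> conn i k.
Proof.
move=> [t rt ct] [t' rt' ct']; have [_ hM _] := (subgroupP _).1 rist_C0_subgroup.
by exists (t' * t)%g; [exact: hM|exact: fcanon_comp ct ct'].
Qed.

Lemma turn_conn i j : turn (vtx i) = vtx j -> conn i j.
Proof.
move=> e; have [|g tg hg] := @circ_homeo R turn turn turnK turnK turn_ceq turn_ceq.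
  by exists 1 => -[|b [|c p]] // _; exists [:: ~~ b].
by apply: tied_conn tg _; rewrite hg e.
Qed.

Lemma slide_conn i j : slide (vtx i) = vtx j -> conn i j.
Proof.
have ce phi : twin_map phi -> (forall b, phi (cst b) = cst b) ->
    forall u v, ceq u v -> ceq (phi u) (phi v).
  move=> tp pc u v [->|[tw|[[-> ->]|[-> ->]]]]; first by left.
  - by right; left; exact: twin_map_twins.
  - by rewrite !pc; right; right; left.
  - by rewrite !pc; right; right; right.
move=> e; have [|g tg hg] := @circ_homeo R slide unslide slideK unslideK
    (ce _ slide_twins slide_cst) (ce _ unslide_twins unslide_cst).
  by exists 2 => -[|[] [|[] [|? ?]]] // _;
    [exists [:: true; true; true]|exists [:: true; true; false]
    |exists [:: true; false]|exists [:: false]].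
by apply: tied_conn tg _; rewrite hg e.
Qed.

(** The turn and the slide bring every dyadic point of the circle to [1/2]. *)
Lemma conn_plus i : conn i (Some [::]).
Proof.
have half : conn (Some [::]) (Some [::]).
  by apply: (conn_trans (j := None)); apply: turn_conn => //; rewrite [RHS]cstE.
suff H n z : size z <= n -> conn (Some (false :: z)) (Some [::]).
  case: i => [[|[] z]|]; [exact: half| |exact: H (leqnn _)|].
    by apply: (conn_trans (j := Some (false :: z))); [exact: turn_conn|exact: H (leqnn _)].
  by apply: turn_conn; rewrite /turn.
elim: n z => [|n IH] [|[] z] //= sz.
- by apply: slide_conn; rewrite /= [in RHS]cstE.
- by apply: slide_conn; rewrite /= [in RHS]cstE.
- apply: (conn_trans (j := Some [:: true, false & z])); first exact: slide_conn.
  apply: (conn_trans (j := Some [:: false, false & z])); first exact: turn_conn.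
  by apply: (conn_trans (j := Some (false :: z))); [exact: slide_conn|exact: IH].
- by apply: (conn_trans (j := Some (false :: z))); [exact: slide_conn|exact: IH].
Qed.

End Moves.

(** ** Two elements of the rigid stabilizer of the horizon *)

Lemma flipl_hl o b : flipl (hl o b) = hl (~~ o) b.
Proof. by case: o b => -[]. Qed.

Lemma flipl_ab o c : flipl (ab o c) = ab (~~ o) c.
Proof. by case: o c => -[]. Qed.

Lemma flip_hw o o' w : flipb (o != o') (hw o w) = hw o' w.
Proof.
rewrite (scons_eta w) !hw_scons flipb_scons; have [->|ne] := eqVneq o o' => //.
by rewrite /= flipl_hl; have -> : o' = ~~ o by case: (o) (o') ne => -[].
Qed.

Lemma flip_hww_ab o o' e c u : flipb (o != o') (hww o e +++ ab (last o e) c ::: u) =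
  hww o' e +++ ab (last o' e) c ::: u.
Proof.
have [->|ne] := eqVneq o o' => //; have -> : o' = ~~ o by case: (o) (o') ne => -[].
by case: e => [|b e]; rewrite /flipb /= ?flipl_hl ?flipl_ab.
Qed.

Lemma blue_horw y : blue (horw y).
Proof. by split; [exact: vw_hww|exact: ec_hww]. Qed.

Section Lifts.
Variable R : realType.
Local Notation Qi := (@Qi R).
Variables (X : homeo Airplane) (g : homeo (unit_itv R)).
Hypothesis tg : tame (S := itv R) g.
Hypothesis tX : tiedH X g.

(** The half turn accounts for the fact that a blue cell of the horizon points in the
    direction of its last digit. *)
Lemma fcanon_hor y y' : bcanon (R := R) id g y y' ->
  fcanon X (horw y) (horw y') (last true y != last true y').
Proof.
move=> c; have [a b] := tX; split; try exact: blue_horw.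
move=> u /(hor_split (last true y)) [[w ->]|[e [d [u' [-> vu']]]]].
  rewrite flip_hw -!hw_sapp; apply: a; by exists y, y', w.
rewrite flip_hww_ab.
have E t : horw t +++ hww (last true t) e +++ ab (last (last true t) e) d ::: u' =
    red (t ++ e) d +++ u'.
  by rewrite sapp_rcons hww_cat last_cat sapp_cat.
by rewrite !E; apply: b => //; rewrite !sapp_cat; exact: c.
Qed.

Lemma red_regular y c r : blue (red y c ++ r) -> regular X (red y c ++ r).
Proof.
move=> br; have [y' e] := tame_mid y tg; exists (red y' c ++ r), false.
have vr : vw Red r /\ ec Red r = Blue.
  by case: br; rewrite vword_cat endc_cat vw_ab ec_ab.
split=> // [|u vu]; first by rewrite /blue vword_cat endc_cat vw_ab ec_ab.
rewrite !sapp_cat; apply: (tX.2 _ _ e); apply/vstream_sapp.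
by case: vr => -> ->.
Qed.

(** Blue cells off the horizon lie in a red cell of a component lying on it. *)
Lemma hor_regular q : blue q ->
  (forall y, q = horw y -> exists y', bcanon (R := R) id g y y') -> regular X q.
Proof.
move=> bq h; have [[y ey]|[y [c [r er]]]] := word_hor_split true bq.1.
  by rewrite ey; have [y' c] := h y ey; exists (horw y'), (last true y != last true y'); exact: fcanon_hor.
by rewrite er -cat_rcons in bq *; exact: red_regular.
Qed.

End Lifts.

Notation p_minus := [:: b_plus; b_minus].

Section Elements.
Variable R : realType.

(** The lift of [unslide] moves the central component into the left half and the component
    at the middle of the right half to the center. *)
Lemma unslide_element : exists x, [/\ rist_Hor x,
  [/\ fcanon x [:: b_plus; b_plus] [:: b_plus] false,
      fcanon x p_minus [:: b_minus; b_minus] true &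
      fcanon x [:: b_minus] [:: b_minus; b_plus] false],
  (forall b u, vs Red u -> x (P ([:: b_plus; cl b] +++ u)) = P ([:: cl b] +++ u)) /\
  (forall b u, vs Red u -> x (P ([:: cl b] +++ u)) = P ([:: b_minus; cl (~~ b)] +++ u)),
  (forall q, singular x q -> q = [:: b_plus]) &
  (forall q, singular x^-1%g q -> q = [:: b_minus])].
Proof.
have [|g tg hg] := itv_homeo R unslideK slideK unslide_twins slide_twins.
  by exists 2 => -[|[] [|[] [|? ?]]] // _;
    [exists [:: true]|exists [:: false; true]|exists [:: false; false; true]
    |exists [:: false; false; false]].
have hgV u : (g^-1)%g (Qi R u) = Qi R (slide u).
  by apply: (can_inj (homeo_funK g)); rewrite /= homeo_invK hg slideK.
have tgV := tame_homeoV tg.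
have [x rx tx] := tied_rist_Hor tg; have txV := tiedH_inv tx.
have can y y' : (forall u, unslide (y +++ u) = y' +++ u) -> bcanon (R := R) id g y y'.
  by move=> h u; rewrite -h; exact: hg.
have canV y y' : (forall u, slide (y +++ u) = y' +++ u) -> bcanon (R := R) id g^-1%g y y'.
  by move=> h u; rewrite -h; exact: hgV.
exists x; split=> //.
- split.
  + by apply: (fcanon_hor tx (y := [:: true; true]) (y' := [:: true])); exact: can.
  + by apply: (fcanon_hor tx (y := [:: true; false]) (y' := [:: false; true])); exact: can.
  + by apply: (fcanon_hor tx (y := [:: false]) (y' := [:: false; false])); exact: can.
- have [_ b] := tx; split=> d u vu.
    have := b [:: true] [::]; rewrite /= !hg => /(_ erefl (~~ d) u vu).
    by case: d.
  have := b [::] [:: false]; rewrite /= !hg => /(_ erefl (~~ d) u vu).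
  by case: d.
- move=> q [qn bq]; apply: contra_notP => nq; apply: (hor_regular tg tx bq).
  move=> [|[] [|[] y]] e; rewrite e // in qn nq *.
  + by exists (true :: y); exact: can.
  + by exists [:: false, true & y]; exact: can.
  + by exists [:: false; false]; exact: can.
  + by exists [:: false, false, true & y]; exact: can.
  + by exists [:: false, false, false & y]; exact: can.
- move=> q [qn bq]; apply: contra_notP => nq; apply: (hor_regular tgV txV bq).
  move=> [|[] [|[] y]] e; rewrite e // in qn nq *.
  + by exists [:: true; true]; exact: canV.
  + by exists [:: true, true, true & y]; exact: canV.
  + by exists [:: true, true, false & y]; exact: canV.
  + by exists [:: true, false & y]; exact: canV.
  + by exists [:: false & y]; exact: canV.
Qed.

(** The lift of [slide1], which is the identity outside the right half. *)
Lemma slide1_element : exists z, [/\ rist_Hor z,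
  [/\ fcanon z [:: b_plus; b_minus; b_plus] p_minus false,
      fcanon z [:: b_plus; b_minus; b_minus] [:: b_plus; b_plus; b_minus] true &
      fcanon z [:: b_minus] [:: b_minus] false],
  (forall b u, vs Red u -> z (P (p_minus +++ cl b ::: u)) = P ([:: b_plus; cl (~~ b)] +++ u)) /\
  (forall b u, vs Red u -> z (P ([:: cl b] +++ u)) = P ([:: cl b] +++ u)),
  (forall q, singular z q -> q = [:: b_plus] \/ q = p_minus) &
  (forall q, singular z^-1%g q -> q = [:: b_plus] \/ q = [:: b_plus; b_plus])].
Proof.
have [|g tg hg] := itv_homeo R slide1K unslide1K slide1_twins unslide1_twins.
  by exists 3 => -[|[] [|[] [|[] [|? ?]]]] // _; do 1?[
    by exists [:: true; true; true; true]|by exists [:: true; true; true; false]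
    |by exists [:: true; true; false]|by exists [:: true; false]
    |by exists [:: false; true; true]|by exists [:: false; true; false]
    |by exists [:: false; false; true]|by exists [:: false; false; false]].
have hgV u : (g^-1)%g (Qi R u) = Qi R (unslide1 u).
  by apply: (can_inj (homeo_funK g)); rewrite /= homeo_invK hg unslide1K.
have tgV := tame_homeoV tg.
have [z rz tz] := tied_rist_Hor tg; have tzV := tiedH_inv tz.
have can y y' : (forall u, slide1 (y +++ u) = y' +++ u) -> bcanon (R := R) id g y y'.
  by move=> h u; rewrite -h; exact: hg.
have canV y y' : (forall u, unslide1 (y +++ u) = y' +++ u) -> bcanon (R := R) id g^-1%g y y'.
  by move=> h u; rewrite -h; exact: hgV.
exists z; split=> //.
- split.
  + by apply: (fcanon_hor tz (y := [:: true; false; false]) (y' := [:: true; false])); exact: can.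
  + by apply: (fcanon_hor tz (y := [:: true; false; true]) (y' := [:: true; true; false])); exact: can.
  + by apply: (fcanon_hor tz (y := [:: false]) (y' := [:: false])); exact: can.
- have [_ b] := tz; split=> d u vu.
    have e : slide1 (mid [:: true; false]) = mid [:: true] by rewrite /= [in RHS]cstE.
    have := b [:: true; false] [:: true]; rewrite hg e => /(_ erefl d u vu).
    by case: d.
  have := b [::] [::]; rewrite /= !hg => /(_ erefl (~~ d) u vu).
  by case: d.
- move=> q [qn bq]; apply: contra_notP => nq; apply: (hor_regular tg tz bq).
  have {}nq : q <> [:: b_plus] /\ q <> p_minus by split=> h; apply: nq; [left|right].
  case: nq => nq1 nq2.
  move=> [|[] [|[] [|[] y]]] e; rewrite e // in qn nq1 nq2 *.
  + by exists [:: true; true; true]; exact: can.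
  + by exists [:: true, true, true, true & y]; exact: can.
  + by exists [:: true, true, true, false & y]; exact: can.
  + by exists [:: true, true, false & y]; exact: can.
  + by exists [:: true, false & y]; exact: can.
  + by exists [:: false]; exact: can.
  + by exists [:: false; true]; exact: can.
  + by exists [:: false, true, true & y]; exact: can.
  + by exists [:: false, true, false & y]; exact: can.
  + by exists [:: false; false]; exact: can.
  + by exists [:: false, false, true & y]; exact: can.
  + by exists [:: false, false, false & y]; exact: can.
- move=> q [qn bq]; apply: contra_notP => nq; apply: (hor_regular tgV tzV bq).
  have {}nq : q <> [:: b_plus] /\ q <> [:: b_plus; b_plus] by split=> h; apply: nq; [left|right].
  case: nq => nq1 nq2.
  move=> [|[] [|[] [|[] y]]] e; rewrite e // in qn nq1 nq2 *.
  + by exists [:: true, true & y]; exact: canV.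
  + by exists [:: true, false, true & y]; exact: canV.
  + by exists [:: true; false; false]; exact: canV.
  + by exists [:: true, false, false, true & y]; exact: canV.
  + by exists [:: true, false, false, false & y]; exact: canV.
  + by exists [:: false]; exact: canV.
  + by exists [:: false; true]; exact: canV.
  + by exists [:: false, true, true & y]; exact: canV.
  + by exists [:: false, true, false & y]; exact: canV.
  + by exists [:: false; false]; exact: canV.
  + by exists [:: false, false, true & y]; exact: canV.
  + by exists [:: false, false, false & y]; exact: canV.
Qed.

End Elements.

(** ** Images of the central component *)

Lemma cw_not_end q w c s : q +++ cw w <> end_tail c s.
Proof.
move=> /(congr1 (fun t => t (size q))); rewrite sappE ltnn subnn /cw /=.
by case: c; case: s; case: (w 0); case: (size q).
Qed.

(** If [q] and [q'] differed, below their last common edge one of the words would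
    lead to a junction, with a tail free of the letters [bu] and [bd]. *)
Lemma glue_comp q q' w v : blue q -> blue q' -> glue (q +++ cw w) (q' +++ cw v) -> q = q'.
Proof.
have nil r x y : blue r -> glue (cw x) (r +++ cw y) -> r = [::].
  move=> br; have [//|rn] := eqVneq r [::].
  have [i [r' ->]] := blue_prim br.1 br.2 rn; rewrite sapp_cat => /glue_cw_prim [e _].
  by case: (@cw_not_end r' y Blue true).
have key c q0 q1 : vword okc lcol c q0 -> vword okc lcol c q1 -> endc lcol c q0 = Blue ->
    endc lcol c q1 = Blue -> glue (q0 +++ cw w) (q1 +++ cw v) -> q0 = q1.
  elim: q0 c q1 => [|a q0 IH] c [|a' q1] //=.
  - move=> _ h e e' gl; rewrite e in h e'; apply/esym.
    exact: (@nil (a' :: q1) w v (conj h e') gl).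
  - move=> h _ e e' gl; rewrite e' in h e.
    exact: (@nil (a :: q0) v w (conj h e) (glue_sym gl)).
  move=> /andP[_ h] /andP[_ h'] e e'; have [aa|aa] := eqVneq a a'.
    rewrite -aa in h' e' * => /glue_scons_inv gl; congr (_ :: _).
    exact: IH h h' e e' gl.
  by move=> /(glue_scons_neq aa) [j [s [t [_ _ /cw_not_end []]]]].
by move=> [h e] [h' e']; exact: key h h' e e'.
Qed.

Lemma P_comp q q' w v : blue q -> blue q' -> P (q +++ cw w) = P (q' +++ cw v) -> q = q'.
Proof.
move=> bq bq' /P_glue e; apply: (glue_comp bq bq' (w := w) (v := v)).
by apply: e; apply/blue_vs => //; exact: vs_cw.
Qed.

Lemma red_comp_split q : vw Blue q -> ec Blue q = Red ->
  exists q0 b y, q = q0 ++ cl b :: map rl y /\ blue q0.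
Proof.
elim/last_ind: q => // q a IH; rewrite vword_rcons endc_rcons => /andP[vq oka] ea.
case E : (ec Blue q) oka ea => oka ea.
  have [b ->] : exists b, a = rl b by case: a oka ea => // _ _; [exists false|exists true].
  have [q0 [d [y [-> bq]]]] := IH vq E; exists q0, d, (rcons y b); split=> //.
  by rewrite map_rcons rcons_cat.
have [b ->] : exists b, a = cl b by case: a oka ea => // _ _; [exists true|exists false].
by exists q, b, [::]; rewrite cats1.
Qed.

(** [f] maps the boundary of the component of [p] into that of the component
    of [q]. *)
Definition comp_map f p q := [/\ blue p, blue q &
  forall w, exists w', f (P (p +++ cw w)) = P (q +++ cw w')].

Lemma comp_map_comp g f p q r : comp_map f p q -> comp_map g q r -> comp_map (g * f)%g p r.
Proof.
move=> [bp bq h] [_ br h']; split=> // w.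
have [w' e] := h w; have [w2 e'] := h' w'.
by exists w2; rewrite /= e e'.
Qed.

Lemma comp_map_fun f p q q' : comp_map f p q -> comp_map f p q' -> q = q'.
Proof.
move=> [bp bq h] [_ bq' h']; have [w e] := h (cst true); have [w' e'] := h' (cst true).
by apply: (P_comp bq bq' (w := w) (v := w')); rewrite -e.
Qed.

Lemma fcanon_comp_map f p q s r : fcanon f p q s -> blue r ->
  comp_map f (p ++ r) (q ++ flipw s r).
Proof.
move=> h br; have [bp bq hf] := fcanon_cat h br; split=> // w.
rewrite hf; last exact: vs_cw.
exists (if s && (r == [::]) then ~~ w 0 ::: sdrop 1 w else w).
by case: ifP => //; rewrite /flipb /cw /=; case: (w 0).
Qed.

Lemma twin_cw z : P (cw (z +++ false ::: cst true)) = P (cw (z +++ true ::: cst false)).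
Proof.
apply/P_glue; [exact: vs_cw|exact: vs_cw|].
by apply/glue_cw; right; left; exists z; left.
Qed.

(** A deep red cell of the central circle is moved into the boundary of a single
    component; two halves of a cell share a point, so they meet the same component. *)
Lemma comp_map_exists f : TA f -> exists q, comp_map f [::] q.
Proof.
move=> /TA_tame /tame_nonempty [n h].
pose into z q := blue q /\ forall w, exists w', f (P (cw (z +++ w))) = P (q +++ cw w').
suff H m z : n.+1 <= size z + m -> exists q, into z q.
  by have [|q [bq hq]] := H n.+1 [::]; [rewrite leq_addl|exists q; split].
elim: m z => [|m IH] z.
  rewrite addn0; case: z => // b z nz.
  have [|_ [q qn /acanonP]] := h (cww (b :: z)) (vw_cww _); first by rewrite /= size_map ltnW.
  rewrite ec_cww => -[vq eq hq]; have [q0 [d [y [eq0 bq]]]] := red_comp_split vq (esym eq).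
  exists q0; split=> // w; exists ((d :: y) +++ w).
  by rewrite cw_sapp hq ?eq0 ?sapp_cat ?cw_sapp //; exact: vs_rw.
move=> nz; have [|q0 [b0 h0]] := IH (rcons z false); first by rewrite size_rcons addSnnS.
have [|q1 [b1 h1]] := IH (rcons z true); first by rewrite size_rcons addSnnS.
have [w0 e0] := h0 (cst true); have [w1 e1] := h1 (cst false).
have e : q0 = q1.
  by apply: (P_comp b0 b1 (w := w0) (v := w1)); rewrite -e0 -e1 !sapp_rcons twin_cw.
exists q0; split=> // w; rewrite (scons_eta w); case: (w 0).
  by have [w' e'] := h1 (sdrop 1 w); exists w'; rewrite e -e' sapp_rcons.
by have [w' e'] := h0 (sdrop 1 w); exists w'; rewrite -e' sapp_rcons.
Qed.

(** If the inverse moved [p] canonically, it would send the image of the central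
    component into a proper cell, and not back to the center. *)
Lemma prefix_singular f p r : comp_map f [::] (p ++ r) -> p != [::] -> blue p ->
  singular f^-1%g p.
Proof.
move=> cf pn bp; split=> // -[q [s h]].
have br : blue r by case: cf => _ /(blue_cat _ bp).
have c := comp_map_comp cf (fcanon_comp_map h br).
have c1 : comp_map (f^-1 * f)%g [::] [::].
  by split=> // w; exists w; rewrite /= homeo_funK.
have := comp_map_fun c1 c => /esym e.
have q0 : q = [::] by case: (q) e.
by rewrite q0 in h; rewrite (fcanon_whole h) in pn.
Qed.

(** ** Bringing the central component back *)

Lemma red_comp_map g p p' b b' r : blue p -> blue p' -> blue (cl b :: r) ->
  (forall u, vs Red u -> g (P (p +++ cl b ::: u)) = P (p' +++ cl b' ::: u)) ->
  comp_map g (p ++ cl b :: r) (p' ++ cl b' :: r).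
Proof.
move=> bp bp' br h; have br' : blue (cl b' :: r) by case: b b' br {h} => -[].
split; [exact/blue_cat|exact/blue_cat|move=> w; exists w; rewrite !sapp_cat; apply: h].
have [vr er] : vw Red r /\ ec Red r = Blue.
  by case: br => {br'} v e; case: b v e => /andP[_].
by apply/vstream_sapp; rewrite er; split=> //; exact: vs_cw.
Qed.

Lemma center_comp_map g p p' (d : bool) : blue p -> blue p' ->
  (forall b u, vs Red u -> g (P (p +++ cl b ::: u)) = P (p' +++ cl (d (+) b) ::: u)) ->
  comp_map g p p'.
Proof.
move=> bp bp' h; split=> // w; exists ((d (+) w 0) ::: sdrop 1 w).
by rewrite cw_scons -h //; exact: vs_rw.
Qed.

(** Every proper blue cell lies in a primary one, which is moved canonically. *)
Lemma rist_C0_regular t p : realType -> rist_C0 t -> ~ singular t p.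
Proof.
move=> R rt [pn bp]; apply; have [i [r er]] := blue_prim bp.1 bp.2 pn.
rewrite er in bp *; apply: regular_cat; last by apply/(blue_cat r (blue_prim_word i)).
have [g tg [_ b]] := rist_C0_tied R rt; have [j e] := tame_vertex i tg.
exists (prim j), false; split; [exact: blue_prim_word|exact: blue_prim_word|].
by move=> u vu; exact: b.
Qed.

Section Centre.
Variable R : realType.
Variable M : set (homeo Airplane).
Hypothesis sM : subgroup M.
Hypothesis MC : rist_C0 `<=` M.
Hypothesis MH : rist_Hor `<=` M.

Let M1 : M 1%g. Proof. by have [] := (subgroupP _).1 sM. Qed.
Let MM f g : M f -> M g -> M (f * g)%g. 
Proof. by have [_ + _] := (subgroupP _).1 sM; apply. Qed.
(** By induction on the length of the address of the image of the central component. *)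
Lemma move_center f k q : cplx f k -> comp_map f [::] q ->
  exists g, [/\ M g, cplx (g * f)%g k & comp_map (g * f)%g [::] [::]].
Proof.
have [n qn] := ubnP (size q); elim: n q f qn => // n IH q f; rewrite ltnS => qn kf cf.
have step g h y y' : M g -> cplx h k -> comp_map h [::] y ->
    (forall p, singular g p -> singular h^-1%g p) -> comp_map g y y' -> size y' < n ->
    exists2 g', M g' & cplx (g' * (g * h))%g k /\ comp_map (g' * (g * h))%g [::] [::].
  move=> Mg kh ch sg cg sy; have [|||g' [Mg' kg' cg']] := IH y' (g * h)%g => //.
  - exact: cplx_left.
  - exact: comp_map_comp ch cg.
  by exists g'.
have [q0|qne] := eqVneq q [::].
  by exists 1%g; rewrite mul1g; split=> //; rewrite -{2}q0.
have [_ bq _] := cf; have [i [r er]] := blue_prim bq.1 bq.2 qne.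
have br : blue r by move: bq; rewrite er => /(blue_cat _ (blue_prim_word i)).
(* An element of [rist_C0] first moves the image into the right half. *)
have [t rt ct] := conn_plus R i.
have Mt := MC rt; pose h := (t * f)%g.
have kh : cplx h k by apply: cplx_left kf => p /(rist_C0_regular R rt).
have ch : comp_map h [::] (b_plus :: r).
  by rewrite er in cf; exact: comp_map_comp cf (fcanon_comp_map ct br).
have sr : size r < n.
  by move: qn; rewrite er size_cat; apply: leq_trans; case: (i) => [[|? ?]|]; rewrite ?size_rcons //= addSn ltnS leq_addl.
suff [g Mg [kg cg]] : exists2 g, M g & cplx (g * h)%g k /\ comp_map (g * h)%g [::] [::].
  by exists (g * t)%g; rewrite -mulgA; split=> //; exact: MM.
have [x [rx [x1 _ _] [xr1 _] sx _]] := unslide_element R.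
have [z [rz [z1 z2 _] [zr1 _] sz _]] := slide1_element R.
have Mx := MH rx; have Mz := MH rz.
have fin g y : M g -> comp_map h [::] y -> (forall p, singular g p -> singular h^-1%g p) ->
    forall y', comp_map g y y' -> size y' < n -> 
    exists2 g, M g & cplx (g * h)%g k /\ comp_map (g * h)%g [::] [::].
  move=> Mg cy sg y' cg sy; have [g' Mg' H] := step g h y y' Mg kh cy sg cg sy.
  by exists (g' * g)%g; [exact: MM|rewrite -mulgA].
have bplus : blue [:: b_plus] by [].
have sxh : forall p, singular x p -> singular h^-1%g p.
  by move=> p /sx ->; exact: (@prefix_singular h [:: b_plus] r).
(* [x] shortens every address in the right half except those that begin with
   [p_minus], which [z] shortens or moves away from [p_minus]. *)
case: r br er ch sr => [|a r] br er ch sr.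
  apply: (fin x _ Mx ch sxh [::] _ _) => //.
  by apply: (@center_comp_map x [:: b_plus] [::] false) => // b u vu; exact: xr1.
have redx b : a = cl b -> exists2 g, M g & cplx (g * h)%g k /\ comp_map (g * h)%g [::] [::].
  move=> ea; rewrite ea in br ch; apply: (fin x _ Mx ch sxh (cl b :: r)) => //.
  by apply: (@red_comp_map x [:: b_plus] [::]) => // u vu; exact: xr1.
case: a br er ch sr redx => br er ch sr redx; try by case: br.
- have szh : forall p, singular z p -> singular h^-1%g p.
    move=> p /sz [] ->; first exact: (@prefix_singular h [:: b_plus] (b_minus :: r)).
    exact: (@prefix_singular h p_minus r).
  have bm : blue p_minus by [].
  case: r br er ch sr {redx} => [|a r] br er ch sr.
    apply: (fin z _ Mz ch szh [:: b_plus] _ _) => //.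
    by apply: (@center_comp_map z p_minus [:: b_plus] true) => // b u vu; exact: zr1.
  have redz b : a = cl b -> exists2 g, M g & cplx (g * h)%g k /\ comp_map (g * h)%g [::] [::].
    move=> ea; rewrite ea in br ch; apply: (fin z _ Mz ch szh [:: b_plus, cl (~~ b) & r]) => //.
    by apply: (@red_comp_map z p_minus [:: b_plus]) => // u vu; exact: zr1.
  case: a br er ch sr redz => br er ch sr redz; try by case: br.
  + have c := fcanon_comp_map z2 (br : blue r).
    have k2 : cplx (z * h)%g k by exact: cplx_left.
    have c2 := comp_map_comp ch c.
    have [|||g Mg H] := step x (z * h)%g _ (b_plus :: b_minus :: flipw true r) Mx k2 c2.
    * by move=> p /sx ->; exact: (@prefix_singular _ [:: b_plus] _ c2).
    * by have := fcanon_comp_map x1 (blue_flip true (br : blue r) : blue (b_minus :: _)).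
    * by rewrite -[size _]/(size (flipw true r)).+2 flipw_size.
    by exists (g * x * z)%g; [apply: MM => //; exact: MM|rewrite -!mulgA].
  + apply: (fin z _ Mz ch szh (p_minus ++ r)) => //.
    exact: (fcanon_comp_map z1 (br : blue r)).
  + exact: redz true erefl.
  + exact: redz false erefl.
- apply: (fin x _ Mx ch sxh (b_plus :: r)) => //.
  exact: (fcanon_comp_map x1 (br : blue r)).
- exact: redx true erefl.
- exact: redx false erefl.
Qed.

End Centre.

(** ** Rearrangements fixing the central circle *)

Definition fixes_circle f := forall w, f (P (cw w)) = P (cw w).

Lemma fixes_circle_inv f : fixes_circle f -> fixes_circle f^-1%g.
Proof.
by move=> h w; apply: (can_inj (homeo_funK f)); rewrite /= homeo_invK h.
Qed.

Lemma TA_inv f : TA f -> TA f^-1%g.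
Proof. by have [_ _] := (subgroupP _).1 TA_subgroup; apply. Qed.

Lemma TA_mul f g : TA f -> TA g -> TA (f * g)%g.
Proof. by have [_ + _] := (subgroupP _).1 TA_subgroup; apply. Qed.

(** Siblings are linked by junctions through one of them, [bu] or [rs]. *)
Lemma sibling_junction c a : okc c a -> exists a0 j s t,
  [/\ okc c a0, role j a = Some s, role j a0 = Some t & a0 = (if c is Blue then bu else rs)].
Proof.
case: c; case: a => // _.
- by exists rs, Jm, false, true.
- by exists rs, Jm, true, true.
- by exists rs, Jm, true, true.
- by exists bu, Jx, true, false.
- by exists bu, Jy, true, true.
- by exists bu, Jx, false, false.
- by exists bu, Jx, true, false.
Qed.

(** The deep cells of a branch go to branches, two cells with a common point go to
    the same one, and the attaching point of the branch is fixed. *)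
Lemma branch_stable f i u : TA f -> fixes_circle f -> vs Blue u ->
  exists2 u', vs Blue u' & f (P (prim i +++ u)) = P (prim i +++ u').
Proof.
move=> /TA_tame /tame_nonempty [n h] fc.
pose into p j := forall v, vs (ec Blue p) v ->
  exists2 v', vs Blue v' & f (P (p +++ v)) = P (prim j +++ v').
have sib p a a' j s t k k' : vw Blue (rcons p a) -> vw Blue (rcons p a') ->
    role j a = Some s -> role j a' = Some t -> into (rcons p a) k -> into (rcons p a') k' ->
    k = k'.
  move=> va va' ja ja' ia ia'.
  have [v vv e] := ia _ (vs_end_tail _ s); have [v' vv' e'] := ia' _ (vs_end_tail _ t).
  have : P (prim k +++ v) = P (prim k' +++ v').
    rewrite -e -e'; congr (f _); rewrite !endc_rcons !sapp_rcons.
    apply: P_cong; rewrite -?sapp_rcons.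
    - by apply/vstream_sapp; split=> //; rewrite endc_rcons; exact: vs_end_tail.
    - by apply/vstream_sapp; split=> //; rewrite endc_rcons; exact: vs_end_tail.
    by rewrite !sapp_rcons; apply: glue_sapp; exact: junction_glue ja ja'.
  by move/P_glue => /(_ ((vs_prim _ _).2 vv) ((vs_prim _ _).2 vv')) /glue_prim [].
have H m r : n <= size (prim i ++ r) + m -> vw Blue (prim i ++ r) -> exists j, into (prim i ++ r) j.
  elim: m r => [|m IH] r.
    rewrite addn0 => np vp; have [_ [q qn /acanonP [vq eq hq]]] := h _ vp np.
    case: (word_circle_split vq qn) => [[b [z ez]]|[j [r' er]]]; last first.
      exists j => v vv; exists (r' +++ v); last by rewrite hq // er sapp_cat.
      by apply/(vs_prim j); rewrite -sapp_cat -er; apply/vstream_sapp; rewrite -eq.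
    have ep : ec Blue (prim i ++ r) = Red by rewrite eq ez ec_cww.
    have vv : vs Red (rw (cst false)) by exact: vs_rw.
    have := hq _ ; rewrite ep ez => /(_ _ vv); rewrite -cw_sapp -{1}(fc (_ +++ _)).
    move/(can_inj (homeo_funK f)); rewrite sapp_cat => /esym /P_glue.
    case/(_ (vs_cw _) _)/glue_cw_prim; first by rewrite -sapp_cat; apply/vstream_sapp; rewrite ep.
    move=> /(congr1 (fun t => t (size r))); rewrite sappE ltnn subnn.
    by case: (size r).
  move=> nm vp; have ch a : okc (ec Blue (prim i ++ r)) a -> exists j, into (rcons (prim i ++ r) a) j.
    move=> oka; rewrite rcons_cat; apply: IH; rewrite -?rcons_cat ?size_rcons ?addSnnS //.
    by rewrite vword_rcons vp.
  set p := prim i ++ r in ch vp *; set c := ec Blue p in ch.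
  pose a0 := if c is Blue then bu else rs.
  have ok0 : okc c a0 by rewrite /a0; case: (c).
  have [j0 i0] := ch _ ok0; exists j0 => v; rewrite -/c (scons_eta v) => /vstream_scons [oka vv].
  have [j ia] := ch _ oka; have [a1 [k [s [t [_ ja ja0 ea]]]]] := sibling_junction oka.
  have e : j = j0.
    rewrite ea in ja0; apply: sib ja ja0 ia i0; rewrite vword_rcons vp //.
  by have [|v' vv' e'] := ia (sdrop 1 v); [rewrite endc_rcons|exists v' => //; rewrite -e -e' sapp_rcons].
move=> vu; have [||j ij] := H n [::]; [exact: leq_addl|by rewrite cats0 vw_prim|].
rewrite cats0 /into ec_prim in ij.
suff e : j = i by rewrite e in ij; exact: ij.
have [v vv] := ij bt vs_bt; rewrite P_prim_bt fc -P_prim_bt => /P_glue.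
by case/(_ ((vs_prim _ _).2 vs_bt) ((vs_prim _ _).2 vv))/glue_prim.
Qed.

(** The action on the central circle is an element of [T], which is cancelled by its
    extension in [rist_C0]. *)
Lemma central_circle_fixed (R : realType) f : TA f -> comp_map f [::] [::] ->
  exists2 t, rist_C0 t & fixes_circle (t^-1 * f)%g.
Proof.
move=> Tf cf; have [q cq] := comp_map_exists (TA_inv Tf).
have q0 : q = [::].
  apply: (@comp_map_fun (f^-1 * f)%g [::]); first exact: comp_map_comp cf cq.
  by split=> // w; exists w; rewrite /= homeo_funK.
rewrite {q}q0 in cq; have [_ _ into] := cf; have [_ _ from] := cq.
have [|g tg hg] := circle_action R Tf into.
  move=> w'; have [w e] := from w'; exists w.
  by rewrite -[P (cw w)]/(P ([::] +++ cw w)) -e /= homeo_invK.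
have [t rt [a _]] := tied_rist_C0 tg; exists t => // w.
apply: (can_inj (homeo_funK t)); rewrite /= homeo_invK.
have [w' e] := Qc_repr (g (Qc R w)).
by rewrite (hg _ _ e) (a _ _ e).
Qed.

(** The branch and its attaching point are preserved, so the cell cannot be moved
    or turned. *)
Lemma regular_branch f i : TA f -> fixes_circle f -> regular f (prim i) ->
  fcanon f (prim i) (prim i) false.
Proof.
move=> Tf fc [q [s h]]; have [bp bq hf] := h.
have Tv := TA_inv Tf; have vc := fixes_circle_inv fc.
have [|r er] := blue_cell_prefix bq bp.
- move=> u vu; have [u' vu' e] := branch_stable i Tf fc (vs_flip s vu).
  by exists u' => //; rewrite -e hf ?flipbK //; exact: vs_flip.
have [|r' er'] := blue_cell_prefix bp bq.
- move=> u vu; have [u' vu' e] := branch_stable i Tv vc vu.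
  exists (flipb s u'); first exact: vs_flip.
  by rewrite -hf // -e /= homeo_invK.
have r0 : r = [::].
  move: (er'); rewrite er -catA => /(congr1 size); rewrite !size_cat => /eqP.
  by rewrite -[X in X == _]addn0 eqn_add2l eq_sym addn_eq0 => /andP[/nilP -> _].
rewrite {}er r0 cats0 in h hf *; case: s h hf => // _ /(_ _ vs_bt).
rewrite P_prim_bt fc -P_prim_bt => /P_glue.
case/(_ ((vs_prim _ _).2 vs_bt) ((vs_prim _ _).2 (vs_flip true vs_bt)))/glue_prim => _ gl.
have : bt = flipb true bt.
  apply: plus_tail_eq gl; [exact: plus_tail_bt|by exists [:: b_plus]].
by move/(congr1 (fun t => t 0)).
Qed.

Lemma regular_rist_C0 f : TA f -> fixes_circle f -> (forall i, regular f (prim i)) ->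
  rist_C0 f.
Proof.
move=> Tf fc h; split=> //.
  apply/seteqP; split=> [_ [x /boundary_central [w ->] <-]|x /boundary_central [w ->]].
    by apply/boundary_central; exists w; rewrite fc.
  by exists (P (cw w)); [apply/boundary_central; exists w|rewrite fc].
move=> e /primary_blueP [i ->]; have pn : prim i != [::] by case: i => [[|b z]|].
apply/(extends_canon f (vw_prim i) pn); exists (prim i) => //.
have [_ _ hf] := regular_branch Tf fc (h i).
by apply/acanonP; rewrite ec_prim; split=> //; exact: vw_prim.
Qed.

(** ** Rearrangements supported on the right half *)

(** [f] is the identity outside the right half [e_R] of the Airplane. *)
Definition supported f := fixes_circle f /\
  forall i u, i != Some [::] -> vs Blue u -> f (P (prim i +++ u)) = P (prim i +++ u).

Lemma supported_mul f g : supported f -> supported g -> supported (f * g)%g.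
Proof.
move=> [cf hf] [cg hg]; split=> [w|i u ni vu] /=; first by rewrite cg cf.
by rewrite hg // hf.
Qed.

Lemma supported_inv f : supported f -> supported f^-1%g.
Proof.
move=> [cf hf]; split=> [|i u ni vu]; first exact: fixes_circle_inv.
by apply: (can_inj (homeo_funK f)); rewrite /= homeo_invK hf.
Qed.

Lemma supported_red f b u : supported f -> vs Red u ->
  f (P ([:: cl b] +++ u)) = P ([:: cl b] +++ u).
Proof.
move=> [cf hf] vu; have v : vs Blue ([:: cl b] +++ u).
  by apply/vstream_sapp; case: b.
have [[w e]|[i [u' [e vu']]]] := circle_split v; rewrite e; first exact: cf.
by apply: hf => //; apply: contraPneq e => -> /scons_inj []; case: (b).
Qed.

Lemma supported_regular f i r : supported f -> i != Some [::] -> blue r ->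
  regular f (prim i ++ r).
Proof.
move=> [_ hf] ni br; apply: regular_cat => //; exists (prim i), false.
by split; [exact: blue_prim_word|exact: blue_prim_word|move=> u vu; exact: hf].
Qed.

(** The right half meets the rest in a point fixed by [f], so [f] can be replaced there
    by the identity. *)
Lemma branch_factor f : TA f -> fixes_circle f -> exists f1,
  [/\ TA f1, supported f1 & forall u, vs Blue u ->
    f1 (P (b_plus ::: u)) = f (P (b_plus ::: u))].
Proof.
move=> Tf fc; have Tv := TA_inv Tf; have vc := fixes_circle_inv fc.
pose inside x := exists2 u, vs Blue u & x = P (prim (Some [::]) +++ u).
pose rel h x y := (inside x /\ y = h x) \/ (~ inside x /\ y = x) : Prop.
have stab h x : TA h -> fixes_circle h -> inside x -> inside (h x).
  by move=> Th hc [u vu ->]; have [u' vu' ->] := branch_stable (Some [::]) Th hc vu; exists u'.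
have tot (h : homeo Airplane) x : exists y, rel h x y.
  by have [ix|ix] := pselect (inside x); [exists (h x); left|exists x; right].
have fn (h : homeo Airplane) x y y' : rel h x y -> rel h x y' -> y = y'.
  by case=> -[ix ->] [] [ix' ->].
have inv x y : rel f x y -> rel f^-1%g y x.
  case=> -[ix ->]; last by right.
  by left; split; [exact: stab|rewrite /= homeo_funK].
have inv' x y : rel f^-1%g y x -> rel f x y.
  case=> -[ix ->]; last by right.
  by left; split; [exact: (stab f^-1%g)|rewrite /= homeo_invK].
have fix_ a u : a != b_plus -> vs Blue (a ::: u) -> inside (P (a ::: u)) ->
    f (P (a ::: u)) = P (a ::: u).
  move=> ab va [u' vu' e]; have ut : u' = bt.
    have /P_glue := e; case/(_ va ((vs_prim (Some [::]) _).2 vu'))/(glue_scons_neq ab).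
    by move=> j [s [t [_ jb _ ->]]]; case: j jb => //= -[<-].
  by rewrite e ut P_prim_bt fc.
have [n h] := tame_nonempty ((TA_tame f).1 Tf).
have [|||||f1 tf1 hf1] := @rel_homeo air (rel f).
- exact: tot.
- by move=> y; have [x /inv'] := tot f^-1%g y; exists x.
- exact: fn.
- by move=> x x' y /inv + /inv; exact: fn.
- exists n.+1 => p vp sp; case: p vp sp => // a p vp sp.
  have [ap|ap] := eqVneq a b_plus.
    have [|_ [q qn /acanonP [vq eq hq]]] := h _ vp; first by rewrite sp.
    exists q; split=> // u vu; left; split; last by rewrite hq.
    exists (p +++ u); last by rewrite ap.
    by have : vs Blue ((a :: p) +++ u) by [apply/vstream_sapp]; rewrite ap => /vstream_scons [].
  exists (a :: p); split=> // u vu.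
  have va : vs Blue ((a :: p) +++ u) by apply/vstream_sapp.
  have [ix|ix] := pselect (inside (P ((a :: p) +++ u))); last by right.
  by left; split=> //; rewrite [RHS](fix_ a (p +++ u)).
exists f1; split; first exact/TA_tame.
  split=> [w|i u ni vu].
    by case: (hf1 (P (cw w))) => -[_ ->] //; exact: fc.
  case: (hf1 (P (prim i +++ u))) => [[[u' vu' e] _]|[_ ->] //].
  have := (P_glue ((vs_prim _ _).2 vu) ((vs_prim _ _).2 vu')).1 e.
  by move=> /glue_prim [ei]; rewrite ei eqxx in ni.
move=> u vu; case: (hf1 (P (b_plus ::: u))) => -[ix ->] //.
by case: ix; exists u.
Qed.

Lemma agree_regular f g p : (forall u, vs Blue u -> f (P (p +++ u)) = g (P (p +++ u))) ->
  regular f p -> regular g p.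
Proof. by move=> e [q [s [bp bq h]]]; exists q, s; split=> // u vu; rewrite -e // h. Qed.

(** The cells of the right half of the airplane that shrink to its attaching
    point. *)
Definition neck (j : nat) : word := p_minus ++ nseq j b_plus.

Lemma nseq_rcons (T : Type) (a : T) j : nseq j.+1 a = rcons (nseq j a) a.
Proof. by elim: j => //= j <-. Qed.

Lemma blue_nseq j : blue (nseq j b_plus).
Proof. by elim: j => // j [v e]; split=> //=. Qed.

Lemma blue_neck j : blue (neck j).
Proof. by apply/blue_cat => //; exact: blue_nseq. Qed.

Lemma neck_suffix q c i j : q ++ c :: nseq i b_plus = neck j ->
  (exists j', q = neck j' /\ c = b_plus) \/ q = [:: b_plus] /\ i = j /\ c = b_minus.
Proof.
have pm : p_minus = rcons [:: b_plus] b_minus by [].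
elim: i j => [|i IH] [|j]; rewrite /neck ?nseq_rcons -?rcons_cons -?rcons_cat.
- by rewrite cats0 cats1 pm => /rcons_inj [-> ->]; right.
- by rewrite cats1 => /rcons_inj [-> ->]; left; exists j.
- by rewrite cats0 pm => /rcons_inj [].
move=> /rcons_inj [/IH]; case=> [|[-> [-> ->]]]; first by left.
by right.
Qed.

Lemma neck_zero_suffix q c i : q ++ c :: nseq i b_plus = neck 0 -> q = [:: b_plus].
Proof.
move=> e; have [[j [eq _]]|[]] // := neck_suffix e.
by move: e; rewrite eq => /(congr1 size); rewrite /neck !size_cat /= !addSn addnS.
Qed.

Lemma not_half f s : TA f -> fixes_circle f -> ~ fcanon f p_minus [:: b_plus] s.
Proof.
move=> Tf fc [_ _ h]; have [|||r] // := @blue_cell_prefix [:: b_plus] p_minus.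
move=> u vu; have [u' vu' e] := branch_stable (Some [::]) Tf fc vu.
exists (flipb s u'); first exact: vs_flip.
apply: (can_inj (homeo_funK f)); rewrite [LHS]e h ?flipbK //; exact: vs_flip.
Qed.

Lemma cst_suffix (T : eqType) (a : T) r : cst a = r +++ cst a -> r = nseq (size r) a.
Proof. by elim: r => //= b r IH; rewrite {1}cstE => /scons_inj [<- /IH {1}->]. Qed.

(** [f] fixes the attaching point of the right half, which has a single blue address,
    so a deep cell shrinking to it is moved to another such cell. *)
Lemma neck_canonical f : TA f -> supported f -> exists i j, fcanon f (neck j) (neck i) false.
Proof.
move=> /TA_tame /tame_nonempty [n h] [fc _].
have [bn en] := blue_neck n.
have [|_ [q qn /acanonP]] := h (neck n) bn.
  by rewrite /neck size_cat size_nseq leq_addl.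
rewrite en => -[vq eq hq]; have bq : blue q by [].
have := hq _ vs_plus.
have e m : neck m +++ cst b_plus = prim (Some [::]) +++ bt.
  by rewrite /neck sapp_cat sapp_nseq_cst.
have pt r : plus_tail (r +++ cst b_plus) by exists r.
have v0 := (blue_vs _ (blue_neck 0)).2 vs_plus; have vqp := (blue_vs _ bq).2 vs_plus.
rewrite e P_prim_bt fc -P_prim_bt -(e 0) => /((P_glue v0 vqp).1).
move/(plus_tail_eq (pt _) (pt _)).
move=> eqt; suff [i ei] : exists i, q = neck i.
  by exists i, n; split=> //; [exact: blue_neck|rewrite -ei].
have [s|s] := leqP (size (neck 0)) (size q).
  by have [r -> /cst_suffix ->] := sapp_prefix eqt s; exists (size r); rewrite /neck cats0.
have [r er /cst_suffix ern] := sapp_prefix (esym eqt) (ltnW s).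
move: s er; rewrite ern; case: (size r) => [|k]; first by rewrite cats0 => + e1; rewrite e1 ltnn.
by case: q {hq qn vq eq bq eqt vqp} => [|? [|? ?]] // _; case: k {ern} => [|k] [].
Qed.

(** Regularity at [neck 0] would force the image of this cell to be the whole right
    half, which [f] preserves. *)
Lemma neck_zero_singular f j : TA f -> fixes_circle f ->
  fcanon f (neck j.+1) (neck 0) false -> singular f (neck 0).
Proof.
move=> Tf fc h; split=> // -[q [s hq]].
have := fcanon_cat hq (blue_nseq j.+1); rewrite {1}/neck cats0 -/(neck j.+1).
move/fcanon_fun/(_ h) => e.
have eq : q = [:: b_plus].
  by case: s {hq} e => /=; exact: neck_zero_suffix.
by apply: (@not_half f s Tf fc); rewrite -eq.
Qed.

Lemma singular_prefix f p r : singular f (p ++ r) -> p != [::] -> blue p -> singular f p.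
Proof.
move=> [_ b nr] pn bp; split=> // reg; apply: nr; apply: regular_cat => //.
exact: ((blue_cat r bp).1 b).
Qed.

Section Generated.
Variable R : realType.
Variable M : set (homeo Airplane).
Hypothesis sM : subgroup M.
Hypothesis MT : M `<=` TA.
Hypothesis MC : rist_C0 `<=` M.
Hypothesis MH : rist_Hor `<=` M.

Let MM f g : M f -> M g -> M (f * g)%g. 
Proof. by have [_ + _] := (subgroupP _).1 sM; apply. Qed.
Let MV f : M f -> M f^-1%g. Proof. by have [_ _] := (subgroupP _).1 sM; apply. Qed.

Section Step.
Variable k : nat.
Hypothesis IH : forall f, TA f -> cplx f k -> M f.

Lemma regular_plus f : TA f -> supported f -> regular f [:: b_plus] -> M f.
Proof.
move=> Tf sf rf; apply/MC/regular_rist_C0 => //; first by case: sf.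
move=> i; have [->//|ni] := eqVneq i (Some [::]).
by have := supported_regular sf ni blue_nil; rewrite cats0.
Qed.

Lemma support_base f : TA f -> supported f -> cplx f k.+1 ->
  fcanon f (neck 0) (neck 0) false -> M f.
Proof.
move=> Tf sf kf cf; have [rf|nf] := pselect (regular f [:: b_plus]); first exact: regular_plus.
have [x [rx [x1 x2 x3] [xr1 xr2] sx sxV]] := unslide_element R.
have Mx := MH rx.
(* The image under [x] of the right half meets both halves, so it lies in no
   proper cell. *)
have xplus g : TA g -> fixes_circle g -> singular (x * g)%g [:: b_plus].
  move=> Tg fg; split=> // -[q [s h]]; have [_ bq hq] := h.
  have inq v : vs Blue v -> exists2 v', vs Blue v' & x (P ([:: b_plus] +++ v)) = P (q +++ v').
    move=> vv; have [v' vv' e] := branch_stable (Some [::]) (TA_inv Tg) (fixes_circle_inv fg) vv.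
    exists (flipb s v'); first exact: vs_flip.
    rewrite -hq //; congr (x _); apply: (can_inj (homeo_funK g^-1%g)).
    by rewrite [LHS]e /= homeo_funK.
  have [|||r er] := @blue_cell_prefix [:: b_plus] q => //.
    move=> u vu; have [|v' vv' e] := inq (b_plus ::: u); first by apply/vstream_scons.
    by exists v' => //; rewrite -e; have [_ _ ->] := x1.
  have [|||r' er'] := @blue_cell_prefix [:: b_minus; b_minus] q => //.
    move=> u vu; have [|v' vv' e] := inq (b_minus ::: flipb true u).
      by apply/vstream_scons; split=> //; exact: vs_flip.
    exists v' => //; rewrite -e; have [_ _ hx] := x2.
    by have := hx _ (vs_flip true vu); rewrite flipbK.
  have q0 : q = [::] by case: q er er' {h bq hq inq} => // a q [<-].
  by rewrite q0 in h; have := fcanon_whole h.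
have [|||||s sk hs] := @cplx_right x f k.+1 [:: [:: b_plus]] [:: [:: b_minus]] => //.
- move=> q; rewrite inE => /eqP ->; rewrite -(mulg1 x); apply: xplus => //.
  by case: ((subgroupP _).1 TA_subgroup).
- by move=> q; rewrite inE => /eqP ->; split.
- by move=> q /sxV ->; rewrite inE.
(* The only singular cell of the inverse of [x] is the left half, on which the
   conjugate [y] is the identity. *)
pose y := (x * (f * x^-1))%g.
have Tx := MT Mx; have Ty : TA y by apply: TA_mul => //; apply: TA_mul => //; exact: TA_inv.
have ky : cplx y k.
  exists s => // p sp.
  have : singular (f * x^-1)%g p.
    apply: singular_left sp => q /sx ->; rewrite invgM invgK; apply: xplus; first exact: TA_inv.
    by apply: fixes_circle_inv; case: sf.
  move=> /hs; rewrite /= inE => /orP [/eqP ep|//]; exfalso.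
  have [_ _] := sp; apply; exists [:: b_minus], false; rewrite ep; split=> // u vu.
  suff e : f (x^-1%g (P ([:: b_minus] +++ u))) = x^-1%g (P ([:: b_minus] +++ u)).
    by rewrite /y /= in e *; rewrite e homeo_invK.
  move: vu; rewrite (scons_eta u) => /vstream_scons [oka].
  move: (u 0) (sdrop 1 u) oka => a v oka vv.
  have red b : a = cl b -> f (x^-1%g (P ([:: b_minus] +++ a ::: v))) =
      x^-1%g (P ([:: b_minus] +++ a ::: v)).
    move=> ea; have vr : vs Red v by move: vv; rewrite ea; case: (b).
    have e : x^-1%g (P ([:: b_minus] +++ a ::: v)) = P ([:: cl (~~ b)] +++ v).
      apply: (can_inj (homeo_funK x)); rewrite /= homeo_invK.
      by have := xr2 (~~ b) v vr; rewrite negbK ea => /esym.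
    by rewrite e; exact: supported_red.
  case: a oka vv red => // _ vv red.
  - have [_ _ /(_ v vv) e] := fcanon_inv x2; rewrite [x^-1%g _]e.
    by have [_ _ ->] := cf => //; exact: vs_flip.
  - have [_ _ /(_ v vv) e] := fcanon_inv x3; rewrite [x^-1%g _]e.
    by have [_ /(_ None v isT vv)] := sf.
  - exact: red true erefl.
  - exact: red false erefl.
have -> : f = (x^-1 * (y * x))%g by rewrite /y -!mulgA mulVg mulg1 mulKg.
by apply: MM; [exact: MV|apply: MM => //; exact: IH].
Qed.

Lemma supported_slide1 : exists z, [/\ M z, supported z,
  forall j, fcanon z (neck j.+1) (neck j) false,
  forall q, singular z q -> q \in [:: [:: b_plus]; neck 0] &
  forall q, singular z^-1%g q -> q \in [:: [:: b_plus]; [:: b_plus; b_plus]]].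
Proof.
have [z [rz [z1 _ z4] [_ zr2] sz szV]] := slide1_element R.
exists z; split; first exact: MH.
- split=> [w|i u ni vu]; first exact: (zr2 (w 0) _ (vs_rw _ erefl)).
  case: i ni => [[|b y]|] // _; last by have [_ _ /(_ u vu)] := z4.
  rewrite prim_cons; apply: zr2.
  have := (vs_prim (Some (b :: y)) u).2 vu; rewrite prim_cons => /vstream_scons [_].
  by case: b.
- by move=> j; exact: (fcanon_cat z1 (blue_nseq j)).
- by move=> q /sz [] ->; rewrite !inE eqxx ?orbT.
- by move=> q /szV [] ->; rewrite !inE eqxx ?orbT.
Qed.

Lemma support_zero j f : TA f -> supported f -> cplx f k.+1 ->
  fcanon f (neck j) (neck 0) false -> M f.
Proof.
have [z [Mz sz cz szs szV]] := supported_slide1; have Tz := MT Mz.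
elim: j f => [|j IHj] f Tf sf kf cf; first exact: support_base.
(* The two singular cells of [z] are singular for [f], so they are traded for those
   of the inverse. *)
suff Mg : M (f * z^-1)%g by rewrite -(mulgVK z f); exact: MM.
have sing g : TA g -> supported g -> fcanon g (neck j.+1) (neck 0) false ->
    forall q, q \in [:: [:: b_plus]; neck 0] -> singular g q.
  move=> Tg [sg _] cg q; have s0 := neck_zero_singular Tg sg cg.
  rewrite !inE => /orP [] /eqP -> //.
  exact: (@singular_prefix g [:: b_plus] [:: b_minus]).
have [|||||s sk hs] := @cplx_right z f k.+1 [:: [:: b_plus]; neck 0]
    [:: [:: b_plus]; [:: b_plus; b_plus]] => //.
- move=> q; rewrite !inE => /orP [] /eqP ->; last first.
    by apply: (@neck_zero_singular z 0) => //; case: sz.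
  apply: (@singular_prefix z [:: b_plus] [:: b_minus]) => //.
  by apply: (@neck_zero_singular z 0) => //; case: sz.
- exact: sing.
apply: IHj.
- by apply: TA_mul => //; exact: TA_inv.
- by apply: supported_mul => //; exact: supported_inv.
- by exists ([:: [:: b_plus]; [:: b_plus; b_plus]] ++ s); rewrite ?size_cat.
- exact: fcanon_comp (fcanon_inv (cz j)) cf.
Qed.

Lemma support_any i j f : TA f -> supported f -> cplx f k.+1 ->
  fcanon f (neck j) (neck i) false -> M f.
Proof.
have [z [Mz sz cz szs _]] := supported_slide1; have Tz := MT Mz.
elim: i f => [|i IHi] f Tf sf kf cf; first exact: support_zero cf.
(* If the inverse of [f] moves [neck 0] canonically, then [f] moves some [neck j']
   to [neck 0]; otherwise composing with [z] creates no singular cell. *)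
have [rg|ng] := pselect (regular f^-1%g (neck 0)).
  have [q [s h]] := rg; have := fcanon_cat h (blue_nseq i.+1).
  rewrite {1}/neck cats0 -/(neck i.+1) => /fcanon_fun /(_ (fcanon_inv cf)) e.
  have e' : q ++ (if s then b_minus else b_plus) :: nseq i b_plus = neck j.
    by rewrite -e; case: (s).
  have [[j' [eq ec]]|[eq _]] := neck_suffix e'.
    case: s h ec {e e'} => // h _; apply: (@support_zero j') => //.
    by have := fcanon_inv h; rewrite eq invgK.
  exfalso; apply: (@not_half f^-1%g s); [exact: TA_inv| |by rewrite -eq].
  by apply: fixes_circle_inv; case: sf.
have sg : singular f^-1%g (neck 0) by split.
suff Mg : M (z * f)%g by rewrite -(mulKg z f); apply: MM => //; exact: MV.
apply: IHi.
- exact: TA_mul.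
- exact: supported_mul.
- apply: cplx_left kf => q /szs; rewrite !inE => /orP [] /eqP -> //.
  exact: (@singular_prefix _ [:: b_plus] [:: b_minus]).
- exact: fcanon_comp cf (cz i).
Qed.

Lemma supported_in f : TA f -> supported f -> cplx f k.+1 -> M f.
Proof.
by move=> Tf sf kf; have [i [j cf]] := neck_canonical Tf sf; exact: support_any cf.
Qed.

End Step.

Lemma rist_C0_fixes_circle t f : rist_C0 t -> fixes_circle f -> fixes_circle (t * f * t^-1)%g.
Proof.
move=> rt fc w; have [g tg tt] := rist_C0_tied R rt; have [a _] := tiedC_inv tt.
have [w' e] := Qc_repr (g^-1%g (Qc R w)).
by rewrite /= in a *; rewrite (a _ _ e) fc -(a _ _ e) homeo_invK.
Qed.

(** ** The induction *)

(** It is enough to treat rearrangements fixing the central circle. *)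
Lemma regularize f k : TA f -> cplx f k -> (forall h, TA h -> fixes_circle h -> cplx h k -> M h) ->
  M f.
Proof.
move=> Tf kf H; have [q cq] := comp_map_exists Tf.
have [g [Mg kg cg]] := move_center R sM MC MH kf cq.
have [t rt fc] := central_circle_fixed R (TA_mul (MT Mg) Tf) cg.
have Mt := MC rt.
have -> : f = (g^-1 * (t * (t^-1 * (g * f))))%g by rewrite mulVKg mulKg.
apply: MM; first exact: MV.
apply: MM => //; apply: H => //.
  by apply: TA_mul; [exact/TA_inv/MT|apply: TA_mul => //; exact: MT].
apply: cplx_left kg => p; suff rtV : rist_C0 t^-1%g by move=> /(rist_C0_regular R rtV).
by have [_ _] := (subgroupP _).1 (rist_C0_subgroup R); apply.
Qed.

Lemma in_subgroup k f : TA f -> cplx f k -> M f.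
Proof.
elim: k f => [|k IH] f Tf kf; apply: (regularize Tf kf) => {Tf kf}f Tf fc kf;
  (have [reg|] := pselect (forall i, regular f (prim i)); first by apply/MC/regular_rist_C0);
  move=> /existsNP [i ni];
  (have si : singular f (prim i) by split; [case: (i) => [[|? ?]|]|exact: blue_prim_word|]).
  by have [[|//] _ /(_ _ si)] := kf.
have [t rt ct] := conn_plus R i; have Mt := MC rt.
have rtV : rist_C0 t^-1%g by have [_ _] := (subgroupP _).1 (rist_C0_subgroup R); apply.
pose y := (t * f * t^-1)%g.
suff My : M y.
  rewrite (_ : f = t^-1 * (y * t))%g; last by rewrite /y mulgVK mulKg.
  by apply: MM; [exact: MV|exact: MM].
have Ty : TA y by apply: TA_mul; [apply: TA_mul => //; exact: MT|exact/TA_inv/MT].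
have yc : fixes_circle y := rist_C0_fixes_circle rt fc.
have ky : cplx y k.+1.
  have [|||||s sk hs] := @cplx_right t (t * f)%g k.+1 [::] [::] => //.
  - by move=> q /(rist_C0_regular R rtV).
  - by apply: cplx_left kf => q /(rist_C0_regular R rt).
  by exists s.
have sy : singular y [:: b_plus].
  split=> // reg; apply: ni; have cy := regular_branch (i := Some [::]) Ty yc reg.
  have := fcanon_comp (fcanon_comp ct cy) (fcanon_inv ct).
  have -> : (t^-1 * (y * t))%g = f by rewrite /y mulgVK mulKg.
  by move=> c; do 2 eexists; exact: c.
(* The factor [f1] is supported on the right half; the other one is the identity
   there, so it has at least one singular cell less. *)
have [f1 [T1 s1 e1]] := branch_factor Ty yc.
have k1 : cplx f1 k.+1.
  have [s sk hs] := ky; exists s => // p [pn bp nr]; apply: hs; split=> // reg; apply: nr.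
  have [j [r er]] := blue_prim bp.1 bp.2 pn; rewrite er in bp reg *.
  have br := (blue_cat r (blue_prim_word j)).1 bp.
  have [ej|nj] := eqVneq j (Some [::]); last exact: supported_regular.
  rewrite ej in reg *; apply: agree_regular reg => u vu /=.
  by rewrite e1 //; apply/blue_vs.
have M1f : M f1 := supported_in IH T1 s1 k1.
suff My' : M (y * f1^-1)%g by rewrite -(mulgVK f1 y); exact: MM.
apply: IH; first by apply: TA_mul => //; exact: TA_inv.
have s1V := supported_inv s1.
have [s sk hs] := ky.
have out p : singular (y * f1^-1)%g p -> p \in [seq q <- s | q != [:: b_plus]].
  move=> [pn bp nr]; have [j [r er]] := blue_prim bp.1 bp.2 pn.
  have br : blue r by apply/(blue_cat r (blue_prim_word j)); rewrite -er.
  have [ej|nj] := eqVneq j (Some [::]).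
    case: nr; rewrite er ej; apply: regular_cat => //.
    exists [:: b_plus], false; split=> // u vu.
    have [u' vu' e] := branch_stable (Some [::]) (TA_inv T1) s1V.1 vu.
    rewrite [LHS](_ : _ = y (f1^-1%g (P ([:: b_plus] +++ u)))) // [f1^-1%g _]e.
    by rewrite [LHS](esym (e1 u' vu')) -[P (b_plus ::: u')]e /= homeo_invK.
  rewrite mem_filter; apply/andP; split.
    by rewrite er; case: (j) nj => [[|[] ?]|].
  apply: hs; split=> // reg; apply: nr; apply: agree_regular reg => u vu /=.
  rewrite er sapp_cat [homeo_inv f1 _]s1V.2 //.
  by apply/blue_vs.
exists [seq q <- s | q != [:: b_plus]] => //.
rewrite -ltnS (leq_trans _ sk) // -(count_predC (pred1 [:: b_plus]) s) size_filter.
rewrite -add1n leq_add2r -has_count; apply/hasP; exists [:: b_plus] => //=.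
exact: hs.
Qed.

End Generated.

(** The real numbers [R] provide the interval and the circle through which elements of
    the rigid stabilizers are built. *)
Lemma TA_generated : realType -> TA = generated (rist_C0 `|` rist_Hor).
Proof.
move=> R; pose S := rist_C0 `|` rist_Hor; pose M := generated S.
have SM : S `<=` M by exact: sub_gen_smallest.
have sM : subgroup M.
  apply/subgroupP; split=> [N [sN _]|x y Mx My N HN|x Mx N HN].
  - by have [] := (subgroupP _).1 sN.
  - by have [_ + _] := (subgroupP _).1 HN.1; apply; [exact: Mx|exact: My].
  - by have [_ _] := (subgroupP _).1 HN.1; apply; exact: Mx.
have MT : M `<=` TA.
  apply: smallest_sub; first exact: TA_subgroup.
  by move=> f [[]|[]].
apply/seteqP; split=> // f Tf; have [k kf] := cplx_exists Tf.
apply: (in_subgroup R sM MT _ _ Tf kf) => g rg; apply: SM; [by left|by right].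
Qed.

Theorem mainTheorem2 (R : realType) :
  [/\ TA = generated (rist_C0 `|` rist_Hor),
      isomorphic rist_C0 (thompson_T R)
    & isomorphic rist_Hor (thompson_F R)].
Proof.
by split; [exact: TA_generated R|exact: rist_C0_iso|exact: rist_Hor_iso].
Qed.
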